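(* Let $d\ge 1$ be an integer, let $M_d(z)=\sum_{n\ge1}\mu_d(n)z^n$, and let $s>0$ be the smallest positive real number such that $M_d'(s)=0$. Then, as $n\to\infty$, $$s_d(n)\sim\frac{1}{\sqrt{-2\pi M_d''(s)}}\;n^{-3/2}\;M_d(s)^{\frac12-n}.$$
   Context: Write $[n]=\{1,\dots,n\}$. A region is an open box $R=(a_1,b_1)\times\cdots\times(a_d,b_d)\subseteq(0,1)^d$. For $i\in[d]$ and an integer $p\ge 2$, put $c_j=a_i+\frac{j}{p}(b_i-a_i)$ for $0\le j\le p$ and $H_{i,p}(R)=\{\{x\in R: c_{j-1}<x_i<c_j\}: j\in[p]\}$. The set $\mathcal S_d$ of decompositions of $(0,1)^d$ is defined recursively as the smallest set such that $\{(0,1)^d\}\in\mathcal S_d$, and whenever $S\in\mathcal S_d$, $R\in S$, $i\in[d]$, $p\ge2$, then $(S\setminus\{R\})\cup H_{i,p}(R)\in\mathcal S_d$. Let $\mathcal S_{d,n}=\{S\in\mathcal S_d:|S|=n\}$ and $s_d(n)=|\mathcal S_{d,n}|$. Let $\mu$ be the classical Möbius function and $(\alpha\ast\beta)(n)=\sum_{i\mid n}\alpha(i)\beta(n/i)$ the Dirichlet convolution; $\mu_d=\mu\ast\cdots\ast\mu$ ($d$ factors). Here $M_d$ is viewed as the function defined by its power series inside its disc of convergence. The notation $f(n)\sim g(n)$ means $f(n)/g(n)\to1$. *)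

(* Defs.v *)
From HB Require Import structures.
From mathcomp Require Import all_boot all_order all_algebra.
From mathcomp Require Import finmap.
From mathcomp Require Import all_classical all_reals all_analysis.

Set Implicit Arguments.
Unset Strict Implicit.
Unset Printing Implicit Defensive.

Import Order.TTheory GRing.Theory Num.Theory.
Import numFieldNormedType.Exports.

Local Open Scope classical_set_scope.
Local Open Scope ring_scope.

Definition box (R : realType) (d : nat) (a b : 'rV[R]_d) : set 'rV[R]_d :=
  [set x | forall i, a 0 i < x 0 i < b 0 i].

Definition unit_cube (R : realType) (d : nat) : set 'rV[R]_d :=
  box (const_mx 0) (const_mx 1).

Definition cut_point (R : realType) (d : nat) (a b : 'rV[R]_d) (i : 'I_d)
    (p j : nat) : R :=
  a 0 i + j%:R / p%:R * (b 0 i - a 0 i).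

(* The set H_{i,p}(R) for the region R = box a b; the indices j run over
   1, ..., p. *)
Definition split_box (R : realType) (d : nat) (i : 'I_d) (p : nat)
    (a b : 'rV[R]_d) : set (set 'rV[R]_d) :=
  [set [set x | box a b x /\
                cut_point a b i p j.-1 < x 0 i < cut_point a b i p j]
  | j in [set j : nat | (1 <= j <= p)%N]].

(* Regions are sets of points, and decompositions are sets of regions, so two
   different sequences of splits can produce the same decomposition. *)
Inductive decomposition (R : realType) (d : nat) :
    set (set 'rV[R]_d) -> Prop :=
| decomposition_cube : decomposition [set @unit_cube R d]
| decomposition_split (S : set (set 'rV[R]_d)) (a b : 'rV[R]_d)
    (i : 'I_d) (p : nat) :
    decomposition S ->
    (forall k, a 0 k < b 0 k) -> S (box a b) -> (2 <= p)%N ->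
    decomposition ((S `\` [set box a b]) `|` split_box i p a b).

Definition decompositions_of_size (R : realType) (d n : nat) :
    set (set (set 'rV[R]_d)) :=
  [set S | decomposition S /\ (S #= `I_n)%card].

(* [fset_set] is empty on infinite sets, but [decompositions_of_size R d n] is
   always finite: every split increases the number of regions. *)
Definition num_decompositions (R : realType) (d n : nat) : nat :=
  #|` fset_set (@decompositions_of_size R d n)|%fset.

(* Arithmetic functions are functions on nat that are meaningful at positive
   integers only; [mobius], [dirichlet a b] and [mobius_pow d] are 0 at 0. *)
Definition mobius (n : nat) : int :=
  if (0 < n)%N && all (fun p => logn p n == 1%N) (primes n)
  then (-1) ^+ size (primes n) else 0.

Definition dirichlet (a b : nat -> int) (n : nat) : int :=
  \sum_(i <- divisors n) a i * b (n %/ i)%N.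

(* The d-fold convolution mobius * ... * mobius (the unit for d = 0). *)
Definition mobius_pow (d : nat) : nat -> int :=
  iterop d dirichlet mobius (fun n => (n == 1%N)%:Z).

Definition mobius_coef (R : realType) (d : nat) : R^nat :=
  fun n => (mobius_pow d n)%:~R.

(* The index 0 contributes nothing to this series.  The value is meaningful
   only inside the disc of convergence. *)
Definition mobius_series (R : realType) (d : nat) (z : R) : R :=
  limn (pseries (@mobius_coef R d) z).

Definition convergence_radius (R : realType) (f : R^nat) : \bar R :=
  ereal_sup [set `|x|%:E | x in [set x : R | cvgn (pseries f x)]].

Definition positive_critical_point (R : realType) (d : nat) (t : R) : Prop :=
  [/\ 0 < t,
      (t%:E < convergence_radius (@mobius_coef R d))%E
    & derive1 (@mobius_series R d) t = 0].

Definition smallest_critical_point (R : realType) (d : nat) (s : R) : Prop :=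
  positive_critical_point d s /\
  (forall t : R, positive_critical_point d t -> s <= t).

Definition asymp_equiv (R : realType) (f g : R^nat) : Prop :=
  (fun n => f n / g n) @ \oo --> (1 : R).

(* Main.v *)
(* Let F be the generating series of s_d.  If a prime p divides the number of
   subdivisions of the i-th axis at every region of a decomposition, then the
   decomposition can be started by a cut into p slabs along that axis.
   Hence the decompositions refining the q_1 x ... x q_d grid have generating
   series F ^ (q_1 ... q_d).  Only the uncut cube refines no other grid than
   the trivial one, so Moebius inversion over the grids gives M_d o F = X.

   The asymptotics are extracted by real analysis.  With m = M_d(s X) / M_d(s)
   and a_n = s_d(n) M_d(s)^n / s, one has m o a = X, m(1) = 1 and m'(1) = 0.
   Write m' = (1 - X) L, 1 - m = (1 - X)^2 Q and E = Q / L^2.  When the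
   coefficients of L after the first one have absolute sum at most q L_0 with
   q < 1/2, the series 1 / L is absolutely summable and 1 / ((1 - X) L) has
   nonnegative coefficients.  Then a has sum 1, and f = a' satisfies
   (1 - X) f^2 = E o a.  Consequently b = (1 - X)^(1/2) f is absolutely
   summable, b(1)^2 = E(1) = - 1 / (2 m''(1)), and f = (1 - X)^(-1/2) b implies
   f_n ~ b(1) binom(2n, n) / 4^n.  The bound on L is checked numerically for
   d = 1, for d = 2, and uniformly for d >= 3. *)
Require Import Defs.
From HB Require Import structures.
From mathcomp Require Import all_boot all_order all_algebra.
From mathcomp Require Import ring lra zify.
From mathcomp Require Import finmap.
From mathcomp Require Import all_classical all_reals all_analysis.
Set Implicit Arguments.
Unset Strict Implicit.
Unset Printing Implicit Defensive.
Import Order.TTheory GRing.Theory Num.Theory.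
Import numFieldNormedType.Exports.
Local Open Scope classical_set_scope.
Local Open Scope ring_scope.

(** * Formal power series *)

(** Singularity analysis of an inverse function works in the complex plane and must exclude other
    singularities on the circle of convergence. Here positivity does this work: as 1 / m' has
    nonnegative coefficients, f = (1 / m')(a) is bounded by values on [0, 1], and a mean value
    argument on partial sums shows that a converges at 1 although its radius is not known
    beforehand. The threshold 1/2 comes from there: if the coefficients of L / L_0 after the first
    have mass q, those of its inverse have mass at most q / (1 - q), and the partial sums of the
    inverse stay nonnegative when this is at most 1. The coefficients of b have no evident sign, so
    their decay needs another argument. With m'(a) a' = 1, the derivative of b^2 = E(a) gives 2 b' =
    (1 - X)^(-1/2) E'(a). The coefficients of E'(a) are summable and O(1/n), hence those of b are
    O(n^(-3/2)). On the combinatorial side primes matter because a composite divisor can be shared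
    between the first cut and the cuts below it; composite grids are reached one prime factor at a
    time. *)

Definition fps (R : comNzRingType) : Type := nat -> R.

Section FormalPowerSeries.
Variable R : comNzRingType.
Implicit Types a b c F P Q : fps R.

HB.instance Definition _ := gen_eqMixin (fps R).
HB.instance Definition _ := gen_choiceMixin (fps R).

Definition fps_const (x : R) : fps R := fun n => if n is 0%N then x else 0.
Definition fps_add a b : fps R := fun n => a n + b n.
Definition fps_opp a : fps R := fun n => - a n.
(** The Cauchy product. [fps] is a name of its own because plain functions already carry the
    pointwise product. *)
Definition fps_mul a b : fps R := fun n => \sum_(i < n.+1) a i * b (n - i)%N.

(** Coefficient n of a product depends only on the truncations at n + 1, so the ring laws, the
    Leibniz rule and the multiplicativity of composition are inherited from polynomials. *)
Definition fps_trunc N a : {poly R} := \poly_(i < N) a i.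

Let coef_trunc N a n : (n < N)%N -> (fps_trunc N a)`_n = a n.
Proof. by move=> h; rewrite coef_poly h. Qed.

Let fps_mulE a b N n : (n < N)%N ->
  fps_mul a b n = (fps_trunc N a * fps_trunc N b)`_n.
Proof.
move=> h; rewrite coefM; apply: eq_bigr => i _.
by rewrite !coef_trunc// (leq_ltn_trans _ h)// ?leq_subr// -ltnS ltn_ord.
Qed.

Fact fps_addA : associative fps_add.
Proof. by move=> a b c; apply/funext => n; rewrite /fps_add addrA. Qed.
Fact fps_addC : commutative fps_add.
Proof. by move=> a b; apply/funext => n; rewrite /fps_add addrC. Qed.
Fact fps_add0 : left_id (fps_const 0) fps_add.
Proof. by move=> a; apply/funext => -[|n]; rewrite /fps_add /= add0r. Qed.
Fact fps_addN : left_inverse (fps_const 0) fps_opp fps_add.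
Proof.
by move=> a; apply/funext => -[|n]; rewrite /fps_add /fps_opp /= addNr.
Qed.
HB.instance Definition _ :=
  GRing.isZmodule.Build (fps R) fps_addA fps_addC fps_add0 fps_addN.

Fact fps_mulC : commutative fps_mul.
Proof.
by move=> a b; apply/funext => n; rewrite !(fps_mulE _ _ (ltnSn n)) mulrC.
Qed.
Fact fps_mulA : associative fps_mul.
Proof.
move=> a b c; apply/funext => n; set t := fps_trunc n.+1.
transitivity ((t a * t b * t c)`_n); last first.
  rewrite coefM; apply: eq_bigr => i _.
  by rewrite -fps_mulE// coef_trunc// ltnS leq_subr.
rewrite -mulrA coefM; apply: eq_bigr => i _.
by rewrite -fps_mulE ?coef_trunc// ltnS leq_subr.
Qed.
Fact fps_mul1 : left_id (fps_const 1) fps_mul.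
Proof.
move=> a; apply/funext => n; rewrite /fps_mul big_ord_recl mul1r subn0 big1 ?addr0//.
by move=> i _; rewrite mul0r.
Qed.
Fact fps_mulDl : left_distributive fps_mul fps_add.
Proof.
move=> a b c; apply/funext => n; rewrite /fps_mul /fps_add -big_split.
by apply: eq_bigr => i _; rewrite mulrDl.
Qed.
Fact fps_1neq0 : fps_const 1 != fps_const 0.
Proof. by apply/eqP => /(congr1 (fun f => f 0%N)) /eqP; rewrite oner_eq0. Qed.
HB.instance Definition _ :=
  GRing.Zmodule_isComNzRing.Build (fps R)
    fps_mulA fps_mulC fps_mul1 fps_mulDl fps_1neq0.

Lemma fps0E n : (0 : fps R) n = 0. Proof. by case: n. Qed.
Lemma fps1E n : (1 : fps R) n = (n == 0%N)%:R. Proof. by case: n. Qed.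
Lemma fpsDE a b n : (a + b) n = a n + b n. Proof. by []. Qed.
Lemma fpsNE a n : (- a) n = - a n. Proof. by []. Qed.
Lemma fpsBE a b n : (a - b) n = a n - b n. Proof. by []. Qed.
Lemma fpsME a b n : (a * b) n = \sum_(i < n.+1) a i * b (n - i)%N.
Proof. by []. Qed.
Lemma fpsMn a k n : (a *+ k) n = a n *+ k.
Proof. by elim: k => [|k IH]; rewrite ?mulr0n ?fps0E// !mulrS fpsDE IH. Qed.
Lemma fps_sumE I (r : seq I) (Q : pred I) (f : I -> fps R) n :
  (\sum_(i <- r | Q i) f i) n = \sum_(i <- r | Q i) f i n.
Proof.
elim/big_rec2: _ => [|i x y _ <-]; first by rewrite fps0E.
by rewrite fpsDE.
Qed.
Lemma fpsM0 a b : (a * b) 0%N = a 0%N * b 0%N.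
Proof. by rewrite fpsME big_ord_recl big_ord0 addr0. Qed.

Fact fps_const_is_zmod : zmod_morphism fps_const.
Proof. by move=> x y; apply/funext => -[|n] //=; rewrite fpsBE /= subr0. Qed.
HB.instance Definition _ :=
  GRing.isZmodMorphism.Build _ _ fps_const fps_const_is_zmod.
Lemma fps_constM x a n : (fps_const x * a) n = x * a n.
Proof.
rewrite fpsME big_ord_recl subn0 big1 ?addr0//= => i _; exact: mul0r.
Qed.
Fact fps_const_is_monoid : monoid_morphism fps_const.
Proof.
split=> // x y; apply/funext => n; rewrite fps_constM.
by case: n => //= n; rewrite mulr0.
Qed.
HB.instance Definition _ :=
  GRing.isMonoidMorphism.Build _ _ fps_const fps_const_is_monoid.

Definition fpsX : fps R := fun n => (n == 1%N)%:R.
Lemma fpsXM a n : (fpsX * a) n = if n is m.+1 then a m else 0.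
Proof.
rewrite fpsME big_ord_recl mul0r add0r; case: n => [|n]; first by rewrite big_ord0.
rewrite big_ord_recl mul1r subSS subn0 big1 ?addr0// => i _.
by rewrite mul0r.
Qed.

Definition fps_geom : fps R := fun=> 1.
Lemma fps_geomM a n : (fps_geom * a) n = \sum_(i < n.+1) a i.
Proof. by rewrite mulrC fpsME; apply: eq_bigr => i _; rewrite mulr1. Qed.
Lemma fps_geomV : (1 - fpsX) * fps_geom = 1.
Proof.
apply/funext => n; rewrite mulrBl mul1r fpsBE fpsXM fps1E.
by case: n => [|n] /=; rewrite ?subr0// subrr.
Qed.

Definition fps_deriv a : fps R := fun n => n.+1%:R * a n.+1.
Local Notation D := fps_deriv.
Lemma fps_derivD a b : D (a + b) = D a + D b.
Proof. by apply/funext => n; rewrite /D !fpsDE mulrDr. Qed.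
Lemma fps_derivN a : D (- a) = - D a.
Proof. by apply/funext => n; rewrite /D !fpsNE mulrN. Qed.
Lemma fps_derivB a b : D (a - b) = D a - D b.
Proof. by rewrite fps_derivD fps_derivN. Qed.
Lemma fps_derivC x : D (fps_const x) = 0.
Proof. by apply/funext => n; rewrite /D mulr0 fps0E. Qed.
Lemma fps_deriv1 : D 1 = 0. Proof. exact: (fps_derivC 1). Qed.
Lemma fps_derivX : D fpsX = 1.
Proof.
apply/funext => n; rewrite /D /fpsX fps1E eqSS.
by case: n => [|n]; rewrite ?mulr1// mulr0.
Qed.
Lemma fps_derivM a b : D (a * b) = D a * b + a * D b.
Proof.
apply/funext => n; set t := fps_trunc n.+2.
rewrite /D [(a * b) _](fps_mulE _ _ (ltnSn n.+1)) -/t mulr_natl -coef_deriv derivM.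
rewrite coefD fpsDE; congr (_ + _); rewrite coefM fpsME; apply: eq_bigr => i _.
  rewrite coef_deriv !coef_trunc ?mulr_natl//; have := ltn_ord i; lia.
rewrite coef_deriv !coef_trunc ?mulr_natl//; have := ltn_ord i; lia.
Qed.
Lemma fps_derivXn a k : D (a ^+ k) = (a ^+ k.-1 * D a) *+ k.
Proof.
elim: k => [|k IH]; first by rewrite expr0 fps_deriv1 mulr0n.
rewrite exprS fps_derivM IH /= mulrS; congr (_ + _); first by rewrite mulrC.
by case: k {IH} => [|k]; rewrite ?mulr0n ?mulr0// mulrnAr exprS mulrA.
Qed.

(** Stopping at k = n loses nothing once F 0 = 0, because F ^+ k then starts at index k; the formula
    is a composition in that case only. *)
Definition fps_comp P F : fps R := fun n => \sum_(k < n.+1) P k * (F ^+ k) n.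

Lemma fps_expr_val F k n : F 0%N = 0 -> (n < k)%N -> (F ^+ k) n = 0.
Proof.
move=> F0; elim: k n => // k IH n hn; rewrite exprS fpsME big_ord_recl F0 mul0r add0r.
rewrite big1// => i _; rewrite IH ?mulr0//= /bump /=; have := ltn_ord i; lia.
Qed.

Section Composition.
Variable F : fps R.
Hypothesis F0 : F 0%N = 0.
Local Notation "P \oF" := (fps_comp P F) (at level 30).

Lemma fps_compE P N n : (n < N)%N -> P \oF n = \sum_(k < N) P k * (F ^+ k) n.
Proof.
move=> nN; rewrite /fps_comp -!(big_mkord xpredT (fun k => P k * (F ^+ k) n)).
rewrite (@big_cat_nat _ _ _ n.+1 0 N)//= [X in _ + X]big1_seq ?addr0// => k.
by rewrite mem_index_iota => /andP[_ /andP[h _]]; rewrite fps_expr_val ?mulr0.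
Qed.

Lemma fps_compD P Q : (P + Q) \oF = P \oF + Q \oF.
Proof.
apply/funext => n; rewrite fpsDE /fps_comp -big_split; apply: eq_bigr => k _.
by rewrite fpsDE mulrDl.
Qed.
Lemma fps_compN P : (- P) \oF = - (P \oF).
Proof.
apply/funext => n; rewrite fpsNE /fps_comp -sumrN; apply: eq_bigr => k _.
by rewrite fpsNE mulNr.
Qed.
Lemma fps_compB P Q : (P - Q) \oF = P \oF - Q \oF.
Proof. by rewrite fps_compD fps_compN. Qed.
Lemma fps_compC x : (fps_const x) \oF = fps_const x.
Proof.
apply/funext => n; rewrite /fps_comp big_ord_recl big1 ?addr0; last first.
  by move=> i _; rewrite mul0r.
by rewrite expr0 fps1E; case: n => [|n]/=; rewrite ?mulr1 ?mulr0.
Qed.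
Lemma fps_comp1 : 1 \oF = 1. Proof. exact: fps_compC 1. Qed.
Lemma fps_compX : fpsX \oF = F.
Proof.
apply/funext => -[|n].
  by rewrite /fps_comp big_ord_recl big_ord0 mul0r addr0 F0.
rewrite /fps_comp !big_ord_recl mul0r add0r mul1r expr1 big1 ?addr0// => i _.
by rewrite mul0r.
Qed.

(** Evaluation at F is a ring morphism on polynomials, and each coefficient of a composition is a
    coefficient of such an evaluation. *)
Let ev (p : {poly R}) : fps R := (map_poly fps_const p).[F].

Let compE_ev P N n : (n < N)%N -> P \oF n = ev (fps_trunc N P) n.
Proof.
move=> nN; rewrite (fps_compE _ nN).
have sz : (size (map_poly fps_const (fps_trunc N P)) <= N)%N.
  by rewrite (leq_trans (size_poly _ _))// size_poly.
rewrite /ev (horner_coef_wide _ sz) fps_sumE; apply: eq_bigr => k _.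
by rewrite coef_map fps_constM coef_trunc.
Qed.

Lemma fps_compM P Q : (P * Q) \oF = P \oF * Q \oF.
Proof.
apply/funext => n; set t := fps_trunc n.+1.
have -> : (P \oF * Q \oF) n = (ev (t P) * ev (t Q)) n.
  rewrite !fpsME; apply: eq_bigr => i _.
  by rewrite -!compE_ev// ltnS leq_subr.
rewrite (compE_ev _ (ltnSn n)) -/t /ev -hornerM -rmorphM /=.
(* The terms of degree above n are a multiple of 'X^(n.+1), and F ^+ n.+1 has no coefficient of
   index n. *)
have -> : t P * t Q = t (P * Q) + drop_poly n.+1 (t P * t Q) * 'X^(n.+1).
  rewrite -{1}(poly_take_drop n.+1 (t P * t Q)); congr (_ + _).
  apply/polyP => i; rewrite coef_take_poly coef_poly; case: ifP => // h.
  rewrite fpsME coefM; apply: eq_bigr => j _.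
  have ? := ltn_ord j; by rewrite !coef_trunc; [by []|lia|lia].
rewrite rmorphD rmorphM /= map_polyXn hornerD hornerM hornerXn fpsDE.
rewrite mulrC fpsME big1 ?addr0// => i _.
by rewrite fps_expr_val ?mulr0 ?ltnS ?leq_subr.
Qed.

Lemma fps_compXn P k : (P ^+ k) \oF = (P \oF) ^+ k.
Proof. by elim: k => [|k IH]; rewrite ?expr0 ?fps_comp1// !exprS fps_compM IH. Qed.

Lemma fps_deriv_comp P : D (P \oF) = (D P) \oF * D F.
Proof.
apply/funext => n; rewrite /D (fps_compE _ (ltnSn n.+1)) big_ord_recl expr0.
rewrite fps1E mulr0 add0r mulr_sumr.
transitivity (\sum_(k < n.+1) P k.+1 * D (F ^+ k.+1) n).
  by apply: eq_bigr => k _; rewrite /D mulrCA.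
transitivity ((\sum_(k < n.+1) fps_const (D P k) * (F ^+ k * D F)) n).
  rewrite fps_sumE; apply: eq_bigr => k _.
  by rewrite fps_constM fps_derivXn fpsMn /= /D mulrnAr -mulr_natl mulrA.
under eq_bigr do rewrite mulrA.
rewrite -mulr_suml !fpsME; apply: eq_bigr => i _; congr (_ * _).
rewrite fps_sumE (@fps_compE (D P) n.+1 i)//; apply: eq_bigr => k _.
by rewrite fps_constM.
Qed.
End Composition.

Lemma fps_comp0 P F : fps_comp P F 0%N = P 0%N.
Proof. by rewrite /fps_comp big_ord_recl big_ord0 expr0 fps1E mulr1 addr0. Qed.

End FormalPowerSeries.

(** * Absolutely summable power series *)

Section Summable.
Variable R : realType.
Implicit Types a b w F P : fps R.

(** Summation as multiplication by 1 / (1 - X), so that ring identities apply to partial sums. The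
    term of index n is included, unlike in [series]. *)
Definition psum a : R^nat := fps_geom R * a.
Definition fsum a : R := limn (psum a).
Definition fabs a : fps R := fun n => `|a n|.
Definition summable a := exists C, forall n, psum (fabs a) n <= C.
Definition bounded_coefs a := exists C, forall n, `|a n| <= C.

Lemma psumE a n : psum a n = \sum_(i < n.+1) a i.
Proof. exact: fps_geomM. Qed.
Lemma psumS a n : psum a n.+1 = psum a n + a n.+1.
Proof. by rewrite !psumE big_ord_recr. Qed.
Lemma psum0 a : psum a 0 = a 0%N.
Proof. by rewrite psumE big_ord1. Qed.
Lemma psum_series a n : psum a n = series a n.+1.
Proof. by rewrite psumE /series /= big_mkord. Qed.
Lemma psumD a b : psum (a + b) = psum a \+ psum b.
Proof. by apply/funext => n; rewrite /psum mulrDr. Qed.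
Lemma psumN a : psum (- a) = \- psum a.
Proof. by apply/funext => n; rewrite /psum mulrN. Qed.
Lemma psumM a b n : psum (a * b) n = \sum_(k < n.+1) a k * psum b (n - k)%N.
Proof. by rewrite /psum mulrCA. Qed.
Lemma psum_ge0 a n : (forall k, 0 <= a k) -> 0 <= psum a n.
Proof. by move=> a0; rewrite psumE sumr_ge0. Qed.
Lemma psum_le a n m : (forall k, 0 <= a k) -> (n <= m)%N -> psum a n <= psum a m.
Proof.
move=> a0; elim: m => [|m IH]; first by rewrite leqn0 => /eqP ->.
rewrite leq_eqVlt => /predU1P[->//|/IH /le_trans]; apply.
by rewrite psumS lerDl.
Qed.
Lemma psum_abs a n : `|psum a n| <= psum (fabs a) n.
Proof. by rewrite !psumE; apply: ler_norm_sum. Qed.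
Lemma fabs_ge0 a n : 0 <= fabs a n. Proof. exact: normr_ge0. Qed.
Lemma fabs_psum_le a b n : (forall k, `|a k| <= b k) -> psum (fabs a) n <= psum b n.
Proof. by move=> h; rewrite !psumE; apply: ler_sum => i _; apply: h. Qed.
Lemma psum_coef_le a n : (forall k, 0 <= a k) -> a n <= psum a n.
Proof.
move=> a0; case: n => [|n]; first by rewrite psum0.
by rewrite psumS lerDr psum_ge0.
Qed.
Lemma psumM_le a b n : (forall k, 0 <= a k) -> (forall k, 0 <= b k) ->
  psum (a * b) n <= psum a n * psum b n.
Proof.
move=> a0 b0; rewrite psumM (psumE a) mulr_suml; apply: ler_sum => i _.
by rewrite ler_wpM2l// psum_le// leq_subr.
Qed.
Lemma fps_mul_ge0 a b n : (forall k, 0 <= a k) -> (forall k, 0 <= b k) ->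
  0 <= (a * b) n.
Proof. by move=> a0 b0; rewrite fpsME sumr_ge0// => i _; rewrite mulr_ge0. Qed.
Lemma fps_exp_ge0 a k n : (forall i, 0 <= a i) -> 0 <= (a ^+ k) n.
Proof.
move=> a0; elim: k n => [|k IH] n; first by rewrite expr0 fps1E ler0n.
by rewrite exprS fps_mul_ge0.
Qed.
Lemma psumX_le a k n : (forall i, 0 <= a i) -> psum (a ^+ k) n <= psum a n ^+ k.
Proof.
move=> a0; elim: k => [|k IH].
  rewrite !expr0 psumE big_ord_recl big1 ?addr0 ?fps1E//.
rewrite !exprS (le_trans (psumM_le _ _ _))//; first by move=> i; exact: fps_exp_ge0.
by rewrite ler_wpM2l// psum_ge0.
Qed.
Lemma fabsM_le a b n : fabs (a * b) n <= (fabs a * fabs b) n.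
Proof.
rewrite /fabs !fpsME (le_trans (ler_norm_sum _ _ _))//.
by apply: ler_sum => i _; rewrite normrM.
Qed.

Lemma summable_le a b : (forall k, `|a k| <= b k) -> summable b -> summable a.
Proof.
move=> h [C hC]; exists C => n; rewrite (le_trans _ (hC n))// !psumE.
by apply: ler_sum => i _; rewrite /fabs (le_trans (h _))// ler_norm.
Qed.
Lemma summable_fabs a : summable a -> summable (fabs a).
Proof.
move=> [C hC]; exists C => n; apply: le_trans (hC n).
by apply: fabs_psum_le => k; rewrite /fabs normr_id.
Qed.
Lemma summableD a b : summable a -> summable b -> summable (a + b).
Proof.
move=> [A hA] [B hB]; exists (A + B) => n.
apply: le_trans (lerD (hA n) (hB n)); rewrite !psumE -big_split.
by apply: ler_sum => i _; apply: ler_normD.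
Qed.
Lemma summableN a : summable a -> summable (- a).
Proof.
move=> [A hA]; exists A => n; rewrite (le_trans _ (hA n))// !psumE.
by apply: ler_sum => i _; rewrite /fabs fpsNE normrN.
Qed.
Lemma summableB a b : summable a -> summable b -> summable (a - b).
Proof. by move=> ha hb; apply/summableD/summableN. Qed.
Lemma summableM a b : summable a -> summable b -> summable (a * b).
Proof.
move=> [A hA] [B hB]; exists (A * B) => n.
apply: (@le_trans _ _ (psum (fabs a * fabs b) n)).
  by apply: fabs_psum_le => k; apply: fabsM_le.
rewrite (le_trans (psumM_le _ _ _)) ?ler_pM ?psum_ge0//;
  by move=> *; apply: fabs_ge0.
Qed.
Lemma summable_const x : summable (fps_const x).
Proof.
exists `|x| => n; rewrite psumE big_ord_recl big1 ?addr0// => i _.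
by rewrite /fabs /= normr0.
Qed.
Lemma summableX : summable (fpsX R).
Proof.
exists 1 => n; rewrite psumE; case: n => [|n].
  by rewrite big_ord_recl big_ord0 /fabs normr0 addr0.
rewrite !big_ord_recl big1 ?addr0; last by move=> i _; rewrite /fabs normr0.
by rewrite /fabs normr0 add0r normr1.
Qed.
Lemma summableM_bounded a b : summable a -> bounded_coefs b -> bounded_coefs (a * b).
Proof.
move=> [A hA] [B hB]; exists (A * B) => n; rewrite fpsME.
apply: le_trans (ler_norm_sum _ _ _) _.
apply: (@le_trans _ _ (psum (fabs a) n * B)); last first.
  by rewrite ler_wpM2r// (le_trans _ (hB 0%N)).
rewrite psumE mulr_suml; apply: ler_sum => i _; rewrite normrM.
by rewrite ler_wpM2l.
Qed.

Lemma summable_cvg a : summable a -> cvgn (psum a).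
Proof.
move=> [C hC].
suff h : cvgn (series a).
  rewrite (_ : psum a = fun n => series a n.+1); last first.
    by apply/funext => n; rewrite psum_series.
  by apply/cvg_ex; exists (limn (series a)); rewrite cvg_shiftS.
apply: normed_cvg; apply: nondecreasing_is_cvgn.
  by apply/nondecreasing_seqP => n; rewrite /normed_series_of seriesSr lerDl /=.
exists C => _ [n _ <-]; case: n => [|n].
  rewrite /normed_series_of seriesEnat /= big_geq//; apply: le_trans (hC 0%N).
  exact/psum_ge0/fabs_ge0.
by apply: le_trans (hC n); rewrite psum_series.
Qed.
Lemma fsum_cvg a : summable a -> psum a @ \oo --> fsum a.
Proof. exact: summable_cvg. Qed.
Lemma fsum_lim a l : psum a @ \oo --> l -> fsum a = l.
Proof. by move=> /cvg_lim; apply. Qed.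

Lemma fsumD a b : summable a -> summable b -> fsum (a + b) = fsum a + fsum b.
Proof.
by move=> ha hb; apply: fsum_lim; rewrite psumD; apply: cvgD; apply: fsum_cvg.
Qed.
Lemma fsumN a : summable a -> fsum (- a) = - fsum a.
Proof. by move=> ha; apply: fsum_lim; rewrite psumN; apply: cvgN; exact: fsum_cvg. Qed.
Lemma fsumB a b : summable a -> summable b -> fsum (a - b) = fsum a - fsum b.
Proof. by move=> ha hb; rewrite (fsumD ha (summableN hb)) (fsumN hb). Qed.
Lemma fsum_const x : fsum (fps_const x) = x.
Proof.
apply: fsum_lim; rewrite (_ : psum _ = cst x); first exact: cvg_cst.
by apply/funext => n; rewrite psumE big_ord_recl big1 ?addr0.
Qed.
Lemma fsum1 : fsum 1 = 1. Proof. exact: fsum_const. Qed.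
Lemma fsumX : fsum (fpsX R) = 1.
Proof.
apply: fsum_lim; rewrite -cvg_shiftS (_ : (fun n => _) = cst 1); first exact: cvg_cst.
apply/funext => n; rewrite psumE !big_ord_recl big1 ?addr0; last by [].
by rewrite add0r.
Qed.
Lemma psum_le_fsum a n : (forall k, 0 <= a k) -> summable a -> psum a n <= fsum a.
Proof.
move=> a0 ha; apply: nondecreasing_cvgn_le; last exact: summable_cvg.
by apply/nondecreasing_seqP => k; rewrite psumS lerDl.
Qed.
Lemma fsum_le a C : summable a -> (forall n, psum a n <= C) -> fsum a <= C.
Proof.
by move=> ha h; apply: limr_le; [exact: summable_cvg|exact: nearW].
Qed.
Lemma ler_fsum a b : summable a -> summable b -> (forall n, a n <= b n) ->
  fsum a <= fsum b.
Proof.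
move=> ha hb h; apply: ler_lim; [exact: summable_cvg|exact: summable_cvg|].
by apply: nearW => n; rewrite !psumE; apply: ler_sum.
Qed.
Lemma fsum_ge0 a : summable a -> (forall n, 0 <= a n) -> 0 <= fsum a.
Proof. by move=> ha h; rewrite (le_trans _ (psum_le_fsum 0 h ha))// psum_ge0. Qed.
Lemma fsum_abs a : summable a -> `|fsum a| <= fsum (fabs a).
Proof.
move=> ha; have hf := summable_fabs ha.
rewrite ler_norml lerNl -fsumN//; apply/andP; split; apply: ler_fsum => //.
- exact: summableN.
- by move=> n; rewrite fpsNE /fabs -normrN ler_norm.
- by move=> n; rewrite /fabs ler_norm.
Qed.

(** Dominated convergence for sums whose length grows with n. It yields the product theorem, the
    value of a composition at 1 and the ratio limit of [isqrt_conv_ratio]. *)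
Lemma tannery (u : nat -> nat -> R) (v : fps R) w :
  summable w -> (forall n k, (k <= n)%N -> `|u n k| <= w k) ->
  (forall k, (fun n => u n k) @ \oo --> v k) ->
  (fun n => \sum_(k < n.+1) u n k) @ \oo --> fsum v.
Proof.
move=> hw uw uv.
have vw k : `|v k| <= w k.
  have h : (fun n => `|u n k|) @ \oo --> `|v k| by apply: cvg_norm; exact: uv.
  rewrite -(cvg_lim _ h)//; apply: limr_le; first by apply/cvg_ex; exists `|v k|.
  by exists k => // n /= kn; apply: uw.
have w0 k : 0 <= w k by apply: le_trans (vw k).
have hv := summable_le vw hw.
have ivP := fsum_cvg hv; have iwP := fsum_cvg hw.
apply/cvgrPdist_le => e e0.
have e3 : 0 < e / 3 by rewrite divr_gt0.
move/cvgrPdist_le : iwP => /(_ _ e3) [K1 _ hK1].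
move/cvgrPdist_le : ivP => /(_ _ e3) [K2 _ hK2].
pose K := maxn K1 K2.
have tail n : (K <= n)%N -> psum w n - psum w K <= e / 3.
  move=> _; have := hK1 K (leq_maxl _ _); have := psum_le_fsum n w0 hw => h1 h2.
  by move: h2; rewrite ler_norml => /andP[_]; lra.
have fin : (fun n => \sum_(k < K.+1) u n k) @ \oo --> psum v K.
  by rewrite psumE; apply: cvg_big => [|k _]; [exact: add_continuous|exact: uv].
move/cvgrPdist_le : fin => /(_ _ e3) [K3 _ hK3].
exists (maxn K K3) => // n /=; rewrite geq_max => /andP[Kn K3n].
have h1 := hK2 K (leq_maxr _ _); have h2 := hK3 n K3n; have h3 := tail n Kn.
rewrite -(big_mkord xpredT (u n)) (@big_cat_nat _ _ _ K.+1)//= big_mkord.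
have h4 : `|\sum_(K.+1 <= i < n.+1) u n i| <= psum w n - psum w K.
  apply: le_trans (ler_norm_sum _ _ _) _.
  rewrite !psumE -!(big_mkord xpredT w) (@big_cat_nat _ _ _ K.+1 0 n.+1)//=.
  rewrite [leRHS]addrAC subrr add0r.
  by rewrite !big_nat; apply: ler_sum => i /andP[_ ?]; apply: uw.
move: h1 h2 h3 h4; set A := \sum_(_ <= _ < _) _; set B := \sum_(_ < _) _.
rewrite !ler_norml; lra.
Qed.

Lemma fsumM a b : summable a -> summable b -> fsum (a * b) = fsum a * fsum b.
Proof.
move=> ha hb; apply: fsum_lim.
rewrite (_ : psum _ = fun n => \sum_(k < n.+1) a k * psum b (n - k)%N); last first.
  by apply/funext => n; rewrite psumM.
have -> : fsum a * fsum b = fsum (fun k => a k * fsum b).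
  apply/esym/fsum_lim; rewrite (_ : psum _ = fun n => psum a n * fsum b).
    by apply: cvgMr_tmp; exact: fsum_cvg.
  by apply/funext => n; rewrite !psumE mulr_suml.
have [B hB] := hb.
apply: (@tannery (fun n k => a k * psum b (n - k)%N) _ (fps_const B * fabs a)).
- by apply: summableM; [exact: summable_const|exact: summable_fabs].
- move=> n k _; rewrite fps_constM normrM mulrC ler_wpM2r//.
  exact: le_trans (psum_abs _ _) (hB _).
- move=> k; apply: cvgMl_tmp; rewrite -(cvg_shiftn k).
  by under eq_fun do rewrite addnK; exact: fsum_cvg.
Qed.
Lemma summableXn a k : summable a -> summable (a ^+ k).
Proof.
move=> ha; elim: k => [|k IH]; first exact: summable_const 1.
by rewrite exprS; apply: summableM.
Qed.
Lemma fsumXn a k : summable a -> fsum (a ^+ k) = fsum a ^+ k.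
Proof.
move=> ha; elim: k => [|k IH]; first by rewrite !expr0 fsum1.
by rewrite !exprS fsumM ?IH//; exact: summableXn.
Qed.

Lemma psum_comp F P n : F 0%N = 0 ->
  psum (fps_comp P F) n = \sum_(k < n.+1) P k * psum (F ^+ k) n.
Proof.
move=> F0.
rewrite psumE (eq_bigr (fun i : 'I_n.+1 => \sum_(k < n.+1) P k * (F ^+ k) i)).
  by rewrite exchange_big; apply: eq_bigr => k _; rewrite psumE mulr_sumr.
by move=> i _; apply: fps_compE.
Qed.

Section SummableComp.
Variable F : fps R.
Hypotheses (F0 : F 0%N = 0) (Fge0 : forall n, 0 <= F n).
Hypotheses (Fs : summable F) (F1 : fsum F <= 1).

(** Being uniform in k and n, this bound lets the coefficients of P alone dominate the
    composition. *)
Let Fk_le1 k n : psum (F ^+ k) n <= 1.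
Proof.
apply: le_trans (psumX_le _ _ Fge0) _.
by rewrite exprn_ile1 ?psum_ge0// (le_trans (psum_le_fsum _ Fge0 Fs)).
Qed.

Lemma summable_comp P : summable P -> summable (fps_comp P F).
Proof.
move=> [C hC]; exists C => n; apply: le_trans (hC n).
apply: (@le_trans _ _ (psum (fps_comp (fabs P) F) n)).
  apply: fabs_psum_le => i; apply: le_trans (ler_norm_sum _ _ _) _.
  by apply: ler_sum => k _; rewrite normrM (ger0_norm (fps_exp_ge0 _ _ Fge0)).
rewrite psum_comp// psumE; apply: ler_sum => k _.
by rewrite ler_piMr// fabs_ge0.
Qed.

Lemma fsum_comp P : summable P ->
  fsum (fps_comp P F) = fsum (fun n => P n * fsum F ^+ n).
Proof.
move=> hP; apply: fsum_lim.
rewrite (_ : psum _ = fun n => \sum_(k < n.+1) P k * psum (F ^+ k) n); last first.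
  by apply/funext => n; rewrite psum_comp.
apply: (@tannery (fun n k => P k * psum (F ^+ k) n) _ (fabs P)); first exact: summable_fabs.
- move=> n k _; rewrite normrM ler_piMr//.
  by rewrite ger0_norm ?Fk_le1// psum_ge0// => i; apply: fps_exp_ge0.
- move=> k; apply: cvgMl_tmp; rewrite -fsumXn//; apply: fsum_cvg; exact: summableXn.
Qed.
End SummableComp.

End Summable.

(** * The series of (1 - X)^(-1/2) *)

Section CentralBinomial.
Variable R : realType.

(* The coefficients binom(2n, n) / 4^n of (1 - X)^(-1/2). *)
Fixpoint isqrt_coef (n : nat) : R :=
  if n is m.+1 then isqrt_coef m * (m.*2.+1%:R / m.*2.+2%:R) else 1.
Definition isqrt : fps R := isqrt_coef.

Lemma isqrtS n : (n.*2.+2)%:R * isqrt n.+1 = n.*2.+1%:R * isqrt n.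
Proof. by rewrite /isqrt /= mulrCA [X in _ * X]mulrC mulfVK ?pnatr_eq0// mulrC. Qed.

Lemma isqrt_gt0 n : 0 < isqrt n.
Proof. by elim: n => [|n IH]; rewrite ?ltr01//= mulr_gt0// divr_gt0. Qed.

Lemma fps_deriv_eq0 (a : fps R) : fps_deriv a = 0 -> a = fps_const (a 0%N).
Proof.
move=> h; apply/funext => -[|n] //=.
have : fps_deriv a n = 0 by rewrite h fps0E.
by move/eqP; rewrite /fps_deriv mulf_eq0 pnatr_eq0 /= => /eqP.
Qed.

(** The differential equation 2 (1 - X) y' = y encodes the recurrence of the coefficients; it makes
    (1 - X) y^2 constant, which identifies y with (1 - X)^(-1/2). *)
Lemma isqrt_deriv : ((1 - fpsX R) * fps_deriv isqrt) *+ 2 = isqrt.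
Proof.
apply/funext => n; rewrite fpsMn mulrBl mul1r fpsBE fpsXM /fps_deriv.
case: n => [|n].
  by have := isqrtS 0; rewrite !mul1r subr0 mulr_natl.
have h := isqrtS n.+1.
have e1 : (n.+1.*2.+2)%:R = 2 * n.+2%:R :> R by rewrite -natrM; congr _%:R; lia.
have e2 : (n.+1.*2.+1)%:R = 2 * n.+1%:R + 1 :> R.
  by rewrite -natrM natr1; congr _%:R; lia.
move: h; rewrite e1 e2; move: (isqrt n.+2) (isqrt n.+1) => x y h.
rewrite -mulr_natr; transitivity ((2 * n.+2%:R) * x - 2 * n.+1%:R * y); first by ring.
by rewrite h; ring.
Qed.

Lemma isqrt_sq : (1 - fpsX R) * isqrt ^+ 2 = 1.
Proof.
suff /fps_deriv_eq0 -> : fps_deriv ((1 - fpsX R) * isqrt ^+ 2) = 0.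
  by rewrite fpsM0 expr2 fpsM0 fpsBE fps1E /fpsX /isqrt /= subr0 !mulr1.
rewrite fps_derivM fps_derivB fps_deriv1 fps_derivX expr2 fps_derivM.
have h := isqrt_deriv.
transitivity (isqrt * (((1 - fpsX R) * fps_deriv isqrt) *+ 2 - isqrt)).
  by ring.
by rewrite h subrr mulr0.
Qed.

(** Integration by parts gives the recursion, so that the Wallis integrals are differences of
    explicit primitives and only derivatives have to be computed. *)
Fixpoint sin_primitive (n : nat) : R -> R :=
  match n with
  | 0 => id
  | 1 => fun x => - cos x
  | m.+2 => fun x =>
      (m.+2%:R)^-1 * (m.+1%:R * sin_primitive m x - cos x * sin x ^+ m.+1)
  end.

Lemma sin_primitiveP n (x : R) : is_derive x 1 (sin_primitive n) (sin x ^+ n).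
Proof.
suff : is_derive x 1 (sin_primitive n) (sin x ^+ n) /\
       is_derive x 1 (sin_primitive n.+1) (sin x ^+ n.+1) by case.
elim: n => [|n [IH IH']].
  split => /=; first by rewrite expr0; exact: is_derive_id.
  by rewrite expr1 -[sin x]opprK; apply: is_deriveN.
split; first exact: IH'.
have hs := is_derive_sin x; have hc := is_derive_cos x.
have hsn := @is_deriveX _ _ (@sin R) n.+1 x 1 (cos x) hs.
have h := is_deriveZ (n.+2%:R^-1) (is_deriveB (is_deriveZ (n.+1%:R) IH) (is_deriveM hc hsn)).
have -> : sin_primitive n.+2 = n.+2%:R^-1 *:
    (n.+1%:R *: sin_primitive n - (@cos R) * (@sin R) ^+ n.+1).
  by apply/funext => y /=; rewrite exprfctE.
apply: (is_derive_eq h).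
rewrite exprfctE /GRing.scale /=.
have -> : sin x ^+ n.+2 = sin x ^+ n * sin x ^+ 2 by rewrite -exprD addn2.
have -> : sin x ^+ n.+1 = sin x ^+ n * sin x by rewrite exprSr.
have h2 := cos2Dsin2 x.
have e : cos x ^+ 2 = 1 - sin x ^+ 2 by rewrite -h2; ring.
have hn : n.+2%:R = n.+1%:R + 1 :> R by rewrite natr1.
have hn0 : n.+1%:R + 1 != 0 :> R by rewrite natr1 pnatr_eq0.
rewrite hn; apply: (mulfI hn0); rewrite mulVKf//.
transitivity (n.+1%:R * sin x ^+ n * (1 - cos x ^+ 2) + sin x ^+ n * sin x ^+ 2); first by ring.
by rewrite e; ring.
Qed.

(** The integral of sin^n over [0, pi / 2]. *)
Definition wallis n : R := sin_primitive n (pi / 2) - sin_primitive n 0.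

Lemma wallis0 : wallis 0 = pi / 2. Proof. by rewrite /wallis /= subr0. Qed.
Lemma wallis1 : wallis 1 = 1.
Proof. by rewrite /wallis /= cos_pihalf cos0; ring. Qed.
Lemma wallisSS n : wallis n.+2 = n.+1%:R / n.+2%:R * wallis n.
Proof. by rewrite /wallis /= cos_pihalf sin0 expr0n /=; ring. Qed.

Lemma wallis_decr n : wallis n.+1 <= wallis n.
Proof.
have pi2 : 0 < pi / 2 :> R by rewrite divr_gt0// pi_gt0.
pose h : R -> R := sin_primitive n - sin_primitive n.+1.
have dh (x : R) : is_derive x 1 h (sin x ^+ n - sin x ^+ n.+1).
  by apply: is_deriveB; apply: sin_primitiveP.
have ch : {within `[0, pi / 2], continuous h}.
  apply: continuous_subspaceT => x; apply: differentiable_continuous.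
  by apply/derivable1_diffP; case: (dh x).
have [c /andP[c0 cpi] e] := MVT pi2 (fun x _ => dh x) ch.
have : 0 <= h (pi / 2) - h 0.
  rewrite e subr0 mulr_ge0 ?(ltW pi2)// subr_ge0 exprS ler_piMl ?sin_le1//.
  by rewrite exprn_ge0// ltW// sin_gt0_pi//; move: c0 cpi; rewrite !bnd_simp => ? ?; lra.
by rewrite /h /wallis !fctE; lra.
Qed.

Lemma wallis_even n : wallis n.*2 = isqrt n * (pi / 2).
Proof.
elim: n => [|n IH]; first by rewrite wallis0 mul1r.
by rewrite doubleS wallisSS IH /isqrt /=; ring.
Qed.

Lemma wallis_odd n : wallis n.*2.+1 * (n.*2.+1%:R * isqrt n) = 1.
Proof.
elim: n => [|n IH]; first by rewrite wallis1 !mul1r.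
rewrite doubleS wallisSS -[RHS]IH /isqrt /=.
have : n.*2.+3%:R != 0 :> R by rewrite pnatr_eq0.
have : n.*2.+2%:R != 0 :> R by rewrite pnatr_eq0.
move: (n.*2.+3%:R) (n.*2.+2%:R) => x y hy hx.
by field; rewrite hx hy.
Qed.

(** The Wallis integrals of index 2n and 2n + 1 are (pi / 2) c and 1 / ((2n + 1) c), where c is
    [isqrt n]. Comparing neighbours gives this bound when the first index is even, and
    [isqrt_ubound] when it is odd. *)
Lemma isqrt_lbound n : 1 <= pi * (n.+1%:R * isqrt n ^+ 2).
Proof.
have := wallis_decr n.*2; rewrite wallis_even => h.
have c0 := isqrt_gt0 n; have n0 : 0 < n.*2.+1%:R :> R by rewrite ltr0n.
rewrite -[leLHS](wallis_odd n).
apply: (@le_trans _ _ (isqrt n * (pi / 2) * (n.*2.+1%:R * isqrt n))).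
  by rewrite ler_wpM2r// mulr_ge0// ltW.
rewrite (_ : n.*2.+1%:R = 2 * n%:R + 1 :> R); last first.
  by rewrite -mul2n -natrM natr1.
have e1 : n.+1%:R = n%:R + 1 :> R by rewrite natr1.
rewrite e1; have p0 := pi_gt0 R; have := mulr_gt0 p0 (exprn_gt0 2 c0).
move: (isqrt n) (n%:R) pi => c N p h1; rewrite -subr_ge0.
by rewrite (_ : _ - _ = p * c ^+ 2 / 2); [lra|field].
Qed.

Lemma isqrt_ubound n : pi * (n.+1%:R * isqrt n.+1 ^+ 2) <= 1.
Proof.
have := wallis_decr n.*2.+1; rewrite -doubleS wallis_even => h.
have c0 := isqrt_gt0 n; have n0 : 0 < n.*2.+1%:R :> R by rewrite ltr0n.
rewrite -[leRHS](wallis_odd n) -isqrtS.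
apply: (@le_trans _ _ (isqrt n.+1 * (pi / 2) * (n.*2.+2%:R * isqrt n.+1))).
  rewrite (_ : n.*2.+2%:R = 2 * n.+1%:R :> R); last by rewrite -doubleS -mul2n -natrM.
  by rewrite le_eqVlt; apply/orP; left; apply/eqP; field.
by rewrite ler_wpM2r// mulr_ge0// ltW// isqrt_gt0.
Qed.

Lemma isqrt_sq_le n : isqrt n ^+ 2 * n.+1%:R <= 1.
Proof.
elim: n => [|n IH]; first by rewrite /isqrt /= expr1n mul1r.
have h := isqrtS n.
have e1 : n.*2.+2%:R = 2 * n.+1%:R :> R by rewrite -natrM; congr _%:R; lia.
have e2 : n.*2.+1%:R = 2 * n.+1%:R - 1 :> R.
  by apply: (canRL (addrK 1)); rewrite natr1.
have e3 : n.+2%:R = n.+1%:R + 1 :> R by rewrite natr1.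
move: h IH; rewrite e1 e2 e3.
have : 1 <= n.+1%:R :> R by rewrite ler1n.
move: (n.+1%:R) (isqrt n) (isqrt n.+1) => N x y N1 h IH.
have h2 : (2 * N * y) ^+ 2 = ((2 * N - 1) * x) ^+ 2 by rewrite h.
have N0 : 0 < 4 * N ^+ 3 by rewrite mulr_gt0// exprn_gt0//; lra.
rewrite -(ler_pM2l N0) mulr1.
have -> : 4 * N ^+ 3 * (y ^+ 2 * (N + 1)) = (x ^+ 2 * N) * ((2 * N - 1) ^+ 2 * (N + 1)).
  by transitivity (((2 * N * y) ^+ 2) * (N * (N + 1))); [ring|rewrite h2; ring].
apply: (@le_trans _ _ ((2 * N - 1) ^+ 2 * (N + 1))); last by nra.
by apply: ler_piMl => //; rewrite mulr_ge0 ?sqr_ge0//; lra.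
Qed.

Lemma isqrt_asymp :
  (fun n => Num.sqrt n.+1%:R * isqrt n) @ \oo --> (Num.sqrt pi)^-1.
Proof.
have p0 := pi_gt0 R.
suff h : (fun n => n.+1%:R * isqrt n ^+ 2) @ \oo --> (pi : R)^-1.
  rewrite -sqrtrV ?(ltW p0)//.
  rewrite (_ : (fun n => _) = Num.sqrt \o (fun n => n.+1%:R * isqrt n ^+ 2)).
    by apply: continuous_cvg => //; exact: sqrt_continuous.
  apply/funext => n /=; rewrite sqrtrM//; congr (_ * _).
  by rewrite sqrtr_sqr ger0_norm// ltW// isqrt_gt0.
rewrite -cvg_shiftS.
apply: (@squeeze_cvgr _ _ _ _ (fun=> pi^-1) (fun n => pi^-1 * (1 + harmonic n))).
- apply: nearW => n.
  have A : pi^-1 <= n.+2%:R * isqrt n.+1 ^+ 2.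
    by rewrite -[leLHS]mulr1 ler_pdivrMl// isqrt_lbound.
  have B : n.+2%:R * isqrt n.+1 ^+ 2 <= pi^-1 * (1 + n.+1%:R^-1).
    rewrite ler_pdivlMl//.
    have e1 : n.+2%:R = n.+1%:R + 1 :> R by rewrite natr1.
    have h := isqrt_ubound n; rewrite e1.
    have n0 : 0 < n.+1%:R :> R by rewrite ltr0n.
    have : pi * isqrt n.+1 ^+ 2 <= n.+1%:R^-1.
      by rewrite -(ler_pM2l n0) mulfV ?gt_eqF// mulrCA.
    move=> h2; apply: le_trans (lerD h h2).
    by rewrite le_eqVlt; apply/orP; left; apply/eqP; ring.
  by apply/andP; split.
- exact: cvg_cst.
- rewrite -[X in _ --> X]mulr1; apply: cvgMl_tmp.
  rewrite -[X in _ --> X]addr0; apply: cvgD; first exact: cvg_cst.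
  exact: cvg_harmonic.
Qed.
End CentralBinomial.

(** * Rapidly decreasing coefficients *)

Section RapidDecay.
Variable R : realType.
Implicit Types a b : fps R.
Local Notation D := (@fps_deriv R).

(** A class stable under derivation and, when the sum vanishes, under division by 1 - X; no
    geometric rate has to be carried through these operations. *)
Definition rapid a := forall k, exists C, forall n, n.+1%:R ^+ k * `|a n| <= C.

Lemma summable_inv_sq : summable (fun n => (n.+1%:R ^+ 2)^-1 : R).
Proof.
exists 2 => n; apply: (@le_trans _ _ (2 - n.+1%:R^-1)); last by rewrite gerBl.
elim: n => [|n IH].
  by rewrite psum0 /fabs expr1n invr1 normr1; lra.
rewrite psumS /fabs ger0_norm ?invr_ge0 ?exprn_ge0//.
apply: le_trans (lerD IH (lexx _)) _.
have e1 : n.+2%:R = n.+1%:R + 1 :> R by rewrite natr1.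
have n0 : 0 < n.+1%:R :> R by rewrite ltr0n.
rewrite e1; move: (n.+1%:R) n0 => N n0.
have N1 : 0 < N + 1 by lra.
rewrite -subr_ge0 (_ : _ - _ = (N * (N + 1) ^+ 2)^-1); last first.
  by field; rewrite !gt_eqF.
by rewrite invr_ge0 mulr_ge0 ?sqr_ge0// ltW.
Qed.

Lemma rapid_summable a : rapid a -> summable a.
Proof.
move=> /(_ 2) [C hC]; apply: (@summable_le _ _ (fps_const C * (fun n => (n.+1%:R ^+ 2)^-1))).
  move=> k; rewrite fps_constM -ler_pdivrMr ?invr_gt0 ?exprn_gt0// invrK mulrC.
  exact: hC.
by apply: summableM; [exact: summable_const|exact: summable_inv_sq].
Qed.

Lemma rapid_le a b : (forall n, `|a n| <= `|b n|) -> rapid b -> rapid a.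
Proof.
move=> h hb k; have [C hC] := hb k; exists C => n; apply: le_trans (hC n).
by rewrite ler_wpM2l// exprn_ge0.
Qed.

Lemma rapidD a b : rapid a -> rapid b -> rapid (a + b).
Proof.
move=> ha hb k; have [A hA] := ha k; have [B hB] := hb k; exists (A + B) => n.
by rewrite (le_trans _ (lerD (hA n) (hB n)))// -mulrDr ler_wpM2l ?ler_normD ?exprn_ge0.
Qed.

Lemma rapidN a : rapid a -> rapid (- a).
Proof.
by apply: rapid_le => n; rewrite fpsNE normrN.
Qed.

Lemma rapidZ x a : rapid a -> rapid (fun n => x * a n).
Proof.
move=> ha k; have [A hA] := ha k; exists (`|x| * A) => n.
by rewrite normrM mulrCA ler_wpM2l.
Qed.

Lemma rapid_const x : rapid (fps_const x).
Proof.
move=> k; exists `|x| => -[|n]; first by rewrite expr1n mul1r.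
by rewrite /= normr0 mulr0.
Qed.

Lemma rapid_deriv a : rapid a -> rapid (D a).
Proof.
move=> ha k; have [A hA] := ha k.+1; exists A => n; apply: le_trans (hA n.+1).
rewrite /D normrM ger0_norm// mulrA -exprSr ler_wpM2r//.
by rewrite lerXn2r ?nnegrE// ler_nat.
Qed.

(** Since the total sum is 0, a partial sum is minus a tail, and in the tail after n the weight (n +
    1)^k is at most (i + 1)^k. *)
Lemma rapid_geom a : rapid a -> fsum a = 0 -> rapid (fps_geom R * a).
Proof.
move=> ha s0 k.
have hb : rapid (fun n => n.+1%:R ^+ k * a n).
  move=> j; have [A hA] := ha (j + k)%N; exists A => n; apply: le_trans (hA n).
  by rewrite normrM mulrA exprD normrX normr_nat.
have [C hC] := rapid_summable hb.
exists C => n.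
have hs := rapid_summable ha.
have -> : `|(fps_geom R * a) n| = `|limn (fun N => psum a N - psum a n)|.
  rewrite (_ : limn _ = - psum a n) ?normrN//; apply: cvg_lim => //.
  rewrite -[X in _ --> X]add0r -s0; apply: cvgD; first exact: fsum_cvg.
  exact: cvg_cst.
have cv : cvgn (fun N => psum a N - psum a n).
  by apply: is_cvgD; [exact: summable_cvg|exact: is_cvg_cst].
have b0 : 0 <= n.+1%:R ^+ k :> R by rewrite exprn_ge0.
rewrite -[X in X * _](ger0_norm b0) -normrM.
have cv2 : (fun N => `|n.+1%:R ^+ k * (psum a N - psum a n)|) @ \oo -->
    `|n.+1%:R ^+ k * limn (fun N => psum a N - psum a n)|.
  by apply: cvg_norm; apply: cvgMl_tmp; exact: cv.
rewrite -(cvg_lim _ cv2)//; apply: limr_le; first by apply/cvg_ex; eexists; exact: cv2.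
exists n => // N /= nN.
rewrite !psumE -!(big_mkord xpredT a) (@big_cat_nat _ _ _ n.+1 0 N.+1)//=.
rewrite addrAC subrr add0r normrM (ger0_norm b0).
apply: le_trans (hC N); rewrite psumE -(big_mkord xpredT (fabs _)).
rewrite (@big_cat_nat _ _ _ n.+1 0 N.+1)//=.
apply: le_trans (ler_wpM2l b0 (ler_norm_sum _ _ _)) _.
rewrite mulr_sumr -[leLHS]add0r; apply: lerD; first by apply: sumr_ge0 => i _; apply: fabs_ge0.
rewrite !big_nat; apply: ler_sum => i /andP[ni _].
rewrite /fabs normrM normrX normr_nat ler_wpM2r// lerXn2r ?nnegrE// ler_nat ltnS.
exact: ltnW.
Qed.

(** Write r as the square of its root: one factor satisfies the bound for k by induction, the other
    absorbs the additional n + 1. *)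
Lemma rapid_expr (r : R) : 0 <= r < 1 -> rapid (fun n => r ^+ n).
Proof.
have base (s : R) : 0 <= s < 1 -> forall n, n.+1%:R * s ^+ n <= (1 - s)^-1.
  move=> /andP[s0 s1] n.
  have h1 : n.+1%:R * s ^+ n <= \sum_(i < n.+1) s ^+ i.
    rewrite mulr_natl -[n.+1 in X in X <= _]card_ord -sumr_const.
    by apply: ler_sum => i _; rewrite ler_wiXn2l ?(ltW s1)// -ltnS.
  apply: le_trans h1 _.
  have s1' : 0 < 1 - s by rewrite subr_gt0.
  rewrite -(ler_pM2l s1') mulfV ?gt_eqF//.
  have := subrX1 s n.+1; have := exprn_ge0 n.+1 s0.
  move: (s ^+ n.+1) (\sum_(i < _) _) => u v; lra.
move=> + k; elim: k r => [|k IH] r /andP[r0 r1].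
  by exists 1 => n; rewrite mul1r ger0_norm ?exprn_ge0// exprn_ile1// ltW.
have sr : 0 <= Num.sqrt r < 1.
  by rewrite sqrtr_ge0 -sqrtr1 ltr_sqrt//.
have [C hC] := IH _ sr; exists (C * (1 - Num.sqrt r)^-1) => n.
have sn0 : 0 <= Num.sqrt r ^+ n by rewrite exprn_ge0// sqrtr_ge0.
rewrite -{1}(sqr_sqrtr r0) -exprM mulnC exprM expr2 normrM mulrA exprSr.
apply: le_trans (ler_pM _ _ (hC n) (base _ sr n)).
- by rewrite ger0_norm// le_eqVlt; apply/orP; left; apply/eqP; ring.
- by rewrite mulr_ge0// exprn_ge0.
- by rewrite mulr_ge0.
Qed.
End RapidDecay.

Section Scaling.
Variables (R : realType) (y : R).
Implicit Types a b : fps R.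

(** The substitution of yX for X, so that [fsum (fps_scale y a)] is the value of the series at y. *)
Definition fps_scale a : fps R := fun n => a n * y ^+ n.

Lemma fps_scaleM a b : fps_scale (a * b) = fps_scale a * fps_scale b.
Proof.
apply/funext => n; rewrite /fps_scale !fpsME mulr_suml; apply: eq_bigr => i _.
by rewrite mulrACA -exprD subnKC// -ltnS.
Qed.
Lemma fps_scaleD a b : fps_scale (a + b) = fps_scale a + fps_scale b.
Proof. by apply/funext => n; rewrite /fps_scale !fpsDE mulrDl. Qed.
Lemma fps_scaleB a b : fps_scale (a - b) = fps_scale a - fps_scale b.
Proof. by apply/funext => n; rewrite /fps_scale !fpsBE mulrBl. Qed.
Lemma fps_scale_const x : fps_scale (fps_const x) = fps_const x.
Proof. by apply/funext => -[|n]; rewrite /fps_scale /= ?mulr1 ?mul0r. Qed.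
Lemma fps_scale1 : fps_scale 1 = 1. Proof. exact: (fps_scale_const 1). Qed.
Lemma fps_scaleXn a k : fps_scale (a ^+ k) = fps_scale a ^+ k.
Proof.
by elim: k => [|k IH]; rewrite ?expr0 ?fps_scale1// !exprS fps_scaleM IH.
Qed.
Lemma fps_scaleX : fps_scale (fpsX R) = fps_const y * fpsX R.
Proof.
apply/funext => n; rewrite fps_constM /fps_scale /fpsX.
by case: eqP => [->|_]; rewrite ?mul0r ?mulr0// mulrC.
Qed.
Lemma fps_scale_comp P F : fps_scale (fps_comp P F) = fps_comp P (fps_scale F).
Proof.
apply/funext => n; rewrite /fps_scale /fps_comp mulr_suml; apply: eq_bigr => k _.
by rewrite -mulrA -/(fps_scale F) -fps_scaleXn.
Qed.

Hypothesis y01 : 0 <= y <= 1.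
Let y0 : 0 <= y. Proof. by case/andP: y01. Qed.

Lemma summable_scale a : summable a -> summable (fps_scale a).
Proof.
move=> ha; apply: summable_le (summable_fabs ha) => k.
rewrite normrM ler_piMr// normrX ger0_norm// exprn_ile1//.
by case/andP: y01.
Qed.
Lemma fsum_scaleX : fsum (fps_scale (fpsX R)) = y.
Proof.
by rewrite fps_scaleX fsumM ?fsumX ?fsum_const ?mulr1//; [exact: summable_const|exact: summableX].
Qed.
Lemma summable_scale_bounded a : y < 1 -> bounded_coefs a -> summable (fps_scale a).
Proof.
move=> y1 [C hC]; apply: (@summable_le _ _ (fps_const C * fun n => y ^+ n)).
  by move=> k; rewrite fps_constM normrM normrX (ger0_norm y0) ler_wpM2r ?exprn_ge0.
apply: summableM; first exact: summable_const.
by apply: rapid_summable; apply: rapid_expr; rewrite y0.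
Qed.
End Scaling.
Lemma fps_scale_1 (R : realType) (a : fps R) : fps_scale 1 a = a.
Proof. by apply/funext => n; rewrite /fps_scale expr1n mulr1. Qed.

(** * Inverses of power series *)

Section InverseSeries.
Variable R : realType.
Local Notation D := (@fps_deriv R).
Local Notation X := (fpsX R).
Local Notation G := (fps_geom R).

Lemma summable_derivM (a b : fps R) : summable a -> summable b ->
  summable (D a) -> summable (D b) -> summable (D (a * b)).
Proof. by move=> ? ? ? ?; rewrite fps_derivM; apply: summableD; apply: summableM. Qed.

Section Factor.
Variable a : fps R.
Hypotheses (ra : rapid a) (sa : fsum a = 0).

Lemma fps_geomK : (1 - X) * (G * a) = a.
Proof. by rewrite mulrA fps_geomV mul1r. Qed.

Lemma fsum_1subX_mul b : summable b -> fsum ((1 - X) * b) = 0.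
Proof.
move=> hb; rewrite fsumM ?fsumB ?fsum1 ?fsumX ?subrr ?mul0r//.
all: rewrite -/(summable _); try apply: summableB.
all: by [exact: summableX|exact: (summable_const 1)].
Qed.

(** L'Hopital's rule at 1: differentiate a = (1 - X) b and evaluate, the term (1 - X) b'
    contributing 0. *)
Lemma fsum_geom : fsum (G * a) = - fsum (D a).
Proof.
have rb := rapid_geom ra sa; set b := G * a in rb *.
rewrite -fps_geomK -/b fps_derivM fps_derivB fps_deriv1 fps_derivX sub0r mulN1r.
have h := fsum_1subX_mul (rapid_summable (rapid_deriv rb)).
have hb := rapid_summable rb.
rewrite fsumD ?fsumN ?h ?addr0 ?opprK//; first exact: summableN.
apply: summableM; last exact/rapid_summable/rapid_deriv.
by apply: summableB; [exact: (summable_const 1)|exact: summableX].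
Qed.
End Factor.

Section FpsInverse.
Variables (L : fps R) (q : R).
Hypotheses (L0 : 0 < L 0%N) (q0 : 0 <= q) (q1 : q < 1 / 2).
Hypothesis Lq : forall n, \sum_(i < n) `|L i.+1| <= q * L 0%N.

(** L is L_0 (1 + t) with t of absolute sum at most q, so its inverse is the Neumann series of - t
    divided by L_0. *)
Let t : fps R := fun n => if n is m.+1 then L n / L 0%N else 0.
Let p := fps_comp G (- t).
Definition fps_inv := fps_const (L 0%N)^-1 * fps_comp G (- t).

Let Lt : L = fps_const (L 0%N) * (1 + t).
Proof.
apply/funext => n; rewrite fps_constM fpsDE fps1E /t.
case: n => [|n] /=; first by rewrite addr0 mulr1.
by rewrite add0r mulrCA mulfV ?mulr1// gt_eqF.
Qed.

Let pt : (1 + t) * p = 1.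
Proof.
have t0 : (- t) 0%N = 0 by rewrite fpsNE oppr0.
have := congr1 (fun f => fps_comp f (- t)) (fps_geomV R).
by rewrite fps_compM// fps_compB fps_comp1// fps_compX// opprK.
Qed.

Lemma fps_invP : fps_inv * L = 1.
Proof.
rewrite [X in fps_inv * X]Lt /fps_inv -/p.
have -> : fps_const (L 0%N)^-1 * p * (fps_const (L 0%N) * (1 + t)) =
  fps_const (L 0%N)^-1 * fps_const (L 0%N) * ((1 + t) * p) by ring.
by rewrite pt mulr1 -rmorphM /= mulVf ?gt_eqF.
Qed.

Let psum_t n : psum (fabs t) n <= q.
Proof.
rewrite psumE big_ord_recl /fabs normr0 add0r.
rewrite -(ler_pM2r L0) mulr_suml; apply: le_trans (Lq n).
apply: ler_sum => i _; rewrite /t /= normrM mulrAC -mulrA.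
by rewrite normfV (gtr0_norm L0) mulfV ?mulr1// gt_eqF.
Qed.

Let psum_tp n : psum (fabs (t * p)) n <= q * psum (fabs p) n.
Proof.
apply: (@le_trans _ _ (psum (fabs t * fabs p) n)).
  by apply: fabs_psum_le => k; exact: fabsM_le.
rewrite (le_trans (psumM_le _ _ _)) ?ler_wpM2r ?psum_ge0//; move=> *; exact: fabs_ge0.
Qed.

Let pE : p = 1 - t * p.
Proof. by rewrite -[X in X - _]pt; ring. Qed.

(** From p = 1 - t p the absolute partial sums satisfy S <= 1 + q S. Working with partial sums, this
    proves summability without assuming it. *)
Let psum_p n : psum (fabs p) n <= (1 - q)^-1.
Proof.
have h : psum (fabs p) n <= 1 + q * psum (fabs p) n.
  apply: le_trans (lerD (lexx 1) (psum_tp n)).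
  rewrite {1}pE !psumE [\sum_(i < n.+1) fabs (t * p) i]big_ord_recl addrA big_ord_recl.
  apply: lerD.
    rewrite /fabs fpsBE fps1E; apply: le_trans (ler_normB _ _) _.
    by rewrite normr1.
  by apply: ler_sum => i _; rewrite /fabs fpsBE fps1E sub0r normrN.
have q1' : 0 < 1 - q by have := q1; lra.
rewrite -(ler_pM2l q1') mulfV ?gt_eqF//; move: h; lra.
Qed.

Lemma fps_inv_summable : summable fps_inv.
Proof.
apply: summableM; first exact: summable_const.
by exists (1 - q)^-1 => n; apply: psum_p.
Qed.

(* This is where q < 1/2 is used: the coefficients of p after the first one
   have absolute sum at most q / (1 - q) < 1. *)
Lemma fps_geom_inv_ge0 n : 0 <= (G * fps_inv) n.
Proof.
have -> : (G * fps_inv) n = (L 0%N)^-1 * psum p n.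
  by rewrite /psum -fps_constM /fps_inv mulrCA.
rewrite mulr_ge0 ?invr_ge0 ?(ltW L0)//.
have -> : psum p n = 1 - psum (t * p) n.
  rewrite {1}pE psumD psumN /=; congr (_ + _).
  by rewrite psumE big_ord_recl big1 ?addr0.
have h1 := psum_tp n; have h2 := psum_p n; have h3 := psum_abs (t * p) n.
have h4 := ler_norm (psum (t * p) n).
have q1' : 0 < 1 - q by have := q1; lra.
have h5 : q * psum (fabs p) n <= 1.
  apply: le_trans (ler_wpM2l q0 h2) _.
  by rewrite ler_pdivrMr// mul1r; have := q1; lra.
rewrite subr_ge0; lra.
Qed.
End FpsInverse.

Lemma fps_inv_deriv (L P : fps R) : P * L = 1 -> D P = - (P ^+ 2 * D L).
Proof.
move=> h; have := congr1 D h; rewrite fps_derivM fps_deriv1 => h2.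
transitivity ((D P * L + P * D L) * P + D P * (1 - P * L) - P ^+ 2 * D L).
  by ring.
by rewrite h2 h subrr; ring.
Qed.

End InverseSeries.

(** * Convolution with the coefficients of (1 - X)^(-1/2) *)

Section IsqrtConvolution.
Variable R : realType.
Implicit Types y : fps R.

(** Coefficients of order n^(-1/2) change by a bounded factor when the index is halved. The squares
    have ratio at most 2 pi <= 8, and 8 <= 3^2. *)
Lemma isqrt_half_le j n : (n <= j.*2.+1)%N -> isqrt R j <= 3 * isqrt R n.
Proof.
move=> nj; have cj := isqrt_gt0 R j; have cn := isqrt_gt0 R n.
rewrite -ler_sqr ?nnegrE ?mulr_ge0 ?(ltW cj) ?(ltW cn)//.
have h1 := isqrt_sq_le R j; have h2 := isqrt_lbound R n.
have p4 : (pi : R) <= 4 by have := pihalf_lt2 R; lra.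
have j0 : 0 < j.+1%:R :> R by rewrite ltr0n.
have h3 : n.+1%:R <= 2 * j.+1%:R :> R by rewrite -natrM ler_nat; lia.
rewrite -(ler_pM2r j0); apply: le_trans h1 _; apply: le_trans h2 _.
have c2 : 0 <= isqrt R n ^+ 2 by rewrite sqr_ge0.
apply: (@le_trans _ _ (4 * (2 * j.+1%:R * isqrt R n ^+ 2))).
  apply: ler_pM => //; first exact: pi_ge0.
    by rewrite mulr_ge0.
  exact: ler_wpM2r.
rewrite exprMn -subr_ge0.
rewrite (_ : _ - _ = j.+1%:R * isqrt R n ^+ 2); last by ring.
by rewrite mulr_ge0// ltW.
Qed.

Lemma psum_isqrt n : psum (isqrt R) n = n.*2.+1%:R * isqrt R n.
Proof.
elim: n => [|n IH]; first by rewrite psum0 mul1r.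
have e : n.+1.*2.+1%:R = n.*2.+2%:R + 1 :> R by rewrite natr1.
by rewrite psumS IH -isqrtS e [RHS]mulrDl mul1r.
Qed.

(** Split at k = n / 2. Below, [isqrt (n - k)] is at most 3 [isqrt n] and y is summable; above, |y
    k| <= 2 C / (n + 1) while the [isqrt] factors sum to (2n + 1) [isqrt n]. *)
Lemma isqrt_conv_le y S C : (forall n, psum (fabs y) n <= S) ->
  (forall k, k.+1%:R * `|y k| <= C) ->
  forall n, `|(isqrt R * y) n| <= (3 * S + 4 * C) * isqrt R n.
Proof.
move=> yS yC n; rewrite mulrC fpsME; apply: le_trans (ler_norm_sum _ _ _) _.
have cn := isqrt_gt0 R n.
have n0 : 0 < n.+1%:R :> R by rewrite ltr0n.
have C0 : 0 <= C by apply: le_trans (yC 0%N); rewrite mulr_ge0.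
apply: (@le_trans _ _ (\sum_(k < n.+1) (3 * isqrt R n * fabs y k
    + 2 * C / n.+1%:R * isqrt R (n - k)%N))).
  apply: ler_sum => k _; rewrite normrM (gtr0_norm (isqrt_gt0 R _)) -/(fabs y k).
  have kn : (k <= n)%N by rewrite -ltnS.
  have yk := fabs_ge0 y k; have cnk := ltW (isqrt_gt0 R (n - k)).
  have [k2|k2] := leqP k.*2 n.
    apply: (@le_trans _ _ (3 * isqrt R n * fabs y k)).
      by rewrite mulrC ler_wpM2r// isqrt_half_le//; lia.
    by rewrite lerDl !mulr_ge0// invr_ge0 ltW.
  apply: (@le_trans _ _ (2 * C / n.+1%:R * isqrt R (n - k)%N)).
    rewrite ler_wpM2r// ler_pdivlMr//.
    apply: (@le_trans _ _ (fabs y k * (2 * k.+1%:R))).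
      by rewrite ler_wpM2l// -natrM ler_nat; lia.
    by rewrite mulrCA ler_wpM2l// mulrC yC.
  by rewrite lerDr !mulr_ge0// ltW.
rewrite big_split /= -!mulr_sumr -psumE.
have -> : \sum_(i < n.+1) isqrt R (n - i)%N = n.*2.+1%:R * isqrt R n.
  rewrite -psum_isqrt /psum fpsME; apply: eq_bigr => i _.
  by rewrite mul1r.
apply: (@le_trans _ _ (3 * isqrt R n * S + 2 * C / n.+1%:R * (2 * n.+1%:R * isqrt R n))).
  apply: lerD; first by rewrite ler_wpM2l ?mulr_ge0 ?(ltW cn).
  rewrite ler_wpM2l ?mulr_ge0 ?invr_ge0 ?(ltW n0)// ler_wpM2r ?(ltW cn)//.
  by rewrite -natrM ler_nat; lia.
rewrite le_eqVlt; apply/orP; left; apply/eqP; field.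
by rewrite gt_eqF.
Qed.

Lemma isqrt_cvg0 : isqrt R @ \oo --> (0 : R).
Proof.
have h : (fun n => isqrt R n ^+ 2) @ \oo --> (0 : R).
  apply: (@squeeze_cvgr _ _ _ _ (fun=> 0) harmonic) => //.
  - apply: nearW => n; rewrite sqr_ge0 /harmonic /= -[leRHS]mul1r.
    by rewrite ler_pdivlMr ?ltr0n// isqrt_sq_le.
  - exact: cvg_cst.
  - exact: cvg_harmonic.
rewrite -(sqrtr0 R) (_ : isqrt R = Num.sqrt \o (fun n => isqrt R n ^+ 2)).
  by apply: continuous_cvg => //; exact: sqrt_continuous.
by apply/funext => n /=; rewrite sqrtr_sqr ger0_norm// ltW// isqrt_gt0.
Qed.

Lemma isqrt_ratioS : (fun n => isqrt R n / isqrt R n.+1) @ \oo --> (1 : R).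
Proof.
apply: (@squeeze_cvgr _ _ _ _ (fun=> 1) (fun n => 1 + harmonic n)).
- apply: nearW => n; have c0 := isqrt_gt0 R n; have c1 := isqrt_gt0 R n.+1.
  have n0 : 0 < n.*2.+1%:R :> R by rewrite ltr0n.
  have -> : isqrt R n / isqrt R n.+1 = 1 + n.*2.+1%:R^-1.
    apply: (mulIf (lt0r_neq0 c1)); rewrite mulfVK ?gt_eqF//.
    apply: (mulfI (lt0r_neq0 n0)); rewrite -isqrtS mulrA mulrDr mulr1 mulfV ?gt_eqF//.
    by rewrite natr1.
  rewrite lerDl invr_ge0 (ltW n0) lerD2l /harmonic /= lef_pV2 ?posrE ?ltr0n//.
  by rewrite ler_nat; lia.
- exact: cvg_cst.
- have h : (fun n => 1 + harmonic n) @ \oo --> (1 + 0 : R).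
    by apply: cvgD; [exact: cvg_cst|exact: cvg_harmonic].
  by rewrite addr0 in h.
Qed.

Lemma isqrt_ratio k : (fun n => isqrt R (n - k)%N / isqrt R n) @ \oo --> (1 : R).
Proof.
rewrite -(cvg_shiftn k).
have -> : (fun n => isqrt R (n + k - k)%N / isqrt R (n + k)%N) =
    (fun n => isqrt R n / isqrt R (n + k)%N).
  by apply/funext => n; rewrite addnK.
elim: k => [|k IH].
  have -> : (fun n => isqrt R n / isqrt R (n + 0)%N) = cst (1 : R).
    by apply/funext => n; rewrite addn0 divff// gt_eqF// isqrt_gt0.
  exact: cvg_cst.
have -> : (fun n => isqrt R n / isqrt R (n + k.+1)%N) =
    (fun n => (isqrt R n / isqrt R (n + k)%N) *
    (isqrt R (n + k)%N / isqrt R (n + k).+1)).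
  apply/funext => n /=; rewrite addnS mulrA mulfVK// gt_eqF//; exact: isqrt_gt0.
have h : (fun n => isqrt R (n + k)%N / isqrt R (n + k).+1) @ \oo --> (1 : R).
  by rewrite (cvg_shiftn k (fun n => isqrt R n / isqrt R n.+1)); exact: isqrt_ratioS.
have := @cvgM R _ \oo _ _ _ _ _ IH h; rewrite mulr1; exact.
Qed.

(** The terms telescope: each is twice the difference of two consecutive [isqrt] coefficients. *)
Lemma summable_isqrt_div : summable (fun n => isqrt R n / n.+1%:R).
Proof.
exists 2 => n; apply: (@le_trans _ _ (2 * (1 - isqrt R n.+1))); last first.
  by have := isqrt_gt0 R n.+1; lra.
rewrite le_eqVlt; apply/orP; left; apply/eqP; elim: n => [|n IH].
  rewrite psum0 /fabs /isqrt /= divr1 normr1 mul1r.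
  by rewrite -[0.*2.+1]/1%N -[0.*2.+2]/2%N; field.
rewrite psumS IH /fabs ger0_norm; last by rewrite divr_ge0// ltW// isqrt_gt0.
have h := isqrtS R n.+1.
have e1 : (n.+1.*2.+2)%:R = 2 * n.+2%:R :> R by rewrite -natrM; congr _%:R; lia.
have e2 : (n.+1.*2.+1)%:R = 2 * n.+2%:R - 1 :> R.
  by apply: (canRL (addrK 1)); rewrite natr1.
have n0 : n.+2%:R != 0 :> R by rewrite pnatr_eq0.
move: h; rewrite e1 e2; move: n0 (isqrt R n.+2) (isqrt R n.+1).
move: (n.+2%:R) => N N0 x y h.
have -> : x = (2 * N - 1) * y / (2 * N).
  by rewrite -h; field.
by field.
Qed.
(** For k <= n / 2 the ratios [isqrt (n - k) / isqrt n] are at most 3 and tend to 1, so dominated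
    convergence gives the sum of b. For larger k, b k is at most 6 B [isqrt n] / (n + 1), and the
    whole upper half is O([isqrt n]), hence tends to 0. *)
Lemma isqrt_conv_ratio (b : fps R) B : 0 <= B ->
  (forall n, n.+1%:R * `|b n.+1| <= B * isqrt R n) -> summable b ->
  (fun n => (isqrt R * b) n / isqrt R n) @ \oo --> fsum b.
Proof.
move=> B0 hB sum_b; set f := isqrt R * b.
pose u n k := if (k.*2 <= n)%N then b k * (isqrt R (n - k)%N / isqrt R n) else 0.
pose v n := \sum_(k < n.+1) (if (k.*2 <= n)%N then 0 else b k * (isqrt R (n - k)%N / isqrt R n)).
have fE2 n : f n / isqrt R n = \sum_(k < n.+1) u n k + v n.
  rewrite /v -big_split /= {1}/f [isqrt R * b]mulrC fpsME mulr_suml; apply: eq_bigr => k _.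
  by rewrite /u; case: ifP => _; rewrite ?addr0 ?add0r mulrA.
rewrite (_ : (fun n => _) = (fun n => \sum_(k < n.+1) u n k) \+ v); last first.
  by apply/funext => n; rewrite fE2.
rewrite -[fsum b]addr0; apply: cvgD.
  apply: (@tannery _ u _ (fps_const 3 * fabs b)).
  - by apply: summableM; [exact: summable_const|exact: summable_fabs].
  - move=> n k _; rewrite fps_constM /u; case: ifP => h; last first.
      by rewrite normr0 mulr_ge0// fabs_ge0.
    have c0 := isqrt_gt0 R n; have c1 := isqrt_gt0 R (n - k).
    rewrite normrM mulrC ler_wpM2r// (ger0_norm (divr_ge0 (ltW c1) (ltW c0))).
    by rewrite ler_pdivrMr// isqrt_half_le//; lia.
  - move=> k; rewrite -[b k]mulr1.
    have h : (fun n => b k * (isqrt R (n - k)%N / isqrt R n)) @ \oo --> b k * 1.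
      by apply: cvgMl_tmp; exact: isqrt_ratio.
    apply: cvg_trans h; apply: near_eq_cvg; exists k.*2 => // n /= kn.
    by rewrite /u kn.
apply/norm_cvg0P.
apply: (@squeeze_cvgr _ _ _ _ (fun=> 0) (fun n => 12 * B * isqrt R n)).
- apply: nearW => n; rewrite normr_ge0 /=.
  have cn := isqrt_gt0 R n; have n0 : 0 < n.+1%:R :> R by rewrite ltr0n.
  apply: (@le_trans _ _ (\sum_(k < n.+1) 6 * B / n.+1%:R * isqrt R (n - k)%N)); last first.
    rewrite -mulr_sumr.
    have -> : \sum_(k < n.+1) isqrt R (n - k)%N = psum (isqrt R) n.
      by rewrite /psum fpsME; apply: eq_bigr => i _; rewrite mul1r.
    rewrite psum_isqrt mulrA ler_wpM2r ?(ltW cn)//.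
    apply: (@le_trans _ _ (6 * B / n.+1%:R * (2 * n.+1%:R))).
      rewrite ler_wpM2l ?mulr_ge0 ?invr_ge0 ?(ltW n0)// -natrM ler_nat; lia.
    by rewrite le_eqVlt; apply/orP; left; apply/eqP; field; rewrite gt_eqF.
  apply: le_trans (ler_norm_sum _ _ _) _; apply: ler_sum => k _.
  have r0' : 0 <= 6 * B / n.+1%:R * isqrt R (n - k)%N.
    by rewrite !mulr_ge0 ?invr_ge0 ?(ltW n0)// ltW// isqrt_gt0.
  case: ifP => [|/negbT]; first by rewrite normr0.
  rewrite -ltnNge => nk; case: (nat_of_ord k) nk r0' => // j nj r0'.
  have cnk := isqrt_gt0 R (n - j.+1).
  rewrite !normrM normfV (gtr0_norm cn) (gtr0_norm cnk) mulrCA mulrC.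
  rewrite ler_wpM2r ?(ltW cnk)//.
  rewrite ler_pdivrMr// mulrAC ler_pdivlMr//.
  have h1 := hB j; have h2 : isqrt R j <= 3 * isqrt R n by apply: isqrt_half_le; lia.
  apply: (@le_trans _ _ (2 * (j.+1%:R * `|b j.+1|))).
    by rewrite mulrC mulrA ler_wpM2r// -natrM ler_nat; lia.
  apply: (@le_trans _ _ (2 * (B * (3 * isqrt R n)))); last by rewrite le_eqVlt; apply/orP; left; apply/eqP; ring.
  by rewrite ler_wpM2l//; apply: le_trans h1 _; rewrite ler_wpM2l.
- exact: cvg_cst.
- rewrite -[X in _ --> X](mulr0 (12 * B)); apply: cvgMl_tmp; exact: isqrt_cvg0.
Qed.

End IsqrtConvolution.

(** * Power series as functions, and bounds on their tails *)

Section PowerSeriesFunctions.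
Variable R : realType.
Local Notation D := (@fps_deriv R).
Local Notation X := (fpsX R).
Implicit Types a c : fps R.

Lemma rapid_scale_deriv (r : R) c : 0 < r -> rapid (fps_scale r c) ->
  rapid (fps_scale r (D c)).
Proof.
move=> r0 h; apply: rapid_le (rapidZ r^-1 (rapid_deriv h)) => n.
rewrite /fps_scale /D exprS le_eqVlt; apply/orP; left; apply/eqP; congr `|_|.
by field; rewrite gt_eqF.
Qed.

Lemma summable_scale_le (r x : R) c : rapid (fps_scale r c) -> `|x| <= r ->
  summable (fps_scale x c).
Proof.
move=> hc xr; apply: (@summable_le _ _ (fabs (fps_scale r c))).
  move=> k; rewrite /fabs !normrM ler_wpM2l// !normrX lerXn2r ?nnegrE//.
  by rewrite (le_trans xr)// ler_norm.
exact/summable_fabs/rapid_summable.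
Qed.

Lemma pseries_cvg c (y : R) : summable (fps_scale y c) ->
  pseries c y @ \oo --> fsum (fps_scale y c).
Proof.
move=> h; rewrite /pseries -cvg_shiftS.
rewrite (_ : (fun n => _) = psum (fps_scale y c)); first exact: fsum_cvg.
by apply/funext => n; rewrite psum_series.
Qed.

Lemma fsum_scale_derive (r y : R) c : 0 < r -> rapid (fps_scale r c) -> `|y| < r ->
  is_derive y 1 (fun x => fsum (fps_scale x c)) (fsum (fps_scale y (D c))).
Proof.
move=> r0 hc yr.
have yr' : `|y| < `|r| by rewrite (gtr0_norm r0).
have cv b : rapid (fps_scale r b) -> cvgn (pseries b r).
  move=> h; apply/cvg_ex; exists (fsum (fps_scale r b)); apply: pseries_cvg.
  exact: rapid_summable.
have h1 := rapid_scale_deriv r0 hc; have h2 := rapid_scale_deriv r0 h1.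
have := pseries_snd_diffs (cv _ hc) (cv _ h1) (cv _ h2) yr'.
rewrite (_ : limn (pseries (pseries_diffs c) y) = fsum (fps_scale y (D c))); last first.
  apply: cvg_lim => //; apply: (@pseries_cvg (D c) y).
  exact: summable_scale_le h1 (ltW yr).
move=> h; apply: near_eq_is_derive h.
have : \forall x \near y, `|x| < r.
  apply/nbhs_ballP; exists (r - `|y|) => /=; first by rewrite subr_gt0.
  move=> x; rewrite /ball /= distrC => hx.
  have := ler_normD (x - y) y; rewrite subrK; move: hx; lra.
apply: filterS => x xr; apply/cvg_lim => //.
exact: (pseries_cvg (summable_scale_le hc (ltW xr))).
Qed.

Lemma fsum_scale_1subX (y : R) c : 0 <= y <= 1 -> summable c ->
  fsum (fps_scale y ((1 - X) * c)) = (1 - y) * fsum (fps_scale y c).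
Proof.
move=> y01 hc; rewrite fps_scaleM fps_scaleB fps_scale1.
have s1 : summable (1 : fps R) by exact: summable_const.
have sX : summable (fps_scale y X) by apply: summable_scale => //; exact: summableX.
rewrite fsumM ?fsumB ?fsum1 ?fsum_scaleX//; first exact: summableB.
exact: summable_scale.
Qed.

(** As y is at most 1, the constant coefficient outweighs all the other terms together. *)
Lemma fsum_scale_gt0 (y q : R) c : 0 <= y <= 1 -> summable c -> 0 < c 0%N -> q < 1 ->
  (forall n, \sum_(i < n) `|c i.+1| <= q * c 0%N) -> 0 < fsum (fps_scale y c).
Proof.
move=> y01 sc c0 q1 cq; have y0 : 0 <= y by case/andP: y01.
pose t := c - fps_const (c 0%N).
have st : summable t by apply: summableB => //; exact: summable_const.
have -> : c = fps_const (c 0%N) + t by rewrite /t; ring.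
rewrite fps_scaleD fps_scale_const.
rewrite fsumD ?fsum_const; [|exact: summable_const|exact: summable_scale].
have h : fsum (fabs (fps_scale y t)) <= q * c 0%N.
  apply: fsum_le; first exact/summable_fabs/summable_scale.
  move=> n; rewrite psumE big_ord_recl {1}/fabs {1}/fps_scale /t fpsBE /= subrr mul0r normr0 add0r.
  apply: le_trans (cq n); apply: ler_sum => i _.
  rewrite /fabs /fps_scale fpsBE /= subr0 normrM ler_piMr// normrX ger0_norm//.
  by rewrite exprn_ile1//; case/andP: y01.
have h2 := fsum_abs (summable_scale y01 st).
have h3 := ler_norm (- fsum (fps_scale y t)); rewrite normrN in h3.
have h4 : q * c 0%N < c 0%N by rewrite gtr_pMl.
by move: h h2 h3 h4; lra.
Qed.

(* Bounds on the tails of a series dominated by the terms (k + 1) l ^ k, and on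
   the sum of these tails. *)
Definition tail1 (l : R) j := l ^+ j * ((j.+1%:R) / (1 - l) + l / (1 - l) ^+ 2).
Definition tail2 (l : R) j :=
  l ^+ j * ((j.+1%:R) / (1 - l) ^+ 2 + 2 * l / (1 - l) ^+ 3).

Section Tails.
Variables (h : fps R) (N : nat) (A l : R).
Hypotheses (l01 : 0 < l < 1) (A0 : 0 <= A) (sh : summable h).
Hypothesis hN : forall k, (N <= k)%N -> `|h k| <= A * (k.+1%:R * l ^+ k).

Let l1 : 1 - l != 0.
Proof. by case/andP: l01 => _ ?; rewrite subr_eq0 eq_sym lt_eqF. Qed.
(** [tail1 l j] is exactly the sum of (k + 1) l^k over k >= j, and [tail2] the sum of the [tail1],
    so both bounds below telescope. They start at [n.+1] because [psum h n] contains the term n. *)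
Let tail1S j : tail1 l j - tail1 l j.+1 = j.+1%:R * l ^+ j.
Proof.
rewrite /tail1 [l ^+ j.+1]exprS -(natr1 j.+1); move: (j.+1%:R) (l ^+ j) => x y.
by field.
Qed.
Let tail2S j : tail2 l j - tail2 l j.+1 = tail1 l j.
Proof.
rewrite /tail2 /tail1 [l ^+ j.+1]exprS -(natr1 j.+1); move: (j.+1%:R) (l ^+ j) => x y.
by field.
Qed.
Let tail1_ge0 j : 0 <= tail1 l j.
Proof.
case/andP: l01 => l0 l1'; have d0 : 0 <= 1 - l by rewrite subr_ge0 ltW.
by rewrite mulr_ge0 ?exprn_ge0 ?(ltW l0)// addr_ge0// divr_ge0 ?exprn_ge0 ?(ltW l0).
Qed.
Let tail2_ge0 j : 0 <= tail2 l j.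
Proof.
case/andP: l01 => l0 l1'; have d0 : 0 <= 1 - l by rewrite subr_ge0 ltW.
rewrite mulr_ge0 ?exprn_ge0 ?(ltW l0)// addr_ge0// divr_ge0 ?exprn_ge0//.
by rewrite mulr_ge0// ltW.
Qed.

Lemma tail_bound n : (N <= n.+1)%N -> `|psum h n - fsum h| <= A * tail1 l n.+1.
Proof.
move=> Nn; rewrite distrC.
have key m : `|psum h (n + m)%N - psum h n| <= A * (tail1 l n.+1 - tail1 l (n + m).+1%N).
  elim: m => [|m IH]; first by rewrite addn0 !subrr mulr0 normr0.
  rewrite addnS psumS addrAC; apply: le_trans (ler_normD _ _) _.
  apply: le_trans (lerD IH (hN _)) _; first by rewrite (leq_trans Nn)// ltnS leq_addr.
  by rewrite -tail1S -mulrDr addrA subrK.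
have cv : (fun m => `|psum h (m + n)%N - psum h n|) @ \oo --> `|fsum h - psum h n|.
  apply: cvg_norm; apply: cvgB; last exact: cvg_cst.
  by rewrite (cvg_shiftn n (psum h)); exact: fsum_cvg.
rewrite -(cvg_lim _ cv)//; apply: limr_le.
  by apply/cvg_ex; eexists; exact: cv.
apply: nearW => m; rewrite addnC; apply: le_trans (key m) _.
by rewrite ler_wpM2l// gerBl.
Qed.

Lemma tail_sum_bound n0 n : (N <= n0.+1)%N ->
  \sum_(n0 <= i < n) `|psum h i - fsum h| <= A * tail2 l n0.+1.
Proof.
move=> Nn; have [nn0|n0n] := leqP n n0; first by rewrite big_geq// mulr_ge0.
apply: (@le_trans _ _ (A * (tail2 l n0.+1 - tail2 l n.+1))); last first.
  by rewrite ler_wpM2l// gerBl.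
elim: n n0n => // n IH; rewrite ltnS leq_eqVlt => /predU1P[<-|n0n].
  by rewrite big_nat1 tail2S tail_bound.
rewrite big_nat_recr ?(ltnW n0n)//=; apply: le_trans (lerD (IH n0n) (tail_bound _)) _.
  by rewrite (leq_trans Nn)// ltnS ltnW.
by rewrite -mulrDr -(tail2S n.+1) addrA subrK.
Qed.
End Tails.
End PowerSeriesFunctions.

(** * Coefficient asymptotics of an inverse series *)

Section InversionAsymptotics.
Variable R : realType.
Local Notation D := (@fps_deriv R).
Local Notation X := (fpsX R).
Local Notation G := (fps_geom R).
Variables (m a : fps R) (K C q : R).
Hypotheses (K1 : 1 < K) (mK : forall n, `|m n| * K ^+ n <= C).
Hypotheses (m0 : m 0%N = 0) (m1 : fsum m = 1) (dm : fsum (D m) = 0).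
Hypotheses (l0 : 0 < m 1%N) (q0 : 0 <= q) (q12 : q < 1 / 2).
(** The inner sums are the coefficients of index i + 1 of L = m' / (1 - X), whose first coefficient
    is m_1. *)
Hypothesis tail_le : forall n,
  \sum_(i < n) `|\sum_(k < i.+2) k.+1%:R * m k.+1| <= q * m 1%N.
Hypotheses (a0 : a 0%N = 0) (a_ge0 : forall n, 0 <= a n).
Hypothesis ma : fps_comp m a = X.

(** An intermediate radius: the bound at K gives rapid decay at r, and r > 1 leaves room to
    differentiate at 1 itself. *)
Variable r : R.
Hypotheses (r1 : 1 < r) (rK : r < K).
Let r0 : 0 < r. Proof. by have := r1; lra. Qed.
Let K0 : 0 < K. Proof. by have := K1; lra. Qed.

Let rapid_mr : rapid (fun n => m n * r ^+ n).
Proof.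
apply: (@rapid_le _ _ (fun n => C * (r / K) ^+ n)); last first.
  by apply: rapidZ; apply: rapid_expr; rewrite divr_ge0 ?ltW//= ltr_pdivrMr// mul1r.
move=> n; have C0 : 0 <= C by apply: le_trans (mK 0%N); rewrite mulr_ge0.
have Kn : 0 < K ^+ n by rewrite exprn_gt0.
rewrite !normrM (ger0_norm C0) !normrX (ger0_norm (divr_ge0 (ltW r0) (ltW K0))).
rewrite (gtr0_norm r0) expr_div_n mulrA [leRHS]mulrAC
  ler_wpM2r ?exprn_ge0 ?(ltW r0)//.
by rewrite ler_pdivlMr.
Qed.

Let rapid_m : rapid m.
Proof.
apply: rapid_le rapid_mr => n.
by rewrite normrM ler_peMr// ger0_norm ?exprn_ge0 ?(ltW r0)// exprn_ege1// ltW.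
Qed.

Let L := G * D m.
Let rapid_L : rapid L. Proof. exact: rapid_geom (rapid_deriv rapid_m) dm. Qed.
Let LE : (1 - X) * L = D m. Proof. exact: fps_geomK. Qed.
Let L0 : L 0%N = m 1%N. Proof. by rewrite -[L 0%N]/(psum (D m) 0%N) psum0 /D mul1r. Qed.
Let Lpos : 0 < L 0%N. Proof. by rewrite L0. Qed.
Let Lq n : \sum_(i < n) `|L i.+1| <= q * L 0%N.
Proof.
rewrite L0; apply: le_trans (tail_le n).
by apply: ler_sum => i _; rewrite -[L i.+1]/(psum (D m) i.+1) psumE.
Qed.

Let Q := G * (G * (1 - m)).
Let rapid_1m : rapid (1 - m).
Proof. by apply: rapidD; [exact: rapid_const|exact: rapidN]. Qed.
Let sum_m : summable m. Proof. exact: rapid_summable. Qed.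
Let fsum_1m : fsum (1 - m) = 0.
Proof. by rewrite fsumB ?fsum1 ?m1 ?subrr//; exact: summable_const. Qed.
(** The second division by 1 - X is allowed because the first quotient has sum m'(1) = 0. *)
Let rapid_Q : rapid Q.
Proof.
apply: rapid_geom; first exact: rapid_geom.
rewrite fsum_geom// fps_derivB fps_deriv1 sub0r fsumN ?dm ?oppr0//.
exact/rapid_summable/rapid_deriv.
Qed.
Let QE : (1 - X) ^+ 2 * Q = 1 - m.
Proof. by rewrite expr2 -mulrA !fps_geomK. Qed.

Let P := fps_inv L.
Let PL : P * L = 1. Proof. exact: fps_invP Lpos. Qed.
Let sum_P : summable P. Proof. exact: fps_inv_summable Lpos q12 Lq. Qed.
Let sL : summable L. Proof. exact: rapid_summable. Qed.
Let sDL : summable (D L). Proof. exact/rapid_summable/rapid_deriv. Qed.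
Let sDDL : summable (D (D L)). Proof. exact/rapid_summable/rapid_deriv/rapid_deriv. Qed.
Let sDP : summable (D P).
Proof.
rewrite (fps_inv_deriv PL); apply: summableN; apply: summableM => //.
exact: summableXn.
Qed.
Let sDDP : summable (D (D P)).
Proof.
rewrite {1}(fps_inv_deriv PL) fps_derivN; apply: summableN; apply: summable_derivM => //.
  exact: summableXn.
by rewrite expr2; apply: summable_derivM.
Qed.

Let E := Q * P ^+ 2.
Let sQ : summable Q. Proof. exact: rapid_summable. Qed.
Let sDQ : summable (D Q). Proof. exact/rapid_summable/rapid_deriv. Qed.
Let sDDQ : summable (D (D Q)). Proof. exact/rapid_summable/rapid_deriv/rapid_deriv. Qed.
Let sPP : summable (P ^+ 2). Proof. exact: summableXn. Qed.
Let sDPP : summable (D (P ^+ 2)). Proof. by rewrite expr2; apply: summable_derivM. Qed.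
Let sDDPP : summable (D (D (P ^+ 2))).
Proof.
by rewrite expr2 fps_derivM fps_derivD; apply: summableD; apply: summable_derivM.
Qed.
Let sE : summable E. Proof. exact: summableM. Qed.
Let sDE : summable (D E). Proof. exact: summable_derivM. Qed.
Let sDDE : summable (D (D E)).
Proof. by rewrite fps_derivM fps_derivD; apply: summableD; apply: summable_derivM. Qed.

Let f := D a.
Let f_ge0 n : 0 <= f n. Proof. by rewrite mulr_ge0. Qed.
Local Notation "A \oa" := (fps_comp A a) (at level 30).
Let fE : f * ((1 - a) * L \oa) = 1.
Proof.
have := congr1 D ma; rewrite fps_deriv_comp// fps_derivX -LE fps_compM//.
by rewrite fps_compB// fps_comp1// fps_compX// => h; rewrite -[RHS]h mulrC.
Qed.
Let f0 : 0 < f 0%N.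
Proof.
have := congr1 (fun u => u 0%N) fE; rewrite !fpsM0 fps_comp0 fpsBE a0 fps1E subr0.
rewrite mul1r L0 => h; rewrite lt_def f_ge0 andbT; apply/eqP => f00.
by move: h; rewrite f00 mul0r => /eqP; rewrite eq_sym oner_eq0.
Qed.
Let fPhi : f = (G * P) \oa.
Proof.
have h : (G * P) \oa * ((1 - a) * L \oa) = 1.
  rewrite -{2}(fps_compX a0) -(fps_comp1 a) -fps_compB// -!fps_compM//.
  rewrite (_ : G * P * ((1 - X) * L) = ((1 - X) * G) * (P * L)); last by ring.
  by rewrite PL fps_geomV mulr1.
by rewrite -[LHS]mulr1 -h mulrCA fE mulr1.
Qed.
Let fP : f * (1 - a) = P \oa.
Proof.
have h := congr1 (fun u => fps_comp u a) PL; rewrite fps_compM// fps_comp1// in h.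
transitivity (f * (1 - a) * (P \oa * L \oa)); first by rewrite h mulr1.
by rewrite mulrACA mulrAC fE mul1r.
Qed.
(** Composing with a gives 1 - X = 1 - m(a) = (1 - a)^2 Q(a), and f (1 - a) = P(a): the factor 1 - a
    disappears. *)
Let fsq : (1 - X) * f ^+ 2 = E \oa.
Proof.
have h := congr1 (fun u => fps_comp u a) QE.
rewrite fps_compM// fps_compXn// !fps_compB// fps_comp1// fps_compX// ma in h.
rewrite -h /E fps_compM// fps_compXn// -fP; ring.
Qed.

Let M y := fsum (fps_scale y m).
Let M' y := fsum (fps_scale y (D m)).

Let M_derive (y : R) : `|y| <= 1 -> is_derive y 1 M (M' y).
Proof.
move=> y1; apply: (fsum_scale_derive r0 rapid_mr).
exact: le_lt_trans y1 r1.
Qed.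

Let M1 : M 1 = 1. Proof. by rewrite /M fps_scale_1. Qed.
Let M'1 : M' 1 = 0. Proof. by rewrite /M' fps_scale_1. Qed.

Let sDm : summable (D m). Proof. exact/rapid_summable/rapid_deriv. Qed.

Let Lval_gt0 (y : R) : 0 <= y <= 1 -> 0 < fsum (fps_scale y L).
Proof. by move=> y01; apply: (fsum_scale_gt0 y01 sL Lpos _ Lq); have := q12; lra. Qed.

Let M'E (y : R) : 0 <= y <= 1 -> M' y = (1 - y) * fsum (fps_scale y L).
Proof. by move=> y01; rewrite /M' -LE fsum_scale_1subX. Qed.

(** A truncated form of m'(a) a' = 1. Since f is the composition of 1 / m' with a and 1 / m' has
    nonnegative coefficients, a partial sum of f at x is at most the value of 1 / m' at the partial
    sum y of a. *)
Let psum_scale_le (n : nat) (x : R) : 0 <= x <= 1 -> psum (fps_scale x a) n <= 1 ->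
  M' (psum (fps_scale x a) n) * \sum_(i < n) f i * x ^+ i <= 1.
Proof.
move=> /andP[x0 x1] y1; set y := psum _ n in y1 *.
have sa_ge0 k : 0 <= fps_scale x a k by rewrite mulr_ge0// exprn_ge0.
have y0 : 0 <= y by apply: psum_ge0.
have y01 : 0 <= y <= 1 by rewrite y0.
case: n @y y1 y0 y01 => [|n] y y1 y0 y01; first by rewrite big_ord0 mulr0.
move: y1; rewrite le_eqVlt => /predU1P[->|y1]; first by rewrite M'1 mul0r.
have Phi_ge0 k : 0 <= (G * P) k by exact: (fps_geom_inv_ge0 Lpos q0 q12 Lq).
have sPhi : summable (fps_scale y (G * P)).
  apply: summable_scale_bounded => //; have [B hB] := sum_P.
  by exists B => k; apply: le_trans (psum_abs P k) (hB k).
have h1 : \sum_(i < n.+1) f i * x ^+ i <= fsum (fps_scale y (G * P)).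
  apply: le_trans (psum_le_fsum n _ sPhi); last first.
    by move=> k; rewrite mulr_ge0// ?exprn_ge0//; apply: Phi_ge0.
  have -> : \sum_(i < n.+1) f i * x ^+ i = psum (fps_scale x f) n by rewrite psumE.
  rewrite fPhi fps_scale_comp psum_comp; last first.
    by rewrite /fps_scale a0 mul0r.
  rewrite psumE; apply: ler_sum => k _; rewrite ler_wpM2l//.
  apply: le_trans (psumX_le _ _ sa_ge0) _.
  by rewrite lerXn2r ?nnegrE ?psum_ge0// psum_le.
have M'0 : 0 <= M' y.
  by rewrite M'E// mulr_ge0 ?subr_ge0 ?(ltW y1)// ltW// Lval_gt0.
apply: le_trans (ler_wpM2l M'0 h1) _.
rewrite -fsumM//; last exact: summable_scale.
rewrite -fps_scaleM -LE (_ : _ * _ * _ = (1 - X) * G * (P * L)); last by ring.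
by rewrite PL fps_geomV mulr1 fps_scale1 fsum1.
Qed.

(** If the truncation p of a exceeded 1 at 1, it would take the value 1 at some x0 in ]0, 1]. By the
    previous bound x - M(p(x)) is nondecreasing on [0, x0], so x0 >= M(1) = 1, hence x0 = 1 and p(1)
    = 1. *)
Let psum_a_le1 n : psum a n <= 1.
Proof.
case: n => [|n]; first by rewrite psum0 a0.
rewrite leNgt; apply/negP => A1.
pose p := \poly_(i < n.+2) a i.
have pE x : p.[x] = psum (fps_scale x a) n.+1.
  by rewrite horner_poly psumE.
have dpE x : p^`().[x] = \sum_(i < n.+1) f i * x ^+ i.
  rewrite (@horner_coef_wide _ n.+1).
    by apply: eq_bigr => i _; rewrite coef_deriv coef_poly ltnS ltn_ord -mulr_natl.
  by apply/leq_sizeP => j nj; rewrite coef_deriv coef_poly ltnS ltnNge nj mul0rn.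
have p0 : p.[0] = 0 by rewrite horner_poly big_ord_recl big1 ?a0 ?mul0r ?addr0// => i _; rewrite expr0n mulr0.
have p1 : p.[1] = psum a n.+1 by rewrite pE fps_scale_1.
have [x0 x001 px0] : exists2 c, c \in `[0, 1] & p.[c] = 1.
  apply: IVT => //; first exact/continuous_subspaceT/continuous_horner.
  by rewrite p0 p1 minElt maxElt (lt_trans ltr01 A1) ler01 ltW.
move: x001; rewrite in_itv /= => /andP[x00 x01].
have {}x00 : 0 < x0.
  rewrite lt_def x00 andbT; apply/eqP => e; move: px0; rewrite e p0 => /eqP.
  by rewrite eq_sym oner_eq0.
pose g : R -> R := id - (M \o horner p).
pose dg x := 1 - M' p.[x] * p^`().[x].
have px01 x : 0 <= x <= x0 -> 0 <= p.[x] <= 1.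
  move=> /andP[xge xle]; rewrite pE psum_ge0/=; last by move=> k; rewrite mulr_ge0// exprn_ge0.
  rewrite -px0 pE !psumE; apply: ler_sum => i _; rewrite ler_wpM2l// lerXn2r ?nnegrE//.
  exact: ltW.
have gd x : 0 <= x <= x0 -> is_derive x 1 g (dg x).
  move=> hx; have /andP[px0' px1] := px01 _ hx.
  have hM : is_derive p.[x] 1 M (M' p.[x]) by apply: M_derive; rewrite ger0_norm.
  have h1 := is_derive1_comp hM (is_derive_poly p x).
  have h2 := is_deriveB (is_derive_id x 1) h1.
  exact: h2.
have [||c cI] := @MVT _ g dg 0 x0 x00.
- by move=> x; rewrite in_itv /= => /andP[? ?]; apply: gd; rewrite !ltW.
- apply: derivable_within_continuous => x; rewrite in_itv /= => hx.
  by case: (gd x hx).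
rewrite in_itv /= in cI; move/andP: cI => [c0 cx].
have cI : 0 <= c <= x0 by rewrite !ltW.
have dg0 : 0 <= dg c.
  rewrite subr_ge0 pE dpE; apply: psum_scale_le.
    by rewrite (ltW c0) (le_trans (ltW cx)).
  by rewrite -pE; case/andP: (px01 _ cI).
have M0 : M 0 = 0.
  rewrite /M; apply: fsum_lim; rewrite (_ : psum _ = cst 0); first exact: cvg_cst.
  apply/funext => k; rewrite psumE big_ord_recl {1}/fps_scale m0 mul0r add0r big1// => i _.
  by rewrite /fps_scale expr0n mulr0.
rewrite /g !fctE /= p0 px0 M0 M1 !subr0 => h.
have x1 : x0 = 1.
  apply/eqP; rewrite eq_le x01 -subr_ge0 h mulr_ge0//; exact: ltW.
by move: A1; rewrite -p1 -x1 px0 x1 ltxx.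
Qed.

Let sum_a : summable a.
Proof.
exists 1 => n; rewrite (_ : fabs a = a) ?psum_a_le1//.
by apply/funext => k; rewrite /fabs ger0_norm.
Qed.

Let fsum_a_le1 : fsum a <= 1. Proof. exact: fsum_le. Qed.

(** Evaluating m(a) = X at 1 gives M(y) = 1 = M(1) for y the sum of a. If y < 1, then M' would
    vanish inside ]y, 1[, where it is (1 - c) L(c) > 0. *)
Let fsum_a : fsum a = 1.
Proof.
set y := fsum a; have y0 : 0 <= y by apply: fsum_ge0.
apply/eqP; rewrite eq_le fsum_a_le1 /= leNgt; apply/negP => y1.
have My : M y = 1.
  by have := fsum_comp a0 a_ge0 sum_a fsum_a_le1 sum_m; rewrite ma fsumX => /esym.
have n1 x : x \in `[y, 1] -> `|x| <= 1.
  rewrite in_itv /= => /andP[yx x1]; rewrite ger0_norm//; exact: le_trans yx.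
have [||c] := @MVT _ M M' y 1 y1.
- by move=> x xI; apply/M_derive/n1/subset_itv_oo_cc.
- by apply: derivable_within_continuous => x /n1 /M_derive [].
rewrite in_itv /= => /andP[yc c1]; rewrite M1 My subrr => /esym/eqP.
have c01 : 0 <= c <= 1 by rewrite (le_trans y0 (ltW yc)) ltW.
rewrite M'E// !mulf_eq0 !subr_eq0 (gt_eqF c1) (gt_eqF y1) orbF /=.
by rewrite (gt_eqF (Lval_gt0 c01)).
Qed.

Let sc c : summable c -> summable (c \oa).
Proof. exact: (summable_comp a0 a_ge0 sum_a fsum_a_le1). Qed.
Let fsc c : summable c -> fsum (c \oa) = fsum c.
Proof.
move=> hc; rewrite (fsum_comp a0 a_ge0 sum_a fsum_a_le1)// fsum_a.
by congr fsum; apply/funext => n; rewrite expr1n mulr1.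
Qed.

(** The coefficients of f^2 are the partial sums of the summable series E(a), and by positivity the
    one of index n is at least f_0 f_n. *)
Let f_bounded : bounded_coefs f.
Proof.
have [B hB] := sc sE; exists (B / f 0%N) => n.
rewrite ler_pdivlMr// ger0_norm// mulrC; apply: le_trans (hB n).
apply: le_trans (psum_abs (E \oa) n); apply: le_trans (ler_norm _).
have -> : psum (E \oa) = f ^+ 2.
  by rewrite -fsq /psum mulrA [G * _]mulrC fps_geomV mul1r.
rewrite expr2 fpsME big_ord_recl subn0 lerDl; apply: sumr_ge0 => i _.
by rewrite mulr_ge0.
Qed.

Let b := (1 - X) * isqrt R * f.
Let z := (D E) \oa.
Let fb : f = isqrt R * b.
Proof.
transitivity ((1 - X) * isqrt R ^+ 2 * f); first by rewrite isqrt_sq mul1r.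
by rewrite /b; ring.
Qed.
Let bsq : b ^+ 2 = E \oa.
Proof.
transitivity ((1 - X) * isqrt R ^+ 2 * ((1 - X) * f ^+ 2)); first by rewrite /b; ring.
by rewrite isqrt_sq mul1r fsq.
Qed.
(* Differentiating b ^+ 2 = E \oa makes the square root of E disappear. *)
Let db : D b *+ 2 = isqrt R * z.
Proof.
have := congr1 D bsq; rewrite fps_deriv_comp// -/z -/f expr2 fps_derivM => h.
have fU := fE; set U := (1 - a) * L \oa in fU.
transitivity (isqrt R * ((D b * b + b * D b) * U)).
  transitivity (((1 - X) * isqrt R ^+ 2) * (f * U) * (D b *+ 2)).
    by rewrite isqrt_sq fU !mul1r.
  by move: (D b) => B; rewrite /b; ring.
by rewrite h -[z * f * U]mulrA fU mulr1.
Qed.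

(** The derivative of z = E'(a) is E''(a) f, a summable series times a bounded one, so k z_k is
    bounded and [isqrt_conv_le] applies to 2 b' = isqrt z. This is why E must be summable together
    with its first two derivatives. *)
Let b_decay : exists2 B, 0 <= B & forall n, n.+1%:R * `|b n.+1| <= B * isqrt R n.
Proof.
have [S hS] := sc sDE; rewrite -/z in hS.
have [C1 hC1] : bounded_coefs (D z).
  by rewrite /z fps_deriv_comp// -/f; apply: summableM_bounded => //; apply: sc.
have S0 : 0 <= S by apply: le_trans (hS 0%N); apply: psum_ge0; exact: fabs_ge0.
have C10 : 0 <= C1 by apply: le_trans (hC1 0%N).
have normD c k : `|D c k| = k.+1%:R * `|c k.+1| by rewrite normrM normr_nat.
have hz k : k.+1%:R * `|z k| <= 2 * C1 + S.
  case: k => [|k].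
    rewrite mul1r; apply: (@le_trans _ _ S); last by rewrite lerDr mulr_ge0.
    exact: le_trans (psum_coef_le 0 (fabs_ge0 z)) (hS 0%N).
  apply: (@le_trans _ _ (2 * C1)); last by rewrite lerDl.
  apply: (@le_trans _ _ (2 * `|D z k|)); last by rewrite ler_wpM2l.
  rewrite normD mulrA ler_wpM2r// -natrM ler_nat.
  by rewrite mul2n -addnn addSn addnS ltnS leq_addr.
have h := isqrt_conv_le hS hz.
exists (3 * S + 4 * (2 * C1 + S)); first by rewrite !(addr_ge0, mulr_ge0).
move=> n; apply: le_trans (h n); rewrite -db fpsMn.
rewrite -normD normrMn mulr2n lerDl.
exact: normr_ge0.
Qed.

Let sum_b : summable b.
Proof.
have [B B0 hB] := b_decay.
have h1 : summable (fps_const B * (fun n => isqrt R n / n.+1%:R)).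
  by apply: summableM; [exact: summable_const|exact: summable_isqrt_div].
have := summableD (summable_const `|b 0%N|) (summableM (summableX R) h1).
apply: summable_le => -[|k]; rewrite fpsDE fpsXM /= ?addr0// add0r fps_constM mulrA.
by rewrite ler_pdivlMr ?ltr0n// mulrC.
Qed.

Let f_ratio : (fun n => f n / isqrt R n) @ \oo --> fsum b.
Proof. by rewrite fb; have [B B0 hB] := b_decay; apply: isqrt_conv_ratio hB sum_b. Qed.

Let M2 := fsum (D (D m)).
Let L1 : fsum L = - M2.
Proof.
rewrite /M2 -LE fps_derivM fps_derivB fps_deriv1 fps_derivX sub0r mulN1r.
rewrite fsumD ?fsumN//; last first.
- by apply: summableM => //; apply: summableB; [exact: (summable_const 1)|exact: summableX].
- exact: summableN.
by rewrite fsum_1subX_mul// addr0 opprK.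
Qed.
(** In the second derivative of (1 - X)^2 Q every term except 2 Q keeps a factor 1 - X, which
    vanishes at 1. *)
Let Q1 : fsum Q *+ 2 = - M2.
Proof.
have h := congr1 (fun c => D (D c)) QE.
rewrite fps_derivB fps_deriv1 sub0r fps_derivN in h.
have e : D (D ((1 - X) ^+ 2 * Q)) = Q *+ 2 + (1 - X) * ((1 - X) * D (D Q) - (D Q) *+ 4).
  have d1X : D (1 - X) = -1 by rewrite fps_derivB fps_deriv1 fps_derivX sub0r.
  by rewrite expr2 !(fps_derivM, d1X, fps_derivD, fps_derivN, fps_deriv1); ring.
rewrite e in h.
have s1X : summable (1 - X) by apply: summableB; [exact: (summable_const 1)|exact: summableX].
have s4 : summable ((1 - X) * D (D Q) - (D Q) *+ 4).
  apply: summableB; first exact: summableM.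
  rewrite -mulr_natl; apply: summableM => //.
  by rewrite -(rmorph_nat (@fps_const R)); apply: summable_const.
have := congr1 (@fsum R) h; rewrite fsumD.
- rewrite fsum_1subX_mul// addr0 fsumN; last exact/rapid_summable/rapid_deriv/rapid_deriv.
  by rewrite !mulr2n fsumD.
- by rewrite mulr2n; apply: summableD.
- exact: summableM.
Qed.
Let M2_lt0 : M2 < 0.
Proof. by rewrite -oppr_gt0 -L1 -(fps_scale_1 L); apply: Lval_gt0; rewrite ler01 lexx. Qed.

(** The square of the sum of b is E(1); its sign is that of the limit of the nonnegative ratios in
    [f_ratio]. *)
Let fsum_b : fsum b = (Num.sqrt (- (2 * M2)))^-1.
Proof.
have b_ge0 : 0 <= fsum b.
  have := f_ratio; move/cvg_lim => <- //.
  apply: limr_ge; first by apply/cvg_ex; exists (fsum b); exact: f_ratio.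
  by apply: nearW => n; rewrite divr_ge0 ?f_ge0// ltW// isqrt_gt0.
rewrite -sqrtrV ?oppr_ge0; last by rewrite pmulr_rle0// ltW.
rewrite -[LHS](ger0_norm b_ge0) -sqrtr_sqr -fsumXn// bsq fsc//; congr Num.sqrt.
rewrite /E fsumM// fsumXn//.
have := congr1 (@fsum R) PL; rewrite fsumM// fsum1 L1 => hP.
have M2n : M2 != 0 by rewrite lt_eqF.
have -> : fsum P = - M2^-1.
  by apply: (mulIf (_ : - M2 != 0)); rewrite ?oppr_eq0// hP mulrNN mulVf.
have -> : fsum Q = - M2 / 2 by have := Q1; rewrite mulr2n => <-; field.
by field.
Qed.

Lemma inversion_asymptotics_aux :
  (fun n => a n * (n%:R * Num.sqrt n%:R)) @ \oo -->
    (Num.sqrt (- (2 * pi * fsum (D (D m)))))^-1.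
Proof.
rewrite -cvg_shiftS.
have -> : (fun n => a n.+1 * (n.+1%:R * Num.sqrt n.+1%:R)) =
    (fun n => (f n / isqrt R n) * (Num.sqrt n.+1%:R * isqrt R n)).
  apply/funext => n; rewrite /f /D.
  rewrite [X in _ = _ * X]mulrC [RHS]mulrA mulfVK ?gt_eqF ?isqrt_gt0//.
  by rewrite mulrA [a _ * _]mulrC.
have := cvgM f_ratio (@isqrt_asymp R); rewrite fsum_b -invfM -sqrtrM ?oppr_ge0; last first.
  by rewrite pmulr_rle0// ltW.
rewrite mulNr [2 * _ * pi]mulrAC => h; exact: h.
Qed.
End InversionAsymptotics.

Lemma inversion_asymptotics (R : realType) (m a : fps R) (K C q : R) :
  1 < K -> (forall n, `|m n| * K ^+ n <= C) ->
  m 0%N = 0 -> fsum m = 1 -> fsum (fps_deriv m) = 0 ->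
  0 < m 1%N -> 0 <= q -> q < 1 / 2 ->
  (forall n, \sum_(i < n) `|\sum_(k < i.+2) k.+1%:R * m k.+1| <= q * m 1%N) ->
  a 0%N = 0 -> (forall n, 0 <= a n) -> fps_comp m a = fpsX R ->
  (fun n => a n * (n%:R * Num.sqrt n%:R)) @ \oo -->
    (Num.sqrt (- (2 * pi * fsum (fps_deriv (fps_deriv m)))))^-1.
Proof.
move=> K1 mK m0 m1 dm l0 q0 q12 tl a0 age0 ma.
have r1 : 1 < (1 + K) / 2 by lra.
have rK : (1 + K) / 2 < K by lra.
exact: (inversion_asymptotics_aux K1 mK m0 m1 dm l0 q0 q12 tl a0 age0 ma r1 rK).
Qed.

(** * Decompositions as sets of codes *)

Section Codes.
Variable d : nat.
Local Open Scope fset_scope.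
Local Open Scope nat_scope.

(* A code gives for each axis a pair (N, j) standing for the interval
   (j/N, (j+1)/N); composition places the second box inside the first one. *)
Definition code := {ffun 'I_d -> nat * nat}.
Implicit Types (c : code) (S : {fset code}) (f g : nat -> {fset code}).

Definition code1 : code := [ffun=> (1, 0)].
Definition code_comp c c' : code :=
  [ffun i => ((c i).1 * (c' i).1, (c i).2 * (c' i).1 + (c' i).2)].
Definition cell i p j : code := [ffun k => if k == i then (p, j) else (1, 0)].
Definition valid c := forall i, (c i).2 < (c i).1.

Lemma code_compA : associative code_comp.
Proof.
move=> a b c; apply/ffunP => i; rewrite !ffunE /=; congr pair; first by rewrite mulnA.
by rewrite mulnDl addnA mulnA.
Qed.
Lemma code_comp1 c : code_comp code1 c = c.
Proof. by apply/ffunP => i; rewrite !ffunE /= mul1n mul0n; case: (c i). Qed.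
Lemma code_comp1r c : code_comp c code1 = c.
Proof. by apply/ffunP => i; rewrite !ffunE /= !muln1 addn0; case: (c i). Qed.
Lemma cell1 i : cell i 1 0 = code1.
Proof. by apply/ffunP => k; rewrite !ffunE; case: eqP. Qed.
Lemma cell_mul i p q j k :
  code_comp (cell i p j) (cell i q k) = cell i (p * q) (j * q + k).
Proof. by apply/ffunP => l; rewrite !ffunE; case: eqP. Qed.
Lemma cellC i k p q j l : i != k ->
  code_comp (cell i p j) (cell k q l) = code_comp (cell k q l) (cell i p j).
Proof.
move=> ik; apply/ffunP => m; rewrite !ffunE.
case: eqP => [->|_]; last by case: eqP; rewrite /= ?mul0n ?muln1 ?mul1n ?addn0.
by rewrite (negbTE ik) /= mul0n !muln1 mul1n addn0.
Qed.
(** On axis i the position is j N + k with k < N, N being the subdivision of c, so j is recovered by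
    Euclidean division. *)
Lemma cell_comp_inj i p j j' c c' : 0 < p -> valid c -> valid c' ->
  code_comp (cell i p j) c = code_comp (cell i p j') c' -> j = j' /\ c = c'.
Proof.
move=> p0 vc vc' /ffunP e; have ei := e i.
rewrite !ffunE eqxx /= in ei; case: ei => /eqP.
rewrite eqn_pmul2l// => /eqP eN ej.
have ejj : j = j'.
  have := congr1 (fun x => x %/ (c i).1) ej; have N0 : 0 < (c i).1 by apply: leq_ltn_trans (vc i).
  by rewrite -eN !divnMDl// !divn_small ?addn0// eN; apply: vc'.
split=> //; apply/ffunP => k; have := e k; rewrite !ffunE.
case: eqP => [->|_] /=; last first.
  by rewrite !mul1n !mul0n !add0n; case: (c k) (c' k) => ? ? [].
move=> _; move: ej; rewrite eN ejj => /addnI; case: (c i) (c' i) eN => ? ? [? ?] /= -> ->//.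
Qed.
Lemma valid1 : valid code1. Proof. by move=> i; rewrite ffunE. Qed.
Lemma valid_comp c c' : valid c -> valid c' -> valid (code_comp c c').
Proof.
move=> v v' i; rewrite ffunE /=; have := v i; have := v' i.
move: (c i) (c' i) => [N j] [M k] /= kM jN.
by apply: (@leq_trans (j.+1 * M)); rewrite ?leq_mul2r ?jN ?orbT// mulSnr ltn_add2l.
Qed.
Lemma valid_cell i p j : j < p -> valid (cell i p j).
Proof. by move=> jp k; rewrite ffunE; case: eqP. Qed.

(** The tree with root cut into p slabs along axis i. The children form a function on all naturals,
    which avoids dependent families; those of index below p are read. *)
Definition node i p f : {fset code} :=
  \bigcup_(j <- iota 0 p) [fset code_comp (cell i p j) c | c in f j].

Lemma nodeP i p f c : reflect (exists j, j < p /\ exists c', c' \in f j /\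
  c = code_comp (cell i p j) c') (c \in node i p f).
Proof.
apply: (iffP (bigfcupP _ _ _ _)).
  move=> [j]; rewrite mem_iota /= add0n => /andP[jp _] /imfsetP[c' /= hc' ->].
  by exists j; split=> //; exists c'.
move=> [j [jp [c' [hc' ->]]]]; exists j; rewrite ?mem_iota ?add0n ?jp//.
by apply/imfsetP; exists c'.
Qed.

Lemma node_ext i p f g : (forall j, j < p -> f j = g j) -> node i p f = node i p g.
Proof.
move=> h; apply/fsetP => c.
apply/nodeP/nodeP => -[j [jp [c' [hc' ->]]]]; exists j; split=> //; exists c'.
  by rewrite -h.
by rewrite h.
Qed.
Lemma node1 i f : node i 1 f = f 0.
Proof.
apply/fsetP => c; apply/nodeP/idP => [[j []]|hc].
  rewrite ltnS leqn0 => /eqP -> [c' [hc' ->]]; by rewrite cell1 code_comp1.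
by exists 0; split=> //; exists c; rewrite cell1 code_comp1.
Qed.
(** With [node_mul], this is how a prescribed cut is moved up to the root in [tdec_split]. *)
Lemma node_comm i k p r (g : nat -> nat -> {fset code}) : i != k ->
  node k r (fun j => node i p (g j)) = node i p (fun m => node k r (fun j => g j m)).
Proof.
have H a b s t (h : nat -> nat -> {fset code}) c : a != b ->
    c \in node b s (fun j => node a t (h j)) ->
    c \in node a t (fun m => node b s (fun j => h j m)).
  move=> ab /nodeP[j [js [c1 [/nodeP[m [mt [c2 [hc2 ->]]]] ->]]]].
  apply/nodeP; exists m; split=> //; exists (code_comp (cell b s j) c2).
  split; first by apply/nodeP; exists j; split=> //; exists c2.
  by rewrite !code_compA (cellC _ _ _ _ ab).
move=> ik; apply/fsetP => c; apply/idP/idP; first exact: H.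
by move/(H k i p r (fun m j => g j m) c); rewrite eq_sym; exact.
Qed.
Lemma node_mul i r p (g : nat -> nat -> {fset code}) : 0 < p ->
  node i r (fun j => node i p (g j)) = node i (r * p) (fun t => g (t %/ p) (t %% p)).
Proof.
move=> p0; apply/fsetP => c; apply/nodeP/nodeP.
  move=> [j [jr [c1 [/nodeP[m [mp [c2 [hc2 ->]]]] ->]]]].
  exists (j * p + m); split.
    by apply: (@leq_trans (j.+1 * p)); rewrite ?leq_mul2r ?jr ?orbT// mulSnr ltn_add2l.
  exists c2; rewrite divnMDl// modnMDl modn_small// divn_small// addn0; split=> //.
  by rewrite code_compA cell_mul.
move=> [t [ht [c2 [hc2 ->]]]]; exists (t %/ p); split; first by rewrite ltn_divLR.
exists (code_comp (cell i p (t %% p)) c2); split.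
  by apply/nodeP; exists (t %% p); split; rewrite ?ltn_mod//; exists c2.
by rewrite code_compA cell_mul -divn_eq.
Qed.

(* The cuts are listed from the cube downwards, in contrast with
   [decomposition], where the last cut refines a single region. *)
Inductive tdec : {fset code} -> Prop :=
| tdec_leaf : tdec [fset code1]
| tdec_node i p f : 1 < p -> (forall j, tdec (f j)) -> tdec (node i p f).

Lemma tdec_valid S c : tdec S -> c \in S -> valid c.
Proof.
move=> hS; elim: hS c => [c|i p f p1 _ IH c]; first by rewrite inE => /eqP ->; exact: valid1.
move=> /nodeP[j [jp [c' [hc' ->]]]]; apply: valid_comp (IH _ _ hc').
exact: valid_cell.
Qed.
Lemma tdec_neq0 S : tdec S -> exists c, c \in S.
Proof.
elim=> [|i p f p1 _ IH]; first by exists code1; rewrite inE.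
have [c hc] := IH 0; exists (code_comp (cell i p 0) c); apply/nodeP.
by exists 0; split; [exact: ltnW|exists c].
Qed.

Definition all_dvd i q S := forall c, c \in S -> q %| (c i).1.

Lemma node_cellE i p f j c : 0 < p -> (forall k, tdec (f k)) -> j < p -> valid c ->
  (code_comp (cell i p j) c \in node i p f) = (c \in f j).
Proof.
move=> p0 hf jp vc; apply/nodeP/idP => [[k [kp [c' [hc' e]]]]|hc]; last first.
  by exists j; split=> //; exists c.
by have [-> ->] := cell_comp_inj p0 vc (tdec_valid (hf k) hc') e.
Qed.

Lemma node_inj i p f g : 0 < p -> (forall k, tdec (f k)) -> (forall k, tdec (g k)) ->
  node i p f = node i p g -> forall j, j < p -> f j = g j.
Proof.
move=> p0 hf hg e j jp; apply/fsetP => c.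
have [vc|nvc] := pselect (valid c).
  by rewrite -(node_cellE i p0 hf jp vc) e node_cellE.
by apply/idP/idP => hc; exfalso; apply: nvc; [exact: tdec_valid (hf j) hc|exact: tdec_valid (hg j) hc].
Qed.

Lemma card_node i p f : 0 < p -> (forall k, tdec (f k)) ->
  #|` node i p f| = \sum_(j < p) #|` f j|.
Proof.
move=> p0 hf; rewrite /node -(big_mkord xpredT (fun j => #|` f j|)) /index_iota subn0.
elim: (iota 0 p) (iota_uniq 0 p) => [|j s IH] /=; first by rewrite !big_nil cardfs0.
move=> /andP[js us]; rewrite !big_cons -IH//.
rewrite cardfsU (_ : _ `&` _ = fset0) ?cardfs0 ?subn0.
  congr (_ + _); rewrite card_in_imfset// => c c' hc hc' e.
  by have [] := cell_comp_inj p0 (tdec_valid (hf j) hc) (tdec_valid (hf j) hc') e.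
apply/fsetP => c; rewrite inE [RHS]inE; apply/negP => /andP[/imfsetP[c1 /= hc1 ->]].
move=> /bigfcupP[k /andP[ks _] /imfsetP[c2 /= hc2 e]].
have [jk _] := cell_comp_inj p0 (tdec_valid (hf j) hc1) (tdec_valid (hf k) hc2) e.
by rewrite jk ks in js.
Qed.

Lemma tdec_card_gt0 S : tdec S -> 0 < #|` S|.
Proof. by move=> /tdec_neq0[c hc]; rewrite cardfs_gt0; apply/fset0Pn; exists c. Qed.

(* Divisibility of all the edge subdivisions by a prime p forces a cut into p
   equal slabs, because a first cut along the same axis into r parts is either
   a refinement of it or leaves the divisibility to the parts. *)
Lemma tdec_split i p S : prime p -> tdec S -> all_dvd i p S ->
  exists2 g, forall j, tdec (g j) & S = node i p g.
Proof.
move=> pp; have p1 := prime_gt1 pp; have p0 := ltnW p1.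
elim=> [|k r f r1 hf IH] hd.
  by have := hd code1; rewrite inE ffunE eqxx dvdn1 => /(_ isT) /eqP e; rewrite e in p1.
have r0 := ltnW r1.
have [ki|ki] := eqVneq k i.
  rewrite {k}ki in hd *.
  have [/dvdnP[r' er]|pr] := boolP (p %| r).
    rewrite er mulnC in r1 r0 hd *.
    have r'0 : 0 < r' by move: r0; case: r' {er r1 hd}; rewrite ?muln0.
    exists (fun m => node i r' (fun l => f (m * r' + l))).
      (* When r' = 1 the inner cut has a single part, which [tdec_node] forbids; it is then the
         child itself. *)
      move=> m; have [r'1|r'1] := ltnP 1 r'; first exact: tdec_node.
      have -> : r' = 1 by apply/eqP; rewrite eqn_leq r'1.
      by rewrite node1.
    by rewrite node_mul//; apply: node_ext => j _; rewrite -divn_eq.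
  (* By Euclid's lemma p divides the subdivisions inside each child, so every child starts with p
     slabs. The resulting r p slabs are regrouped as p groups of r. Beyond r a leaf is the default
     child. *)
  have /choice[G hG] : forall j, exists g, (forall m, tdec (g m)) /\ (j < r -> f j = node i p g).
    move=> j; have [jr|jr] := ltnP j r; last by exists (fun=> [fset code1]); split=> // _; exact: tdec_leaf.
    have [|g hg e] := IH j; last by exists g.
    move=> c hc; have := hd (code_comp (cell i r j) c).
    rewrite !ffunE eqxx /= Euclid_dvdM// (negbTE pr) /=; apply.
    by apply/nodeP; exists j; split=> //; exists c.
  exists (fun m => node i r (fun j => G ((m * r + j) %/ p) ((m * r + j) %% p))).
    by move=> m; apply: tdec_node => // j; apply: (hG _).1.
  rewrite node_mul// (@node_ext _ _ f (fun j => node i p (G j))); last first.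
    by move=> j /(hG j).2.
  by rewrite node_mul// mulnC; apply: node_ext => j _; rewrite -divn_eq.
have /choice[G hG] : forall j, exists g, (forall m, tdec (g m)) /\ (j < r -> f j = node i p g).
  move=> j; have [jr|jr] := ltnP j r; last by exists (fun=> [fset code1]); split=> // _; exact: tdec_leaf.
  have [|g hg e] := IH j; last by exists g.
  move=> c hc; have := hd (code_comp (cell k r j) c).
  rewrite !ffunE eq_sym (negbTE ki) /= mul1n; apply.
  by apply/nodeP; exists j; split=> //; exists c.
exists (fun m => node k r (fun j => G j m)).
  by move=> m; apply: tdec_node => // j; apply: (hG j).1.
rewrite -node_comm//; last by rewrite eq_sym.
by apply: node_ext => j /(hG j).2.
Qed.

(** A cut into p slabs adds at least p - 1 regions outside the slab that contains c, and p <= 2^(p -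
    1). This makes the set of decompositions of a given size finite. *)
Lemma tdec_bound S c i : tdec S -> c \in S -> (c i).1 <= 2 ^ #|` S|.
Proof.
move=> hS; elim: hS c => [c|k p f p1 hf IH c].
  by rewrite inE => /eqP ->; rewrite ffunE expn_gt0.
have p0 := ltnW p1.
move=> /nodeP[j [jp [c' [hc' ->]]]]; rewrite card_node// ffunE /=.
have -> : \sum_(m < p) #|` f m| = #|` f j| + \sum_(m < p | m != Ordinal jp) #|` f m|.
  by rewrite (bigD1 (Ordinal jp)).
have h1 : p.-1 <= \sum_(m < p | m != Ordinal jp) #|` f m|.
  rewrite (_ : p.-1 = \sum_(m < p | m != Ordinal jp) 1); last first.
    by rewrite sum1_card cardC1 card_ord.
  by apply: leq_sum => m _; apply: tdec_card_gt0.
have h2 : p <= 2 ^ \sum_(m < p | m != Ordinal jp) #|` f m|.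
  by apply: leq_trans (_ : 2 ^ p.-1 <= _); rewrite ?leq_pexp2l// -{1}(prednK p0) ltn_expl.
have h3 := IH j c' hc'.
rewrite ffunE addnC expnD; case: eqP => _ /=; first exact: leq_mul.
rewrite mul1n; apply: leq_trans h3 _; rewrite leq_pmull// expn_gt0//.
Qed.
End Codes.

(** * Counting the decompositions that refine a grid *)

Section Counting.
Local Open Scope fset_scope.
Variable R : realType.

Lemma fpsX_expr k n : (fpsX R ^+ k) n = (n == k)%:R.
Proof.
elim: k n => [|k IH] n; first by rewrite expr0 fps1E.
by rewrite exprS fpsXM; case: n => //= n; rewrite IH eqSS.
Qed.

Lemma fps_expr_ext (F H : fps R) n p : (forall k, (k <= n)%N -> F k = H k) ->
  (F ^+ p) n = (H ^+ p) n.
Proof.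
move=> h; elim: p {-2}n (leqnn n) => [|p IH] m mn; first by rewrite !expr0.
rewrite !exprS !fpsME; apply: eq_bigr => i _.
have im : (i <= m)%N by rewrite -ltnS.
by rewrite h ?(leq_trans im)// IH// (leq_trans (leq_subr _ _)).
Qed.

(** Coefficient n of a power sees F only up to n, where it agrees with the finite sum of the X^(w
    x); expanding the product of p such sums enumerates the p-tuples. *)
Lemma fps_expr_count (K : choiceType) (B : {fset K}) (w : K -> nat) (F : fps R) n p :
  (forall k, (k <= n)%N -> F k = (count (fun x => w x == k) B)%:R) ->
  (F ^+ p) n = #|[pred f : {ffun 'I_p -> B} | (\sum_j w (val (f j)))%N == n]|%:R.
Proof.
move=> hF.
have -> : (F ^+ p) n = ((\sum_(x : B) fpsX R ^+ w (val x)) ^+ p) n.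
  apply: fps_expr_ext => k kn; rewrite hF//.
  rewrite -(big_seq_fsetE _ B xpredT (fun x => fpsX R ^+ w x)) fps_sumE -sum1_count natr_sum.
  rewrite big_mkcond; apply: eq_bigr => x _; rewrite fpsX_expr eq_sym.
  by case: eqP.
rewrite -[p in LHS]card_ord -prodr_const bigA_distr_bigA fps_sumE /=.
rewrite -sum1_card natr_sum [RHS]big_mkcond; apply: eq_bigr => f _.
rewrite (_ : \prod_i _ = fpsX R ^+ (\sum_j w (val (f j)))%N); last first.
  by elim/big_rec2: _ => [|i a b _ ->]; rewrite ?expr0// exprD.
by rewrite fpsX_expr inE eq_sym; case: eqP.
Qed.

Variable d : nat.
Local Notation code := (code d).
Implicit Types (S : {fset code}) (q : 'I_d -> nat).

Lemma finite_tdec n : finite_set [set S : {fset code} | tdec S /\ (#|` S| <= n)%N].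
Proof.
pose b := (2 ^ n).+1.
pose F (g : {ffun 'I_d -> 'I_b * 'I_b}) : code :=
  [ffun i => ((g i).1 : nat, (g i).2 : nat)].
pose B := [fset F g | g in {ffun 'I_d -> 'I_b * 'I_b}].
apply: (@sub_finite_set _ _ [set` fpowerset B]); last exact: finite_fset.
move=> S [hS Sn]; rewrite /= fpowersetE; apply/fsubsetP => c cS.
have h i : ((c i).1 < b)%N.
  by rewrite ltnS (leq_trans (tdec_bound i hS cS))// leq_pexp2l.
have h' i : ((c i).2 < b)%N by apply: leq_trans (h i); apply/ltnW/(tdec_valid hS cS).
apply/imfsetP; exists [ffun i => (Ordinal (h i), Ordinal (h' i))] => //=.
by apply/ffunP => i; rewrite !ffunE /=; case: (c i).
Qed.

(** Sizes up to n, so that the parts of a decomposition of size n lie in the same finite set. *)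
Definition decs n : {fset {fset code}} := fset_set [set S : {fset code} | tdec S /\ (#|` S| <= n)%N].
Lemma decsP n S : reflect (tdec S /\ (#|` S| <= n)%N) (S \in decs n).
Proof.
rewrite in_fset_set; last exact: finite_tdec.
by apply: (iffP idP); rewrite inE.
Qed.

Definition grid q S := forall i, all_dvd i (q i) S.
Definition grid_count q n :=
  count (fun S => (#|` S| == n) && `[< grid q S >]) (decs n).
Definition grid_series q : fps R := fun n => (grid_count q n)%:R.
Definition upd q i v : 'I_d -> nat := fun k => if k == i then v else q k.

Lemma eq_count_uniq (T : eqType) (a b : pred T) (s t : seq T) : uniq s -> uniq t ->
  (forall x, (x \in s) && a x = (x \in t) && b x) -> count a s = count b t.
Proof.
move=> us ut h; rewrite -!size_filter; apply: perm_size.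
apply: uniq_perm; rewrite ?filter_uniq// => x.
by rewrite !mem_filter andbC h andbC.
Qed.

Lemma grid_count_le q n k : (k <= n)%N ->
  grid_count q k = count (fun S => (#|` S| == k) && `[< grid q S >]) (decs n).
Proof.
move=> kn; apply: eq_count_uniq => [||S]; try exact: fset_uniq.
case: eqP => /= [e|]; last by rewrite !andbF.
congr (_ && _); apply/decsP/decsP => -[h _]; split=> //; rewrite e//.
Qed.

(** By [tdec_split] such a decomposition is a root cut into p slabs along axis i, and its slabs are
    arbitrary decompositions refining the grid with q_i / p in place of q_i. *)
Lemma grid_series_split q i p v : prime p -> (q i = p * v)%N ->
  grid_series q = grid_series (upd q i v) ^+ p.
Proof.
move=> pp qi; have p1 := prime_gt1 pp; have p0 := ltnW p1.
apply/funext => n; pose q' := upd q i v.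
pose B := [fset S in decs n | `[< grid q' S >]].
have BP S : reflect [/\ tdec S, (#|` S| <= n)%N & grid q' S] (S \in B).
  apply: (iffP idP).
    by rewrite !inE => /andP[/decsP[? ?] /asboolP ?].
  by move=> [? ? ?]; rewrite !inE; apply/andP; split; [apply/decsP|apply/asboolP].
rewrite (@fps_expr_count _ B (fun S => #|` S|)); last first.
  move=> k kn; rewrite /grid_series (grid_count_le _ kn); congr _%:R.
  apply: eq_count_uniq => [||S]; try exact: fset_uniq.
  by rewrite !inE /= [RHS]andbAC andbA.
rewrite /grid_series; congr _%:R.
(* [node] takes a child for every natural number; the missing ones are leaves. *)
pose ext (f : {ffun 'I_p -> B}) j : {fset code} :=
  oapp (fun k => val (f k)) [fset code1 d] (insub j).
have extE f (j : 'I_p) : ext f j = val (f j) by rewrite /ext valK.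
have ext_tdec f j : tdec (ext f j).
  rewrite /ext; case: (insub j) => [k|] /=; last exact: tdec_leaf.
  by have /BP[] := valP (f k).
pose phi f := node i p (ext f).
have card_phi f : #|` phi f| = (\sum_j #|` val (f j)|)%N.
  by rewrite card_node//; apply: eq_bigr => j _; rewrite extE.
have phi_inj : injective phi.
  move=> f g e; apply/ffunP => j; apply/val_inj.
  by rewrite -!extE; apply: (node_inj p0 _ _ e).
rewrite /grid_count -size_filter cardE -(size_map phi).
apply: perm_size; apply: uniq_perm.
- by rewrite filter_uniq// fset_uniq.
- by rewrite map_inj_uniq// enum_uniq.
move=> S; rewrite mem_filter; apply/idP/mapP.
  move=> /andP[/andP[/eqP Sn /asboolP hg] /decsP[hS _]].
  have [g hg1 e] : exists2 g, forall j, tdec (g j) & S = node i p g.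
    by apply: tdec_split => // c cS; have := hg i c cS; rewrite qi; apply/dvdn_trans/dvdn_mulr.
  have gB (j : 'I_p) : g j \in B.
    apply/BP; split=> //.
      by rewrite -Sn e card_node// (bigD1 j)//= leq_addr.
    move=> k c hc; have := hg k (code_comp (cell i p j) c).
    rewrite e (node_cellE i p0 hg1 (ltn_ord j) (tdec_valid (hg1 j) hc)) => /(_ hc).
    rewrite !ffunE /q' /upd; case: eqP => [->|_] /=; last by rewrite mul1n.
    by rewrite qi dvdn_pmul2l.
  have eS : S = phi [ffun j => [` gB j]].
    by rewrite e; apply: node_ext => j jp; rewrite (extE _ (Ordinal jp)) ffunE.
  by exists [ffun j => [` gB j]] => //; rewrite mem_enum inE -card_phi -eS Sn.
move=> [f]; rewrite mem_enum inE -card_phi => /eqP fn ->.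
have hp : tdec (phi f) by apply: tdec_node.
apply/andP; split; last by apply/decsP; rewrite fn.
rewrite fn eqxx /=; apply/asboolP => k c /nodeP[j [jp [c' [hc' ->]]]].
have /BP[_ _ hg] := valP (f (Ordinal jp)).
rewrite -(extE f (Ordinal jp)) in hg; have := hg k c' hc'.
rewrite !ffunE /q' /upd; case: eqP => [->|_] /=; last by rewrite mul1n.
by rewrite qi dvdn_pmul2l.
Qed.

Definition dec_series : fps R := grid_series (fun=> 1%N).

(** Each step removes one prime factor p of one q_i and contributes an exponent p; the induction is
    on a bound for the product. *)
Lemma grid_seriesE q : (forall i, 0 < q i)%N -> grid_series q = dec_series ^+ (\prod_i q i)%N.
Proof.
move: {2}(\prod_i q i)%N (leqnn (\prod_i q i)%N) => m; elim: m q => [|m IH] q qm q0.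
  by move: qm; rewrite leqNgt prodn_gt0.
have [/forallP h|] := boolP [forall i, q i == 1%N].
  rewrite (_ : q = fun=> 1%N); last by apply/funext => i; apply/eqP.
  by rewrite big1// expr1.
rewrite negb_forall => /existsP[i qi].
have qi1 : (1 < q i)%N by rewrite ltn_neqAle eq_sym qi q0.
have pp := pdiv_prime qi1; set p := pdiv (q i) in pp.
have /dvdnP[v qv] : (p %| q i)%N by apply: pdiv_dvd.
have v0 : (0 < v)%N by move: (q0 i); rewrite qv muln_gt0 => /andP[].
rewrite mulnC in qv.
have e : (\prod_k q k = p * \prod_k upd q i v k)%N.
  rewrite (bigD1 i)//= [in RHS](bigD1 i)//= /upd eqxx qv mulnA; congr (_ * _)%N.
  by apply: eq_bigr => k ki; rewrite (negbTE ki).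
have u0 k : (0 < upd q i v k)%N by rewrite /upd; case: ifP.
rewrite (grid_series_split pp qv) IH//; last first.
  have : (0 < \prod_k upd q i v k)%N by rewrite prodn_gt0.
  move: qm; rewrite e; move: (\prod_k _)%N (prime_gt1 pp) => t p1 h t0.
  rewrite -ltnS; apply: leq_trans h; rewrite -[X in (X < _)%N]mul1n ltn_pmul2r//.
by rewrite e mulnC exprM.
Qed.
End Counting.

(** * The functional equation *)

Section Mobius.

Lemma mobius1 : mobius 1 = 1. Proof. by []. Qed.

Lemma mobius_prime_mul p e : prime p -> (0 < e)%N -> ~~ (p %| e)%N ->
  mobius (p * e) = - mobius e.
Proof.
move=> pp e0 pe; have p0 := prime_gt0 pp.
have hp : perm_eq (primes (p * e)) (p :: primes e).
  apply: uniq_perm; rewrite /= ?primes_uniq ?andbT//.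
    by rewrite mem_primes (negbTE pe) !andbF.
  by move=> r; rewrite primesM// primes_prime// !inE.
rewrite /mobius muln_gt0 p0 e0 /= (perm_all _ hp) /= (perm_size hp) /=.
rewrite lognM// [logn p p]logn_prime// eqxx.
have -> : logn p e = 0%N by apply/eqP; rewrite -leqn0 leqNgt logn_gt0 mem_primes pp e0 (negbTE pe).
rewrite (_ : all _ (primes e) = all (fun r => logn r e == 1%N) (primes e)) /=; last first.
  apply: eq_in_all => r; rewrite mem_primes => /and3P[rp _ re].
  rewrite lognM// (logn_prime _ pp) (_ : (r == p) = false) ?add0n//.
  by apply/eqP => rE; move: pe; rewrite -rE re.
by case: ifP => _; rewrite ?oppr0// exprS mulN1r.
Qed.

Lemma mobius_sq p e : prime p -> (p ^ 2 %| e)%N -> mobius e = 0.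
Proof.
move=> pp; case: e => // e pe; rewrite /mobius ltn0Sn /=.
case: allP => // h; have := h p; rewrite mem_primes pp /=.
have -> : (p %| e.+1)%N by apply: dvdn_trans pe; rewrite expnS dvdn_mulr.
move=> /(_ isT) /eqP h1; have := dvdn_leq_log p (ltn0Sn e) pe.
by rewrite h1 pfactorK.
Qed.

(** For a prime p dividing n, the divisors p e with p not dividing e cancel against the divisors e,
    and those divisible by p^2 contribute 0. *)
Lemma mobius_sum n : (0 < n)%N -> \sum_(e <- divisors n) mobius e = (n == 1%N)%:R.
Proof.
move=> n0; have [->|n1] := eqVneq n 1%N; first by rewrite big_seq1.
have {}n1 : (1 < n)%N by rewrite ltn_neqAle eq_sym n1.
have pp := pdiv_prime n1; set p := pdiv n in pp; have p0 := prime_gt0 pp.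
have pn : (p %| n)%N by apply: pdiv_dvd.
have np0 : (0 < n %/ p)%N by rewrite divn_gt0// dvdn_leq.
rewrite (bigID (fun e => p %| e)%N) /=.
have -> : \sum_(e <- divisors n | (p %| e)%N) mobius e =
    \sum_(e <- [seq (p * e)%N | e <- divisors (n %/ p)]) mobius e.
  rewrite -big_filter; apply: perm_big; apply: uniq_perm.
  - by rewrite filter_uniq// divisors_uniq.
  - rewrite map_inj_uniq ?divisors_uniq// => x y /eqP; by rewrite eqn_pmul2l// => /eqP.
  move=> e; rewrite mem_filter -dvdn_divisors//; apply/andP/mapP.
    move=> [/dvdnP[k ek] en]; exists k; last by rewrite mulnC.
    by rewrite -dvdn_divisors// -(dvdn_pmul2l p0) mulnC -ek [(p * _)%N]mulnC divnK.
  move=> [k]; rewrite -dvdn_divisors// => kn ->; rewrite dvdn_mulr//; split=> //.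
  by rewrite -(divnK pn) mulnC dvdn_pmul2r.
rewrite big_map (bigID (fun e => p %| e)%N) /= big1 ?add0r; last first.
  by move=> e pe; apply: (mobius_sq pp); rewrite expnS expn1 dvdn_pmul2l.
rewrite big_seq_cond (eq_bigr (fun e => - mobius e)); last first.
  move=> e /andP[]; rewrite -dvdn_divisors// => en pe.
  by rewrite mobius_prime_mul//; apply: dvdn_gt0 en.
rewrite -big_seq_cond sumrN addrC; apply/eqP; rewrite subr_eq0; apply/eqP.
rewrite -big_filter -[RHS]big_filter; apply: perm_big; apply: uniq_perm.
- by rewrite filter_uniq// divisors_uniq.
- by rewrite filter_uniq// divisors_uniq.
move=> e; rewrite !mem_filter -!dvdn_divisors//; case: (boolP (p %| e)%N) => //= pe.
rewrite -{1}(divnK pn) Gauss_dvdl// coprime_sym prime_coprime//.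
Qed.

Lemma dirichlet0 (a b : nat -> int) : b 0%N = 0 -> dirichlet a b 0%N = 0.
Proof. by move=> b0; rewrite /dirichlet big_seq1 div0n b0 mulr0. Qed.

Lemma dirichlet1r (a : nat -> int) : a 0%N = 0 -> dirichlet a (fun n => (n == 1%N)%:Z) = a.
Proof.
move=> a0; apply/funext => -[|n]; first by rewrite dirichlet0// a0.
rewrite /dirichlet (bigD1_seq n.+1) ?divisors_uniq -?dvdn_divisors//= divnn /= mulr1.
rewrite big_seq_cond big1 ?addr0// => e /andP[]; rewrite -dvdn_divisors// => /dvdnP[k ek] en.
have e0 : (0 < e)%N by case: e ek {en} => //; rewrite muln0.
rewrite ek mulnK//; case: eqP => [k1|]; last by rewrite mulr0.
by move: en; rewrite ek k1 mul1n eqxx.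
Qed.

Lemma mobius_powS d : mobius_pow d.+1 = dirichlet mobius (mobius_pow d).
Proof. by case: d => [|d] //; rewrite dirichlet1r. Qed.

Lemma mobius_pow0 d : mobius_pow d 0%N = 0.
Proof. by elim: d => [//|d IH]; rewrite mobius_powS dirichlet0. Qed.

Lemma dirichlet_sum (R : comNzRingType) (a b : nat -> int) (g : nat -> R) n :
  a 0%N = 0 -> b 0%N = 0 -> (forall k, (n < k)%N -> g k = 0) ->
  \sum_(0 <= k < n.+1) (dirichlet a b k)%:~R * g k =
  \sum_(0 <= e < n.+1) (a e)%:~R * \sum_(0 <= k < n.+1) (b k)%:~R * g (e * k)%N.
Proof.
move=> a0 b0 gn.
pose t e k m := (m == e * k)%N%:R * (a e)%:~R * (b k)%:~R * g m.
transitivity (\sum_(0 <= m < n.+1) \sum_(0 <= e < n.+1) \sum_(0 <= k < n.+1) t e k m).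
  rewrite !big_nat; apply: eq_bigr => m; case: m => [|m] /= mn.
    rewrite dirichlet0// mul0r big1// => e _; rewrite big1// => k _.
    rewrite /t; case: eqP => [/esym/eqP|_]; last by rewrite !mul0r.
    by rewrite muln_eq0 => /orP[]/eqP ->; rewrite ?a0 ?b0 ?mulr0 ?mul0r ?mulr0 ?mul0r.
  rewrite /dirichlet rmorph_sum mulr_suml /=.
  rewrite (_ : \sum_(0 <= e < n.+1) _ =
      \sum_(e <- divisors m.+1) \sum_(0 <= k < n.+1) t e k m.+1); last first.
    rewrite (bigID (fun e => e %| m.+1)%N) /= [X in _ + X]big1 ?addr0; last first.
      move=> e em; rewrite big1// => k _; rewrite /t; case: eqP => [h|_]; last by rewrite !mul0r.
      by move: em; rewrite h dvdn_mulr.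
    rewrite -big_filter; apply: perm_big; apply: uniq_perm.
    - by rewrite filter_uniq// iota_uniq.
    - exact: divisors_uniq.
    move=> e; rewrite mem_filter mem_index_iota -dvdn_divisors//=; case: (boolP (e %| m.+1)%N) => //= em.
    by rewrite (leq_ltn_trans (dvdn_leq _ em)).
  rewrite big_seq [RHS]big_seq; apply: eq_bigr => e; rewrite -dvdn_divisors// => /dvdnP[k mE].
  have e0 : (0 < e)%N by case: e mE => //; rewrite muln0.
  have kn : (k < n.+1)%N.
    by apply: leq_ltn_trans mn; rewrite mE leq_pmulr.
  rewrite (bigD1_seq k) ?mem_index_iota ?iota_uniq//= big1 ?addr0; last first.
    move=> k' k'k; rewrite /t mE mulnC eqn_pmul2l// eq_sym (negbTE k'k) !mul0r//.
  by rewrite /t mE mulnK// [(e * k)%N]mulnC eqxx mul1r rmorphM.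
rewrite exchange_big /=; apply: eq_bigr => e _; rewrite exchange_big /= mulr_sumr.
apply: eq_bigr => k _; have [ek|ek] := leqP (e * k) n.
  rewrite (bigD1_seq (e * k)%N) ?mem_index_iota ?iota_uniq//= big1 ?addr0.
    by rewrite /t eqxx mul1r mulrA.
  by move=> m mE; rewrite /t (negbTE mE) !mul0r.
rewrite gn// !mulr0 big_nat big1// => m /= mn; rewrite /t; case: eqP => [h|_]; last by rewrite !mul0r.
by move: mn; rewrite h ltnNge ek.
Qed.
End Mobius.

(** * Moebius inversion over the grids *)

Section FunctionalEquation.
Variables (R : realType) (d : nat).
Local Notation code := (code d).
Local Notation F := (@dec_series R d).
Implicit Types (S : {fset code}) (q : 'I_d -> nat).

Definition axis_gcd (i : 'I_d) S : nat := \big[gcdn/0%N]_(c <- S) (c i).1.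

Lemma axis_gcdP i S e : reflect (all_dvd i e S) (e %| axis_gcd i S)%N.
Proof.
apply: (iffP idP); rewrite /all_dvd /axis_gcd.
  by move=> h c cS; apply: dvdn_trans h _; rewrite (bigD1_seq c cS (fset_uniq S)); exact: dvdn_gcdl.
move=> h; rewrite big_seq; elim/big_rec: _ => [|c x cS ex]; first exact: dvdn0.
by rewrite dvdn_gcd h.
Qed.

Lemma dec_series0 : F 0%N = 0.
Proof.
rewrite /dec_series /grid_series /grid_count (@eq_in_count _ _ pred0) ?count_pred0// => S.
move=> /decsP[hS _]; have := tdec_card_gt0 hS; by case: (#|` S|)%fset.
Qed.

Lemma axis_gcd_bounds i S : tdec S -> (0 < axis_gcd i S <= #|` S|)%N.
Proof.
move=> hS; set e := axis_gcd i S.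
have [c cS] := tdec_neq0 hS.
have e0 : (0 < e)%N.
  have : (e %| (c i).1)%N by apply: (axis_gcdP i S e (dvdnn e)).
  by move/dvdn_gt0; apply; apply: leq_ltn_trans (tdec_valid hS cS i).
rewrite e0 leqNgt; apply/negP => en.
pose q := upd (fun=> 1%N) i e.
have q0 k : (0 < q k)%N by rewrite /q /upd; case: ifP.
have := congr1 (fun f => f #|` S|%fset) (grid_seriesE R q0).
rewrite (_ : (\prod_i _)%N = e); last first.
  by rewrite (bigD1 i)//= /q /upd eqxx big1 ?muln1// => k /negbTE ->.
rewrite fps_expr_val//; last exact: dec_series0.
rewrite /grid_series => /eqP; rewrite pnatr_eq0 -leqn0 leqNgt -has_count => /negP; apply.
apply/hasP; exists S; first exact/decsP.
rewrite eqxx /=; apply/asboolP => k; rewrite /q /upd; case: eqP => [->|_].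
  exact/axis_gcdP.
by move=> ? _; exact: dvd1n.
Qed.

Lemma mobius_axis_sum i S : tdec S ->
  \sum_(0 <= e < #|` S|.+1) (mobius e)%:~R * (e %| axis_gcd i S)%N%:R =
  (axis_gcd i S == 1%N)%:R :> R.
Proof.
move=> hS; have /andP[g0 gn] := axis_gcd_bounds i hS; set g := axis_gcd i S in g0 gn *.
have := congr1 (fun z : int => z%:~R : R) (mobius_sum g0).
rewrite /= rmorph_sum /= => h.
transitivity (((g == 1%N)%:R : int)%:~R : R); last by case: eqP.
rewrite -h (bigID (fun e => e %| g)%N) /= [X in _ + X]big1 ?addr0; last first.
  by move=> e /negbTE ->; rewrite mulr0.
rewrite (eq_bigr (fun e => (mobius e)%:~R)); last by move=> e ->; rewrite mulr1.
rewrite -big_filter; apply: perm_big; apply: uniq_perm.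
- by rewrite filter_uniq// iota_uniq.
- exact: divisors_uniq.
move=> e; rewrite mem_filter mem_index_iota -dvdn_divisors//=; case: (boolP (e %| g)%N) => //= eg.
by rewrite ltnS (leq_trans (dvdn_leq _ eg)).
Qed.

(** The axes are sieved one at a time. Those of l, where q_i = 1, are forced to have gcd 1; the
    outer variable e of the convolution becomes the grid size on the first of them, and the others
    are treated by induction for this enlarged grid. *)
Lemma mobius_grid_sum n (l : seq 'I_d) q : uniq l -> (forall i, 0 < q i)%N ->
  {in l, forall i, q i = 1%N} ->
  \sum_(0 <= k < n.+1) (mobius_pow (size l) k)%:~R * (F ^+ (k * \prod_i q i)) n =
  \sum_(S <- decs d n | #|` S|%fset == n)
     (`[< grid q S >] && all (fun i => axis_gcd i S == 1%N) l)%:R.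
Proof.
elim: l q => [|i l IH] q.
  move=> /= _ q0 _; case: n => [|n].
    rewrite big_nat1 /= mul0r big_seq_cond big1// => S /andP[/decsP[hS _]].
    by have := tdec_card_gt0 hS; case: (#|` S|)%fset.
  rewrite (bigD1_seq 1%N) ?mem_index_iota ?iota_uniq//= [X in _ + X]big1 ?addr0; last first.
    by move=> k k1; rewrite /mobius_pow /= (negbTE k1) mul0r.
  rewrite mul1r mul1n -grid_seriesE// /grid_series /grid_count -sum1_count natr_sum.
  rewrite big_mkcondr /=; apply: eq_bigr => S _; rewrite andbT; by case: ifP.
rewrite cons_uniq -[size (i :: l)]/(size l).+1 => /andP[il ul] q0 q1.
have qi : q i = 1%N by apply: q1; rewrite mem_head.
rewrite mobius_powS dirichlet_sum//; last 2 first.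
- exact: mobius_pow0.
- move=> k kn; apply: fps_expr_val; first exact: dec_series0.
  by apply: leq_trans kn _; rewrite leq_pmulr// prodn_gt0.
transitivity (\sum_(0 <= e < n.+1) \sum_(S <- decs d n | #|` S|%fset == n)
   (mobius e)%:~R * ((e %| axis_gcd i S)%N%:R *
    (`[< grid q S >] && all (fun i => axis_gcd i S == 1%N) l)%:R) : R).
  apply: eq_bigr => e _; rewrite -mulr_sumr; case: e => [|e]; first by rewrite !mul0r.
  congr (_ * _).
  transitivity (\sum_(0 <= k < n.+1) (mobius_pow (size l) k)%:~R *
      (F ^+ (k * \prod_j upd q i e.+1 j)) n).
    apply: eq_bigr => k _.
    rewrite (_ : (e.+1 * k * \prod_j q j = k * \prod_j upd q i e.+1 j)%N)//.
    rewrite [in RHS](bigD1 i)//= [in LHS](bigD1 i)//= qi /upd eqxx mul1n.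
    rewrite mulnA [(k * e.+1)%N]mulnC; congr (_ * _)%N.
    by apply: eq_bigr => j /negbTE ->.
  rewrite IH//; last 2 first.
  - by move=> j; rewrite /upd; case: ifP.
  - move=> j jl; rewrite /upd; case: eqP => [ji|_]; first by move: il; rewrite -ji jl.
    by apply: q1; rewrite inE jl orbT.
  apply: eq_bigr => S _; rewrite -natrM mulnb andbA; congr (_ && _)%:R.
  apply/asboolP/andP => [h|[/axis_gcdP h /asboolP hq]].
    split; first by apply/axis_gcdP; have := h i; rewrite /upd eqxx.
    apply/asboolP => j; have := h j; rewrite /upd; case: eqP => // -> _.
    by rewrite qi => c _; exact: dvd1n.
  by move=> j; rewrite /upd; case: eqP => [->|].
rewrite exchange_big /= big_seq_cond [RHS]big_seq_cond; apply: eq_bigr => S.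
move=> /andP[/decsP[hS _] /eqP Sn].
under eq_bigr do rewrite mulrA.
rewrite -mulr_suml -{1}Sn mobius_axis_sum// -natrM mulnb.
by rewrite andbCA.
Qed.

Lemma axis_gcd_eq1 S : tdec S -> (forall i, axis_gcd i S = 1%N) -> S = [fset code1 d]%fset.
Proof.
case=> // i p f p1 hf h; exfalso.
have : (p %| axis_gcd i (node i p f))%N.
  apply/axis_gcdP => c /nodeP[j [jp [c' [hc' ->]]]].
  by rewrite !ffunE eqxx /= dvdn_mulr.
by rewrite h dvdn1 => /eqP pE; rewrite pE in p1.
Qed.

Lemma mobius_comp_dec_series : fps_comp (@mobius_coef R d : fps R) F = fpsX R.
Proof.
apply/funext => n.
have := @mobius_grid_sum n (enum 'I_d) (fun=> 1%N) (enum_uniq _) (fun=> isT) (fun _ _ => erefl).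
rewrite size_enum_ord big_mkord.
rewrite (eq_bigr (fun k : 'I_n.+1 => (mobius_pow d k)%:~R * (F ^+ k) n)); last first.
  by move=> k _; rewrite big1// muln1.
rewrite /fps_comp /mobius_coef => ->.
transitivity (\sum_(S <- decs d n | (#|` S|%fset == n)) (S == [fset code1 d]%fset)%:R : R).
  rewrite big_seq_cond [RHS]big_seq_cond; apply: eq_bigr => S /andP[/decsP[hS _] _].
  congr (_%:R); apply: congr1; apply/andP/eqP => [[_ /allP h]|->].
    by apply: axis_gcd_eq1 => // i; apply/eqP/h; rewrite mem_enum.
  split; first by apply/asboolP => i c _; exact: dvd1n.
  by apply/allP => i _; rewrite /axis_gcd big_seq_fset1 ffunE.
rewrite /fpsX; case: eqP => [->|n1].
  rewrite big_mkcond (bigD1_seq [fset code1 d]%fset) ?fset_uniq//=; last first.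
    by apply/decsP; split; [exact: tdec_leaf|rewrite cardfs1].
  rewrite cardfs1 !eqxx big1 ?addr0// => S /negbTE ->; by case: ifP.
rewrite big1// => S /eqP Sn; case: eqP => // e; exfalso; apply: n1.
by rewrite -Sn e cardfs1.
Qed.
End FunctionalEquation.

(** * Geometric decompositions *)

Section Refinement.
Local Open Scope fset_scope.
Variable d : nat.
Local Notation code := (code d).
Local Notation code1 := (code1 d).
Implicit Types (S T : {fset code}) (c b : code).

Definition code_map c T : {fset code} := [fset code_comp c x | x in T].
Definition slabs i p : {fset code} := node i p (fun=> [fset code1]).
Definition refine S c i p : {fset code} := (S `\ c) `|` code_map c (slabs i p).

Lemma code_mapP c T x : reflect (exists2 y, y \in T & x = code_comp c y) (x \in code_map c T).
Proof. exact: imfsetP. Qed.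

Lemma code_map1 T : code_map code1 T = T.
Proof.
apply/fsetP => x; apply/code_mapP/idP => [[y hy ->]|hx]; first by rewrite code_comp1.
by exists x; rewrite ?code_comp1.
Qed.

Lemma code_comp_inj c x y : valid c -> code_comp c x = code_comp c y -> x = y.
Proof.
move=> vc /ffunP e; apply/ffunP => i; have := e i; rewrite !ffunE => -[/eqP].
rewrite eqn_pmul2l ?(leq_ltn_trans _ (vc i))// => /eqP eN; rewrite eN => /addnI.
by case: (x i) (y i) eN => ? ? [? ?] /= -> ->.
Qed.

(** Descend to the child that contains c; injectivity of composition ensures that no other child
    changes. *)
Lemma tdec_refine S c i p : tdec S -> c \in S -> (1 < p)%N -> tdec (refine S c i p).
Proof.
move=> hS; elim: hS c => [c|k r f r1 hf IH c].
  rewrite inE => /eqP -> p1; rewrite /refine fsetDv fset0U code_map1.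
  by apply: tdec_node => // j; exact: tdec_leaf.
have r0 := ltnW r1.
move=> /nodeP[j [jr [c' [hc' ->]]]] p1.
pose f' m := if m == j then refine (f j) c' i p else f m.
have hf' m : tdec (f' m) by rewrite /f'; case: eqP => // _; apply: IH.
suff -> : refine (node k r f) (code_comp (cell k r j) c') i p = node k r f' by apply: tdec_node.
have vc' := tdec_valid (hf j) hc'.
apply/fsetP => x; rewrite !inE; apply/orP/nodeP.
  move=> [/andP[xc /nodeP[m [mr [y [hy xE]]]]]|/code_mapP[y hy ->]].
    exists m; split=> //; exists y; split=> //; rewrite /f'; case: eqP => [mj|//].
    rewrite !inE; apply/orP; left; rewrite -mj hy andbT; apply: contra xc => /eqP yc.
    by rewrite xE mj yc.
  exists j; split=> //; exists (code_comp c' y); rewrite code_compA; split=> //.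
  by rewrite /f' eqxx !inE; apply/orP; right; apply/code_mapP; exists y.
move=> [m [mr [y [hy ->]]]]; move: hy; rewrite /f'; case: eqP => [->|mj hy]; last first.
  left; apply/andP; split; last by apply/nodeP; exists m; split=> //; exists y.
  apply/eqP => e; have [] := cell_comp_inj r0 (tdec_valid (hf m) hy) vc' e.
  by move=> /mj.
rewrite !inE => /orP[/andP[yc hy]|/code_mapP[z hz ->]].
  left; apply/andP; split; last by apply/nodeP; exists j; split=> //; exists y.
  apply: contra yc => /eqP e.
  by have [_ ->] := cell_comp_inj r0 (tdec_valid (hf j) hy) vc' e.
by right; apply/code_mapP; exists z; rewrite ?code_compA.
Qed.

(** The order of cuts of [decomposition], transported to codes: an intermediate form through which a
    tree becomes a sequence of refinements of single regions. *)
Inductive bdec : {fset code} -> Prop :=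
| bdec_leaf : bdec [fset code1]
| bdec_refine S c i p : bdec S -> c \in S -> (1 < p)%N -> bdec (refine S c i p).

Lemma bdec_tdec S : bdec S -> tdec S.
Proof. by elim=> [|{}S c i p _ hS cS p1]; [exact: tdec_leaf|exact: tdec_refine]. Qed.

(** A whole tree is grafted at c, child after child. The last hypothesis says that S has no other
    region inside c, so that grafted regions cannot collide with old ones. *)
Lemma bdec_graft T S c : tdec T -> bdec S -> c \in S ->
  (forall b, valid b -> code_comp c b \in S -> code_comp c b = c) ->
  bdec ((S `\ c) `|` code_map c T).
Proof.
move=> hT; elim: hT S c => [|i p f p1 hf IH] S c hS cS ext.
  rewrite (_ : code_map c _ = [fset c]); first by rewrite fsetUC fsetD1K.
  apply/fsetP => x; rewrite inE; apply/code_mapP/eqP => [[y]|->].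
    by rewrite inE => /eqP -> ->; rewrite code_comp1r.
  by exists code1; rewrite ?inE ?code_comp1r.
have p0 := ltnW p1.
have vc : valid c by apply: tdec_valid (bdec_tdec hS) cS.
(* After m steps the first m children are complete and the others are still bare slabs. *)
pose g m j := if (j < m)%N then f j else [fset code1].
have hg m j : tdec (g m j) by rewrite /g; case: ifP => // _; exact: tdec_leaf.
pose A m := (S `\ c) `|` code_map c (node i p (g m)).
suff hA m : (m <= p)%N -> bdec (A m).
  have := hA p (leqnn p); rewrite /A (@node_ext _ _ _ (g p) f)// => j jp.
  by rewrite /g jp.
elim: m => [_|m IHm mp]; first exact: bdec_refine.
pose cm := code_comp c (cell i p m).
have vm : valid (cell i p m) by apply: valid_cell.
have cmA : cm \in A m.
  rewrite !inE; apply/orP; right; apply/code_mapP; exists (cell i p m) => //.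
  apply/nodeP; exists m; split=> //; exists code1; rewrite code_comp1r /g ltnn.
  by rewrite inE.
have extm b : valid b -> code_comp cm b \in A m -> code_comp cm b = cm.
  move=> vb; rewrite /cm -code_compA !inE => /orP[/andP[n1 h]|/code_mapP[y hy e]].
    by move: n1; rewrite (ext _ _ h) ?eqxx//; exact: valid_comp.
  have {}e := code_comp_inj vc e; rewrite e; congr code_comp.
  move: hy; rewrite -e => /nodeP[j [jp [z [hz e2]]]].
  have [mj bz] := cell_comp_inj p0 vb (tdec_valid (hg m j) hz) e2.
  move: hz; rewrite /g -mj ltnn inE => /eqP z1.
  by rewrite e2 z1 code_comp1r mj.
have := IH m (A m) cm (IHm (ltnW mp)) cmA extm.
congr bdec; apply/fsetP => x; rewrite !inE; apply/orP/orP.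
  move=> [/andP[xcm /orP[h|]]|]; first by left.
    move=> /code_mapP[y /nodeP[j [jp [z [hz ->]]]] xE]; right.
    apply/code_mapP; exists (code_comp (cell i p j) z) => //.
    apply/nodeP; exists j; split=> //; exists z; split=> //.
    move: hz; rewrite /g ltnS [(j <= m)%N]leq_eqVlt; case: eqP => [jm|_]; last by [].
    rewrite jm ltnn inE => /eqP z1; exfalso; move: xcm.
    by rewrite xE z1 jm code_comp1r eqxx.
  move=> /code_mapP[y hy ->]; right; apply/code_mapP.
  exists (code_comp (cell i p m) y); last by rewrite code_compA.
  by apply/nodeP; exists m; split=> //; exists y; split=> //; rewrite /g ltnSn.
move=> [/andP[xc xS]|/code_mapP[y /nodeP[j [jp [z [hz ->]]]] xE]].
  left; apply/andP; split; last by apply/orP; left; rewrite xc xS.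
  apply/eqP => xE.
  have := ext (cell i p m) vm; rewrite -/cm -xE => /(_ xS) e.
  by rewrite e eqxx in xc.
have [jm|jm] := eqVneq j m.
  right; apply/code_mapP; exists z; last by rewrite xE /cm jm code_compA.
  by move: hz; rewrite /g jm ltnSn.
left; apply/andP; split.
  apply/eqP; rewrite xE /cm -[cell i p m]code_comp1r => /(code_comp_inj vc) e.
  have [jE _] := cell_comp_inj p0 (tdec_valid (hg m.+1 j) hz) (@valid1 d) e.
  by rewrite jE eqxx in jm.
apply/orP; right; apply/code_mapP; exists (code_comp (cell i p j) z) => //.
apply/nodeP; exists j; split=> //; exists z; split=> //.
by move: hz; rewrite /g ltnS [(j <= m)%N]leq_eqVlt (negbTE jm).
Qed.

Lemma tdec_bdec T : tdec T -> bdec T.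
Proof.
move=> hT; have := @bdec_graft T [fset code1] code1 hT bdec_leaf.
rewrite fsetDv fset0U code_map1; apply; first by rewrite inE.
by move=> b _; rewrite inE => /eqP.
Qed.
End Refinement.

(** * From codes to boxes *)

Section Geometry.
Variables (R : realType) (d : nat).
Local Notation code := (code d).
Implicit Types (c : code) (a b x : 'rV[R]_d) (S : {fset code}).

(** Let one coordinate range over its interval while the others stay at midpoints; a point close
    enough to a violating endpoint would leave the larger box. *)
Lemma box_subset a b a' b' : (forall k, a 0 k < b 0 k) -> box a b `<=` box a' b' ->
  forall i, a' 0 i <= a 0 i /\ b 0 i <= b' 0 i.
Proof.
move=> ab sub i.
have key t : a 0 i < t < b 0 i -> a' 0 i < t < b' 0 i.
  move=> ht; pose x : 'rV[R]_d := \row_k (if k == i then t else (a 0 k + b 0 k) / 2).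
  have : box a b x.
    move=> k; rewrite mxE; case: eqP => [->//|_]; have := ab k; lra.
  by move=> /sub /(_ i); rewrite mxE eqxx.
have abi := ab i; split; rewrite leNgt; apply/negP => h.
  have := key ((a 0 i + Num.min (a' 0 i) (b 0 i)) / 2).
  by case: (leP (a' 0 i) (b 0 i)) => h2; lra.
have := key ((b 0 i + Num.max (b' 0 i) (a 0 i)) / 2).
by case: (leP (b' 0 i) (a 0 i)) => h2; lra.
Qed.

(** The endpoints in [decomposition_split] are known only through the set [box a b]; this identifies
    them with those of a code, so that the cut points are the expected ones. *)
Lemma box_inj a b a' b' : (forall k, a 0 k < b 0 k) -> (forall k, a' 0 k < b' 0 k) ->
  box a b = box a' b' -> a = a' /\ b = b'.
Proof.
move=> h h' e.
have h1 : box a b `<=` box a' b' by rewrite e.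
have h2 : box a' b' `<=` box a b by rewrite e.
split; apply/rowP => i; have [l1 r1] := box_subset h h1 i;
  have [l2 r2] := box_subset h' h2 i; apply/eqP; rewrite eq_le ?l1 ?l2 ?r1 ?r2//.
Qed.

Definition code_lo c : 'rV[R]_d := \row_i ((c i).2%:R / (c i).1%:R).
Definition code_hi c : 'rV[R]_d := \row_i ((c i).2.+1%:R / (c i).1%:R).
Definition code_box c : set 'rV[R]_d := box (code_lo c) (code_hi c).
Definition code_boxes S : set (set 'rV[R]_d) := [set code_box c | c in [set` S]].

Let valid_gt0 c i : valid c -> 0 < (c i).1%:R :> R.
Proof. by move=> vc; rewrite ltr0n; apply: leq_ltn_trans (vc i). Qed.

Lemma code_lohi c : valid c -> forall k, code_lo c 0 k < code_hi c 0 k.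
Proof.
by move=> vc k; rewrite !mxE ltr_pM2r ?invr_gt0 ?valid_gt0// ltr_nat.
Qed.

Lemma code_box_inj c c' : valid c -> valid c' -> code_box c = code_box c' -> c = c'.
Proof.
move=> vc vc' /(box_inj (code_lohi vc) (code_lohi vc')) [/rowP lo /rowP hi].
apply/ffunP => i; have := lo i; have := hi i; rewrite !mxE.
have := valid_gt0 i vc; have := valid_gt0 i vc'.
case: (c i) (c' i) => [N j] [N' j'] /= N'0 N0.
rewrite -!natr1 !mulrDl !mul1r => h1 h2.
have /invr_inj/eqP : N%:R^-1 = N'%:R^-1 :> R.
  by apply: (addrI (j%:R / N%:R)); rewrite h1 h2.
rewrite eqr_nat => /eqP NE; move: h2; rewrite NE.
move=> /(mulIf (invr_neq0 (lt0r_neq0 N'0))) /eqP; rewrite eqr_nat => /eqP ->//.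
Qed.

Lemma unit_cubeE : @unit_cube R d = code_box (code1 d).
Proof.
rewrite /unit_cube /code_box; congr box; apply/rowP => i;
  by rewrite !mxE ffunE /= ?mul0r ?divr1.
Qed.

Lemma split_boxE c i p : valid c -> (1 < p)%N ->
  split_box i p (code_lo c) (code_hi c) = code_boxes (code_map c (slabs i p)).
Proof.
move=> vc p1; have p0 : 0 < p%:R :> R by rewrite ltr0n ltnW.
have cut j : cut_point (code_lo c) (code_hi c) i p j =
    ((c i).2 * p + j)%N%:R / ((c i).1 * p)%N%:R.
  rewrite /cut_point !mxE; have := valid_gt0 i vc; case: (c i) => [N k] /= N0.
  rewrite natrD !natrM -natr1; move: (N%:R) N0 (p%:R) p0 => x x0 y y0.
  by field; rewrite !gt_eqF.
have hi_lo k : code_lo c 0 k < code_hi c 0 k by apply: code_lohi.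
have boxE j : (j < p)%N ->
    [set x | box (code_lo c) (code_hi c) x /\
      cut_point (code_lo c) (code_hi c) i p j < x 0 i <
      cut_point (code_lo c) (code_hi c) i p j.+1] = code_box (code_comp c (cell i p j)).
  move=> jp; have N0 := valid_gt0 i vc.
  (* The cut points of index 0 and p are the endpoints, so along axis i a slab stays within the
     box. *)
  have c0 : cut_point (code_lo c) (code_hi c) i p 0 <= cut_point (code_lo c) (code_hi c) i p j.
    by rewrite !cut ler_wpM2r ?invr_ge0// ler_nat leq_add2l.
  have cp : cut_point (code_lo c) (code_hi c) i p j.+1 <= cut_point (code_lo c) (code_hi c) i p p.
    by rewrite !cut ler_wpM2r ?invr_ge0// ler_nat leq_add2l.
  rewrite {1}/cut_point !mul0r addr0 in c0.
  rewrite {2}/cut_point divff ?gt_eqF// mul1r addrC subrK in cp.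
  apply/seteqP; split=> x /=.
    move=> [xb xi] k; rewrite !mxE !ffunE; have := xb k; rewrite !mxE.
    case: eqP => [->|_] /=; last by rewrite !muln1 addn0.
    by move=> _; move: xi; rewrite !cut addnS.
  move=> hx.
  have xi : cut_point (code_lo c) (code_hi c) i p j < x 0 i <
      cut_point (code_lo c) (code_hi c) i p j.+1.
    by have := hx i; rewrite !mxE !ffunE eqxx /= !cut addnS.
  split=> // k; have [->|ki] := eqVneq k i.
    by move: xi c0 cp; lra.
  by have := hx k; rewrite !mxE !ffunE (negbTE ki) /= !muln1 addn0.
apply/seteqP; split=> X.
  move=> [[//|j] /= jp <-]; exists (code_comp c (cell i p j)).
    apply/code_mapP; exists (cell i p j) => //; apply/nodeP; exists j; split=> //.
    by exists (code1 d); rewrite code_comp1r inE.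
  by rewrite boxE.
move=> [_ /code_mapP[y /nodeP[j [jp [z [/fset1P -> ->]]]] ->] <-].
by exists j.+1 => //=; rewrite boxE// code_comp1r.
Qed.

Lemma code_boxes_refine S c i p : (forall c, c \in S -> valid c) -> c \in S -> (1 < p)%N ->
  code_boxes (refine S c i p) =
  (code_boxes S `\` [set code_box c]) `|` split_box i p (code_lo c) (code_hi c).
Proof.
move=> vS cS p1; have vc := vS c cS; rewrite split_boxE//.
apply/seteqP; split=> X.
  move=> [b /=]; rewrite !inE => /orP[/andP[bc bS]|hb] <-; last by right; exists b.
  left; split; first by exists b.
  by move=> /= /(code_box_inj (vS _ bS) vc) e; rewrite e eqxx in bc.
move=> [[[b /= bS <-] bc]|[b /= hb <-]]; exists b => //=; rewrite !inE.
  by rewrite bS andbT; apply/orP; left; apply/eqP => e; apply: bc; rewrite e.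
by rewrite hb orbT.
Qed.

Lemma tdec_decomposition S : tdec S -> decomposition (code_boxes S).
Proof.
move=> /tdec_bdec; elim=> [|{}S c i p hb hS cS p1].
  rewrite (_ : code_boxes _ = [set @unit_cube R d]); first exact: decomposition_cube.
  rewrite unit_cubeE; apply/seteqP; split=> X.
    by move=> [c /= /fset1P -> <-].
  by move=> ->; exists (code1 d) => //=; rewrite inE.
have vS c1 : c1 \in S -> valid c1 by move=> bS; apply: tdec_valid (bdec_tdec hb) bS.
rewrite code_boxes_refine//; apply: decomposition_split => //.
  by apply/code_lohi/vS.
by exists c.
Qed.

Lemma decomposition_tdec (D : set (set 'rV[R]_d)) : decomposition D ->
  exists2 S, tdec S & D = code_boxes S.
Proof.
elim=> [|E a b i p _ [S hS ->] ab].
  exists [fset code1 d]%fset; first exact: tdec_leaf.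
  rewrite unit_cubeE; apply/seteqP; split=> X.
    by move=> ->; exists (code1 d) => //=; rewrite inE.
  by move=> [c /= /fset1P -> <-].
have vS c : c \in S -> valid c by apply: tdec_valid hS.
move=> [c /= cS e] p1.
have [-> ->] := box_inj ab (code_lohi (vS _ cS)) (esym e).
exists (refine S c i p); first exact: tdec_refine.
by rewrite code_boxes_refine.
Qed.

Lemma code_boxes_inj S T : tdec S -> tdec T -> code_boxes S = code_boxes T -> S = T.
Proof.
have H (A B : {fset code}) : tdec A -> tdec B -> code_boxes A = code_boxes B -> {subset A <= B}.
  move=> hA hB e c cA; have : code_boxes A (code_box c) by exists c.
  rewrite e => -[b /= bB /code_box_inj <-//]; first exact: tdec_valid hB bB.
  exact: tdec_valid hA cA.
move=> hS hT e; apply/fsetP => c; apply/idP/idP; first exact: H.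
by apply: H.
Qed.

Lemma code_boxes_card S n : tdec S -> (code_boxes S #= `I_n)%card <-> #|` S|%fset = n.
Proof.
move=> hS; pose f := code_box.
have inj : {in [set` S] &, injective code_box}.
  by move=> b c; rewrite !inE => bS cS /code_box_inj; apply; [exact: tdec_valid hS bS|exact: tdec_valid hS cS].
have e := inj_card_eq inj; split=> h.
  by apply/card_eq_fsetP; rewrite -(card_eql e).
by rewrite (card_eql e); apply/card_eq_fsetP.
Qed.

Lemma num_decompositionsE n : dec_series R d n = (num_decompositions R d n)%:R.
Proof.
rewrite /dec_series /grid_series; congr _%:R.
pose A := [set S : {fset code} | tdec S /\ #|` S|%fset = n].
have fA : finite_set A.
  by apply: sub_finite_set (finite_tdec d n) => S [hS Sn]; split; rewrite ?Sn.
have -> : num_decompositions R d n = #|` fset_set A|%fset.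
  rewrite /num_decompositions (_ : @decompositions_of_size R d n = code_boxes @` A).
    rewrite fset_set_image// card_in_imfset// => S T.
    by rewrite !in_fset_set// !inE => -[hS _] [hT _]; apply: code_boxes_inj.
  apply/seteqP; split=> D.
    by move=> [/decomposition_tdec[S hS ->] /(code_boxes_card _ hS) Sn]; exists S.
  by move=> [S [hS Sn] <-]; split; [exact: tdec_decomposition|exact/(code_boxes_card _ hS)].
rewrite /grid_count -size_filter; apply: perm_size; apply: uniq_perm.
- by rewrite filter_uniq// fset_uniq.
- exact: fset_uniq.
move=> S; rewrite mem_filter [in RHS]in_fset_set//; apply/andP/idP.
  by move=> [/andP[/eqP Sn _] /decsP[hS _]]; rewrite inE.
rewrite inE => -[hS Sn]; split; last by apply/decsP; rewrite Sn.
by rewrite Sn eqxx /=; apply/asboolP => i c _; exact: dvd1n.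
Qed.
End Geometry.

(** * The Moebius series *)

Section MobiusBounds.
Local Open Scope nat_scope.

(** The number of prime factors counted with multiplicity; d to this power bounds
    |[mobius_pow d n]|. *)
Definition bigomega n := \sum_(p <- primes n) logn p n.

Lemma bigomegaE n N : 0 < n -> n < N -> bigomega n = \sum_(0 <= p < N) logn p n.
Proof.
move=> n0 nN; rewrite [RHS](bigID (fun p => p \in primes n)) /= [X in _ + X]big1 ?addn0; last first.
  by move=> p; rewrite -logn_gt0 lt0n negbK => /eqP.
rewrite -big_filter; apply: perm_big; apply: uniq_perm.
- exact: primes_uniq.
- by rewrite filter_uniq// iota_uniq.
move=> p; rewrite mem_filter mem_index_iota /=; case: (boolP (p \in primes n)) => //=.
by rewrite mem_primes => /and3P[_ _ /dvdn_leq h]; rewrite (leq_ltn_trans (h n0)).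
Qed.

Lemma bigomega1 : bigomega 1 = 0. Proof. exact: big_nil. Qed.

Lemma bigomegaM p n : prime p -> 0 < n -> bigomega (p * n) = (bigomega n).+1.
Proof.
move=> pp n0; have p0 := prime_gt0 pp; have pn0 : 0 < p * n by rewrite muln_gt0 p0.
rewrite (bigomegaE pn0 (ltnSn _)) (@bigomegaE n (p * n).+1)//; last first.
  by rewrite ltnS leq_pmull.
rewrite (eq_bigr (fun r => (r == p) + logn r n)); last first.
  by move=> r _; rewrite lognM// logn_prime.
rewrite big_split /= (bigD1_seq p) ?iota_uniq ?mem_index_iota//=; last first.
  by rewrite ltnS leq_pmulr.
by rewrite eqxx big1 // => r /negbTE ->.
Qed.

Lemma prime_ind (P : nat -> Prop) : P 1 ->
  (forall p n, prime p -> 0 < n -> P n -> P (p * n)) -> forall n, 0 < n -> P n.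
Proof.
move=> P1 PM n; elim/ltn_ind: n => n IH n0; have [n1|n1] := leqP n 1.
  by have -> : n = 1 by apply/eqP; rewrite eqn_leq n1.
have pp := pdiv_prime n1; have /dvdnP[k nE] := pdiv_dvd n.
have k0 : 0 < k by move: n0; rewrite nE muln_gt0 => /andP[].
rewrite nE mulnC; apply: PM => //; apply: IH => //.
by rewrite [X in _ < X]nE ltn_Pmulr// prime_gt1.
Qed.

Lemma bigomega_exp2 n : 0 < n -> 2 ^ bigomega n <= n.
Proof.
elim/prime_ind => [|p {}n pp n0 IH]; first by rewrite bigomega1.
by rewrite bigomegaM// expnS leq_mul// prime_gt1.
Qed.

(** From 8 on, 2^Omega(n) <= n <= 2^(n - 4); the values 5, 6 and 7 are checked by hand. At n = 4 the
    bound fails, which is why four coefficients are computed explicitly. *)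
Lemma bigomega_le n : 5 <= n -> bigomega n <= n - 4.
Proof.
move=> n5; have [n8|n8] := ltnP n 8.
  have e : n = 5 * 1 \/ n = 2 * (3 * 1) \/ n = 7 * 1 by lia.
  by case: e => [->|[->|->]]; rewrite !bigomegaM// bigomega1.
rewrite -(leq_exp2l _ _ (ltnSn 1)); apply: leq_trans (bigomega_exp2 _) _.
  exact: leq_trans n5.
rewrite -{1}(subnK n8) -{2}(subnK n8); move: (n - 8) => k {n n5 n8}.
rewrite -addnBA//; elim: k => // k IH.
by rewrite !addSn expnS; move: IH; move: (2 ^ _) => t; lia.
Qed.

(** A divisor of p n either is prime to p, and then divides n, or is p e with e a divisor of n.
    Equality holds for squarefree n. *)
Lemma sum_divisors_bigomega x n : 0 < n ->
  \sum_(e <- divisors n) x ^ bigomega e <= x.+1 ^ bigomega n.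
Proof.
elim/prime_ind => [|p {}n pp n0 IH]; first by rewrite big_seq1 bigomega1.
have p0 := prime_gt0 pp; have pn0 : 0 < p * n by rewrite muln_gt0 p0.
rewrite bigomegaM// expnS mulSn (bigID (fun e => p %| e)) /= addnC; apply: leq_add.
  apply: leq_trans IH; rewrite -big_filter [leqRHS](bigID (fun e => p %| e)) /=.
  apply: leq_trans (leq_addl _ _); rewrite -[leqRHS]big_filter eq_leq//.
  apply: perm_big; apply: uniq_perm; rewrite ?filter_uniq ?divisors_uniq// => e.
  rewrite !mem_filter -!dvdn_divisors//; case: (boolP (p %| e)) => //= pe.
  by rewrite Gauss_dvdr// coprime_sym prime_coprime.
rewrite (_ : \sum_(e <- divisors (p * n) | p %| e) _ =
    \sum_(e <- [seq p * e | e <- divisors n]) x ^ bigomega e); last first.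
  rewrite -big_filter; apply: perm_big; apply: uniq_perm.
  - by rewrite filter_uniq// divisors_uniq.
  - rewrite map_inj_uniq ?divisors_uniq// => y z /eqP; by rewrite eqn_pmul2l// => /eqP.
  move=> e; rewrite mem_filter -dvdn_divisors//; apply/andP/mapP.
    move=> [/dvdnP[k ->]]; rewrite mulnC dvdn_pmul2l// => kn; exists k => //.
    by rewrite -dvdn_divisors.
  by move=> [k]; rewrite -dvdn_divisors// => kn ->; rewrite dvdn_mulr// dvdn_pmul2l.
rewrite big_map; apply: leq_trans (leq_mul (leqnn x) IH); rewrite big_distrr /=.
rewrite big_seq [leqRHS]big_seq; apply: leq_sum => e; rewrite -dvdn_divisors// => en.
by rewrite bigomegaM ?expnS// (dvdn_gt0 n0).
Qed.

Lemma mobius_le1 n : (`|mobius n| <= 1)%R.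
Proof.
rewrite /mobius; case: ifP => _; last by rewrite normr0.
by rewrite normrX normrN1 expr1n.
Qed.

Lemma mobius_pow_le d n : 0 < n -> (`|mobius_pow d n| <= (d ^ bigomega n)%:Z)%R.
Proof.
elim: d n => [|d IH] n n0.
  by rewrite /mobius_pow /=; case: eqP => [->|_]; rewrite ?bigomega1//= normr0.
rewrite mobius_powS /dirichlet; apply: le_trans (ler_norm_sum _ _ _) _.
apply: (@le_trans _ _ (\sum_(e <- divisors n) (d ^ bigomega (n %/ e))%:Z)%R).
  rewrite big_seq [leRHS]big_seq; apply: ler_sum => e; rewrite -dvdn_divisors// => en.
  rewrite normrM -[leRHS]mul1r ler_pM// ?mobius_le1// IH//.
  by rewrite divn_gt0 ?(dvdn_gt0 n0)// dvdn_leq.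
rewrite -(big_morph Posz PoszD erefl).
apply: le_trans (_ : (\sum_(e <- divisors n) d ^ bigomega e)%:Z <= _)%R; last first.
  exact: sum_divisors_bigomega.
rewrite -(big_map (fun e => n %/ e) xpredT (fun e => d ^ bigomega e)) le_eqVlt.
apply/orP; left; apply/eqP; congr Posz; apply: perm_big; apply: uniq_perm.
- rewrite map_inj_in_uniq ?divisors_uniq// => e f; rewrite -!dvdn_divisors// => en fn h.
  have e0 : 0 < n %/ e by rewrite divn_gt0 ?(dvdn_gt0 n0)// dvdn_leq.
  by apply/eqP; rewrite -(eqn_pmul2l e0) (divnK en) h (divnK fn).
- exact: divisors_uniq.
move=> e; apply/mapP/idP => [[f]|].
  by rewrite -!dvdn_divisors// => fn ->; rewrite -{2}(divnK fn) dvdn_mulr.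
rewrite -dvdn_divisors// => en; exists (n %/ e).
  by rewrite -dvdn_divisors// -{2}(divnK en) dvdn_mulr.
by rewrite -{1}(divnK en) mulKn// divn_gt0 ?(dvdn_gt0 n0)// dvdn_leq.
Qed.

Lemma mobius_pow1 d : mobius_pow d 1 = 1%R.
Proof.
by elim: d => // d IH; rewrite mobius_powS /dirichlet big_seq1 divn1 IH.
Qed.
Lemma mobius_pow2 d : mobius_pow d 2 = (- d%:Z)%R.
Proof.
elim: d => // d IH; rewrite mobius_powS /dirichlet (_ : divisors 2 = [:: 1; 2])//.
rewrite !big_cons big_nil divn1 divnn IH mobius_pow1 mobius1 (_ : mobius 2 = -1)%R//; lia.
Qed.
Lemma mobius_pow3 d : mobius_pow d 3 = (- d%:Z)%R.
Proof.
elim: d => // d IH; rewrite mobius_powS /dirichlet (_ : divisors 3 = [:: 1; 3])//.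
rewrite !big_cons big_nil divn1 divnn IH mobius_pow1 mobius1 (_ : mobius 3 = -1)%R//; lia.
Qed.
Lemma mobius_pow4 d : mobius_pow d 4 = 'C(d, 2)%:Z.
Proof.
elim: d => // d IH; rewrite mobius_powS /dirichlet (_ : divisors 4 = [:: 1; 2; 4])//.
rewrite !big_cons big_nil divn1 divnn IH mobius_pow1 mobius1 (_ : mobius 2 = -1)%R//.
rewrite (_ : mobius 4 = 0)%R// (_ : 4 %/ 2 = 2)// mobius_pow2 binS bin1; lia.
Qed.
End MobiusBounds.

Section MobiusSeries.
Variables (R : realType) (d : nat).
Local Notation D := (@fps_deriv R).
Definition mobius_fps : fps R := @mobius_coef R d.
Local Notation g := mobius_fps.

Lemma mobius_fps_le n : (0 < n)%N -> `|g n| <= (d ^ bigomega n)%:R.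
Proof.
move=> n0; rewrite /g /mobius_coef -intr_norm.
by have := mobius_pow_le d n0; rewrite -(ler_int R).
Qed.

(** From d <= 2^d follows d^Omega(n) <= (2^Omega(n))^d <= n^d, and polynomial growth gives
    convergence on the open unit disc. *)
Lemma mobius_fps_poly n : `|g n| <= n.+1%:R ^+ d.
Proof.
case: n => [|n]; first by rewrite /g /mobius_coef mobius_pow0 normr0 exprn_ge0.
apply: le_trans (mobius_fps_le (ltn0Sn n)) _.
rewrite -natrX ler_nat; apply: (@leq_trans ((2 ^ d) ^ bigomega n.+1)).
  by case: (bigomega _) => // k; rewrite leq_exp2r// ltnW// ltn_expl.
rewrite -expnM mulnC expnM; case: d => // d'; rewrite leq_exp2r//.
by apply: leqW; apply: bigomega_exp2.
Qed.

Lemma rapid_mobius s : 0 <= s < 1 -> rapid (fps_scale s g).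
Proof.
move=> s01 k; have [C hC] := rapid_expr s01 (k + d).
have /andP[s0 _] := s01.
exists C => n; apply: le_trans (hC n); rewrite exprD -mulrA ler_wpM2l ?exprn_ge0//.
by rewrite /fps_scale normrM ler_wpM2r// mobius_fps_poly.
Qed.

Lemma rapid_mobius_deriv s : 0 <= s < 1 -> rapid (fps_scale s (D g)).
Proof.
move=> /andP[s0 s1]; have h : 0 < (s + 1) / 2 < 1 by apply/andP; split; lra.
have /andP[h0 h1] := h.
have := rapid_scale_deriv h0 (rapid_mobius (_ : 0 <= (s + 1) / 2 < 1)).
rewrite (ltW h0) h1 => /(_ isT); apply: rapid_le => n.
rewrite /fps_scale !normrM ler_wpM2l// !normrX lerXn2r ?nnegrE//.
by rewrite !ger0_norm ?(ltW h0)//; lra.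
Qed.

Lemma mobius_fsum_derive (s : R) : `|s| < 1 ->
  is_derive s 1 (fun x => fsum (fps_scale x g)) (fsum (fps_scale s (D g))) /\
  is_derive s 1 (fun x => fsum (fps_scale x (D g))) (fsum (fps_scale s (D (D g)))).
Proof.
move=> s1; pose r : R := (`|s| + 1) / 2.
have r0 : 0 < r by rewrite /r; have := normr_ge0 s; lra.
have r1 : r < 1 by rewrite /r; lra.
have sr : `|s| < r by rewrite /r; lra.
have r01 : 0 <= r < 1 by rewrite (ltW r0) r1.
split; apply: (@fsum_scale_derive _ r) => //; first exact: rapid_mobius.
exact: rapid_mobius_deriv.
Qed.
End MobiusSeries.

(** * Existence of the critical point *)

Section CriticalPoint.
Variables (R : realType) (d : nat).
Hypothesis d1 : (1 <= d)%N.
Local Notation D := (@fps_deriv R).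
Local Notation g := (@mobius_fps R d).
Local Notation h s := (fps_scale s (D g)).

Lemma scale_deriv_coef (s : R) k : h s k = k.+1%:R * g k.+1 * s ^+ k.
Proof. by []. Qed.

Lemma mobius_fps1 : g 1%N = 1. Proof. by rewrite /mobius_fps /mobius_coef mobius_pow1. Qed.
Lemma mobius_fps2 : g 2%N = - d%:R.
Proof. by rewrite /mobius_fps /mobius_coef mobius_pow2 rmorphN. Qed.
Lemma mobius_fps3 : g 3%N = - d%:R.
Proof. by rewrite /mobius_fps /mobius_coef mobius_pow3 rmorphN. Qed.
Lemma mobius_fps4 : g 4%N = d%:R * (d%:R - 1) / 2.
Proof.
rewrite /mobius_fps /mobius_coef mobius_pow4 /=.
have e : 2 * 'C(d, 2)%:R = d%:R * (d%:R - 1) :> R.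
  rewrite -natrM mul2n bin2 -(prednK d1) -[X in X - 1]natr1 addrK -natrM /=.
  congr _%:R; have := odd_double_half (d.-1.+1 * d.-1)%N.
  by rewrite oddM /= andNb add0n.
by rewrite -e mulrC mulKf.
Qed.

Lemma psum_h0 s : psum (h s) 0 = 1.
Proof. by rewrite psum0 scale_deriv_coef mobius_fps1 expr0 !mulr1. Qed.
Lemma psum_h1 s : psum (h s) 1 = 1 - 2 * d%:R * s.
Proof. by rewrite psumS psum_h0 scale_deriv_coef mobius_fps2; ring. Qed.
Lemma psum_h2 s : psum (h s) 2 = 1 - 2 * d%:R * s - 3 * d%:R * s ^+ 2.
Proof. by rewrite psumS psum_h1 scale_deriv_coef mobius_fps3; ring. Qed.
Lemma psum_h3 s : psum (h s) 3 =
  1 - 2 * d%:R * s - 3 * d%:R * s ^+ 2 + 2 * d%:R * (d%:R - 1) * s ^+ 3.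
Proof. by rewrite psumS psum_h2 scale_deriv_coef mobius_fps4; field. Qed.

(** The coefficient bound d^(k - 3) and s^k combine to d^(-3) (d s)^k, so the ratio l controls d s
    and not s itself. *)
Lemma scale_deriv_le (s l : R) k : 0 <= s -> d%:R * s <= l -> (4 <= k)%N ->
  `|h s k| <= (d%:R ^+ 3)^-1 * (k.+1%:R * l ^+ k).
Proof.
move=> s0 dsl k4; have d0 : 0 < d%:R :> R by rewrite ltr0n.
rewrite scale_deriv_coef !normrM normr_nat mulrCA -mulrA ler_wpM2l//.
have -> : `|s ^+ k| = s ^+ k by rewrite ger0_norm ?exprn_ge0.
apply: (@le_trans _ _ (d%:R ^+ (k - 3) * s ^+ k)).
  rewrite ler_wpM2r ?exprn_ge0//; apply: le_trans (mobius_fps_le _ _ _) _ => //.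
  rewrite -natrX ler_nat leq_pexp2l//; apply: leq_trans (bigomega_le _) _ => //.
apply: (@le_trans _ _ ((d%:R ^+ 3)^-1 * (d%:R * s) ^+ k)); last first.
  by rewrite ler_wpM2l ?invr_ge0 ?exprn_ge0// lerXn2r ?nnegrE ?mulr_ge0// (le_trans _ dsl)// mulr_ge0.
have e : d%:R ^+ k = d%:R ^+ 3 * d%:R ^+ (k - 3) :> R by rewrite -exprD subnKC// ltnW.
rewrite exprMn e -mulrA mulKf//.
by rewrite expf_neq0// gt_eqF.
Qed.

Lemma scale_deriv_cont (a b : R) : 0 <= a -> b < 1 ->
  {within `[a, b], continuous (fun s => fsum (h s))}.
Proof.
move=> a0 b1; apply: derivable_within_continuous => s; rewrite in_itv /= => /andP[as_ sb].
have s1 : `|s| < 1 by rewrite ger0_norm ?(le_trans a0)// (le_lt_trans sb).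
by have [_ []] := mobius_fsum_derive d s1.
Qed.

Lemma scale_deriv_root (a b : R) : 0 <= a -> a <= b -> b < 1 ->
  0 <= fsum (h a) -> fsum (h b) <= 0 -> exists2 s, a <= s <= b & fsum (h s) = 0.
Proof.
move=> a0 ab b1 ha hb.
have [|s sI hs] := IVT (v := 0) ab (scale_deriv_cont a0 b1).
  by rewrite ge_min hb orbT le_max ha.
by exists s.
Qed.

Lemma summable_h (s : R) : 0 <= s < 1 -> summable (h s).
Proof. by move=> s01; apply/rapid_summable/rapid_mobius_deriv. Qed.

Let scale_deriv0 : h 0 = 1.
Proof.
apply/funext => -[|k]; rewrite scale_deriv_coef fps1E /=.
  by rewrite mobius_fps1 expr0 !mulr1.
by rewrite expr0n mulr0.
Qed.

(* Only the coefficients of index at most 4 of mobius_fps are computed; those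
   of index k + 1 > 4 are bounded by d ^ (k - 3), because bigomega (k + 1) is
   at most k - 3. *)
Lemma critical_point_general (b l A q : R) :
  A = (d%:R ^+ 3)^-1 -> 0 < b -> b < 1 -> 0 < l < 1 -> d%:R * b <= l -> (d%:R - 1) * b <= 1 ->
  psum (h b) 3 + A * tail1 l 4 <= 0 ->
  3 * d%:R * b ^+ 2 + 2 * (A * tail1 l 4) + A * tail2 l 4 <= q ->
  exists2 s : R, 0 < s <= b & fsum (h s) = 0 /\
    forall n, \sum_(i < n) `|psum (h s) i.+1| <= q.
Proof.
move=> AE b0 b1 l01 dbl db1 hb hq; have d0 : 0 < d%:R :> R by rewrite ltr0n.
have A0 : 0 <= A by rewrite AE invr_ge0 exprn_ge0.
have tb s : 0 <= s <= b -> `|psum (h s) 3 - fsum (h s)| <= A * tail1 l 4.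
  move=> /andP[s0 sb]; rewrite AE in A0 *.
  apply: (@tail_bound _ _ 4) => //; first by apply: summable_h; rewrite s0 (le_lt_trans sb).
  by move=> k; apply: scale_deriv_le => //; apply: le_trans dbl; rewrite ler_wpM2l// ltW.
have [||s /andP[s0 sb] hs] := @scale_deriv_root 0 b (lexx 0) (ltW b0) b1.
- by rewrite scale_deriv0 fsum1.
- have := tb b; rewrite (ltW b0) lexx => /(_ isT); rewrite ler_norml => /andP[]; move: hb; lra.
have s_gt0 : 0 < s.
  rewrite lt_def s0 andbT; apply/eqP => sE; move: hs.
  by rewrite sE scale_deriv0 fsum1 => /eqP; rewrite oner_eq0.
exists s; rewrite ?s_gt0 ?sb//; split=> // n.
have s01 : 0 <= s < 1 by rewrite s0 (le_lt_trans sb).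
have t3 := tb s; rewrite s0 sb hs subr0 in t3; have {}t3 := t3 isT.
(* At a critical point the full sum is 0, so each partial sum is minus a tail. *)
have tl m : \sum_(3 <= i < m) `|psum (h s) i| <= A * tail2 l 4.
  have := @tail_sum_bound _ (h s) 4 A l l01 A0 (summable_h s01) _ 3 m isT.
  rewrite hs; under eq_bigr do rewrite subr0; apply=> k k4; rewrite AE.
  by apply: scale_deriv_le => //; apply: le_trans dbl; rewrite ler_wpM2l// ltW.
apply: (@le_trans _ _ (\sum_(1 <= i < n.+3) `|psum (h s) i|)).
  rewrite big_add1 /= -(big_mkord xpredT (fun i => `|psum (h s) i.+1|)).
  have nn2 : (n <= n.+2)%N by apply: leqW.
  by rewrite (@big_cat_nat _ _ _ n 0 n.+2)//= lerDl sumr_ge0.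
rewrite big_ltn// big_ltn//; have t4 := tl n.+3.
(* The first partial sums are compared with the third, itself a tail: they differ from it by v - u
   and - u with 0 <= u <= v, so the two absolute values add up to at most v plus two tails. *)
have h12 : `|psum (h s) 1| + `|psum (h s) 2| <= 3 * d%:R * b ^+ 2 + 2 * (A * tail1 l 4).
  pose u := 2 * d%:R * (d%:R - 1) * s ^+ 3; pose v := 3 * d%:R * s ^+ 2.
  have e2 : psum (h s) 2 = psum (h s) 3 - u by rewrite psum_h3 psum_h2 /u; ring.
  have e1 : psum (h s) 1 = psum (h s) 3 + (v - u) by rewrite psum_h3 psum_h1 /u /v; ring.
  have dm1 : 0 <= d%:R - 1 :> R by rewrite subr_ge0 ler1n.
  have u0 : 0 <= u by rewrite /u !mulr_ge0 ?exprn_ge0.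
  have v0 : 0 <= d%:R * s ^+ 2 by rewrite mulr_ge0 ?exprn_ge0.
  have uv : u <= v.
    rewrite /u /v (_ : _ * s ^+ 3 = 2 * (d%:R * s ^+ 2) * ((d%:R - 1) * s)); last by ring.
    have ds : (d%:R - 1) * s <= 1 by apply: le_trans db1; rewrite ler_wpM2l.
    apply: (@le_trans _ _ (2 * (d%:R * s ^+ 2) * 1)); last by lra.
    by rewrite ler_wpM2l// mulr_ge0.
  have vb : v <= 3 * d%:R * b ^+ 2.
    by rewrite /v ler_wpM2l ?mulr_ge0// lerXn2r ?nnegrE// ltW.
  rewrite e1 e2; apply: le_trans (lerD (ler_normD _ _) (ler_normB _ _)) _.
  rewrite (ger0_norm u0) (ger0_norm (_ : 0 <= v - u)) ?subr_ge0//.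
  by move: t3 vb; lra.
by move: h12 t4 hq; lra.
Qed.
End CriticalPoint.

Section CriticalPointExistence.
Variable R : realType.
Local Notation D := (@fps_deriv R).
Local Notation critical d s q := (fsum (fps_scale s (D (@mobius_fps R d))) = 0 /\
  forall n, \sum_(i < n) `|psum (fps_scale s (D (@mobius_fps R d))) i.+1| <= q).

Local Notation h s := (fps_scale s (D (@mobius_fps R 1))).
(** For d = 1 the estimate of [critical_point_general] stays above 1/2: it forces b >= 1/3, and 3
    b^2 with the two [tail1] terms already exceeds 1/2. Hence partial sums are computed up to index
    5 and s is bracketed in [32/100, 1/3]. *)
Lemma critical_point_1 : exists2 s : R, 0 < s < 1 & critical 1 s (99 / 200).
Proof.
have h4 s : psum (h s) 4 = 1 - 2 * s - 3 * s ^+ 2 - 5 * s ^+ 4.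
  rewrite psumS psum_h3// scale_deriv_coef /mobius_fps /mobius_coef.
  by rewrite (_ : mobius_pow 1 5 = -1)// rmorphN1; ring.
have h5 s : psum (h s) 5 = 1 - 2 * s - 3 * s ^+ 2 - 5 * s ^+ 4 + 6 * s ^+ 5.
  rewrite psumS h4 scale_deriv_coef /mobius_fps /mobius_coef.
  by rewrite (_ : mobius_pow 1 6 = 1)//; ring.
have hN (s : R) k : 0 <= s <= 1 / 3 -> (6 <= k)%N -> `|h s k| <= 1 * (k.+1%:R * (1 / 3) ^+ k).
  move=> /andP[s0 s3] _; rewrite mul1r scale_deriv_coef !normrM normr_nat -mulrA.
  rewrite ler_wpM2l// -[leRHS]mul1r; apply: ler_pM => //.
    by have := @mobius_fps_le R 1 k.+1 isT; rewrite exp1n.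
  by rewrite normrX ger0_norm// lerXn2r ?nnegrE.
have l01 : 0 < (1 / 3 : R) < 1 by apply/andP; split; lra.
have sh (s : R) : 0 <= s <= 1 / 3 -> summable (h s).
  by move=> /andP[s0 s3]; apply: summable_h; rewrite s0 /=; lra.
have tb (s : R) : 0 <= s <= 1 / 3 -> `|psum (h s) 5 - fsum (h s)| <= 1 * tail1 (1 / 3) 6.
  by move=> s3; apply: (@tail_bound _ _ 6) => //; [exact: sh|move=> k; exact: hN].
have t1 : tail1 (1 / 3 : R) 6 = 45 / 2916 by rewrite /tail1; field.
have t2 : tail2 (1 / 3 : R) 6 = 18 / 729 by rewrite /tail2; field.
have a0 : 0 <= 32 / 100 :> R by lra.
have [||||s /andP[sa sb] hs] := @scale_deriv_root R 1 (32 / 100) (1 / 3) a0.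
- by lra.
- by lra.
- have := tb (32 / 100); rewrite h5 t1 ler_norml => H.
  have /H/andP[_] : 0 <= (32 / 100 : R) <= 1 / 3 by apply/andP; split; lra.
  move: (fsum _) => F; lra.
- have := tb (1 / 3); rewrite h5 t1 ler_norml => H.
  have /H/andP[+ _] : 0 <= (1 / 3 : R) <= 1 / 3 by apply/andP; split; lra.
  move: (fsum _) => F; lra.
exists s; first by apply/andP; split; lra.
split=> // n.
have s03 : 0 <= s <= 1 / 3 by apply/andP; split; lra.
have tl m : \sum_(5 <= i < m) `|psum (h s) i| <= 1 * tail2 (1 / 3) 6.
  have := @tail_sum_bound _ (h s) 6 1 (1 / 3) l01 ler01 (sh _ s03) _ 5 m isT.
  by rewrite hs; under eq_bigr do rewrite subr0; apply=> k; exact: hN.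
apply: (@le_trans _ _ (\sum_(1 <= i < n.+1.+4) `|psum (h s) i|)).
  rewrite big_add1 /= -(big_mkord xpredT (fun i => `|psum (h s) i.+1|)).
  have nn : (n <= n.+4)%N by rewrite !leqW.
  by rewrite (@big_cat_nat _ _ _ n 0 n.+4)//= lerDl sumr_ge0.
do 4 (rewrite big_ltn//).
have := tl n.+1.+4; rewrite mul1r t2.
have p1 : psum (h s) 1 = 1 - 2 * s by rewrite psum_h1//; ring.
have p2 : psum (h s) 2 = 1 - 2 * s - 3 * s ^+ 2 by rewrite psum_h2//; ring.
have p3 : psum (h s) 3 = 1 - 2 * s - 3 * s ^+ 2 by rewrite psum_h3//; ring.
rewrite h4 p1 p2 p3.
move: (\sum_(_ <= _ < _) _) => T hT.
have s2 : (32 / 100) ^+ 2 <= s ^+ 2 by rewrite lerXn2r ?nnegrE//; lra.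
have s2' : s ^+ 2 <= (1 / 3) ^+ 2 by rewrite lerXn2r ?nnegrE//; lra.
have s4 : (32 / 100) ^+ 4 <= s ^+ 4 by rewrite lerXn2r ?nnegrE//; lra.
have s4' : s ^+ 4 <= s ^+ 2 * (1 / 3) ^+ 2 by rewrite (exprD s 2 2) ler_wpM2l ?sqr_ge0.
rewrite (ger0_norm (_ : 0 <= 1 - 2 * s)); last by lra.
rewrite (ger0_norm (_ : 0 <= 1 - 2 * s - 3 * s ^+ 2)); last by lra.
(* This partial sum changes sign on the bracket, so both signs are estimated. *)
have [h0|h0] := leP 0 (1 - 2 * s - 3 * s ^+ 2 - 5 * s ^+ 4).
  by rewrite ger0_norm//; lra.
by rewrite ltr0_norm//; lra.
Qed.

Lemma critical_point_2 : exists2 s : R, 0 < s < 1 & critical 2 s (9 / 20).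
Proof.
have p2 : (3 / 7) ^+ 2 <= 37 / 200 :> R by rewrite expr2; lra.
have p4 : (3 / 7) ^+ 4 <= 7 / 200 :> R.
  rewrite (exprM _ 2 2); apply: (@le_trans _ _ ((37 / 200) ^+ 2)).
    by rewrite lerXn2r ?nnegrE//; rewrite expr2; lra.
  by rewrite expr2; lra.
have t1 : tail1 (3 / 7 : R) 4 <= 7 / 200 * (10 + 1 / 16).
  rewrite /tail1 (_ : _ / _ + _ = 10 + 1 / 16); first by rewrite ler_wpM2r//; lra.
  by field.
have t2 : tail2 (3 / 7 : R) 4 <= 7 / 200 * (20 - 3 / 32).
  rewrite /tail2 (_ : _ / _ + _ = 20 - 3 / 32); first by rewrite ler_wpM2r//; lra.
  by field.
have e : (2%:R ^+ 3)^-1 = 1 / 8 :> R by field.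
(* The ratio 3/7 lies just above d b = 42/100 and keeps 1 - l a simple fraction. *)
have [|||||||s /andP[s0 sb] hs] :=
  @critical_point_general R 2 isT (21 / 100) (3 / 7) (1 / 8) (9 / 20) (esym e).
- by lra.
- by lra.
- by apply/andP; split; lra.
- by lra.
- by lra.
- rewrite psum_h3//; move: t1; move: (tail1 _ _) => T; lra.
- move: t1 t2; move: (tail1 _ _) (tail2 _ _) => T T'; lra.
by exists s => //; rewrite s0 /=; lra.
Qed.

(** With b = 1 / (2d) the product d b is 1/2 for every d, and all conditions become polynomial
    inequalities in u = 1/d on ]0, 1/3]. For d = 2 this b would give a bound above 1/2, hence the
    smaller b there. *)
Lemma critical_point_ge3 d : (3 <= d)%N -> exists2 s : R, 0 < s < 1 & critical d s (9 / 20).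
Proof.
move=> d3; have d1 : (1 <= d)%N by apply: leq_trans d3.
have dd : 3 <= d%:R :> R by rewrite ler_nat.
pose u : R := d%:R^-1.
have du : d%:R * u = 1 by rewrite mulfV// gt_eqF//; lra.
have u0 : 0 < u by rewrite invr_gt0; lra.
have u3 : u <= 1 / 3 by rewrite -(ler_pM2l (_ : 0 < d%:R)) ?du; lra.
have u2 : u ^+ 2 <= u / 3 by rewrite expr2; nra.
have u2' : 0 <= u ^+ 2 by rewrite sqr_ge0.
have uu : u ^+ 3 <= u / 9 by rewrite exprS; nra.
have t1 : tail1 (1 / 2 : R) 4 = 3 / 4 by rewrite /tail1; field.
have t2 : tail2 (1 / 2 : R) 4 = 7 / 4 by rewrite /tail2; field.
have e : (d%:R ^+ 3)^-1 = u ^+ 3 by rewrite /u exprVn.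
have [|||||||s /andP[s0 sb] hs] :=
  @critical_point_general R d d1 (u / 2) (1 / 2) (u ^+ 3) (9 / 20) (esym e).
- by lra.
- by lra.
- by apply/andP; split; lra.
- by rewrite mulrA du.
- by rewrite mulrBl mulrA du; lra.
- rewrite psum_h3// t1.
  rewrite (_ : 1 - _ - _ + _ = 1 - (d%:R * u) - 3 / 4 * ((d%:R * u) * u) +
    1 / 4 * ((d%:R * u) * ((d%:R * u) - u) * u)); last by field.
  by rewrite du; lra.
- rewrite t1 t2 (_ : 3 * d%:R * (u / 2) ^+ 2 = 3 / 4 * ((d%:R * u) * u)); last by field.
  by rewrite du; lra.
by exists s => //; rewrite s0 /=; lra.
Qed.

Lemma critical_point_exists d : (1 <= d)%N ->
  exists s q : R, [/\ 0 < s < 1, 0 <= q, q < 1 / 2 & critical d s q].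
Proof.
case: d => // -[_|[_|d _]].
- have [s hs hc] := critical_point_1; exists s, (99 / 200); split=> //; lra.
- have [s hs hc] := critical_point_2; exists s, (9 / 20); split=> //; lra.
- have [s hs hc] := @critical_point_ge3 d.+3 isT; exists s, (9 / 20); split=> //; lra.
Qed.
End CriticalPointExistence.

(** * The Moebius series near its critical point, and the asymptotics *)

Section MobiusSeriesFunction.
Variables (R : realType) (d : nat).
Local Notation D := (@fps_deriv R).
Local Notation g := (@mobius_fps R d).

Lemma mobius_seriesE (z : R) : 0 <= z < 1 -> mobius_series d z = fsum (fps_scale z g).
Proof.
move=> z01; apply: cvg_lim => //; apply: (@pseries_cvg _ g).
exact/rapid_summable/rapid_mobius.
Qed.

Let near_itv (z : R) : 0 < z < 1 -> \forall x \near z, 0 < x < 1.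
Proof.
move=> /andP[z0 z1]; have : \forall x \near z, x \in `]0, 1[%R.
  by apply: near_in_itvoo; rewrite in_itv /= z0.
by apply: filterS => x; rewrite in_itv.
Qed.

Lemma mobius_series_derive1 (z : R) : 0 < z < 1 ->
  derive1 (@mobius_series R d) z = fsum (fps_scale z (D g)).
Proof.
move=> z01; have /andP[z0 z1] := z01.
have [h _] : is_derive z 1 (fun x => fsum (fps_scale x g)) (fsum (fps_scale z (D g))) /\
    is_derive z 1 (fun x => fsum (fps_scale x (D g))) (fsum (fps_scale z (D (D g)))).
  by apply: mobius_fsum_derive; rewrite ger0_norm// ltW.
rewrite derive1E; apply: derive_val; apply: near_eq_is_derive h.
by apply: filterS (near_itv z01) => x /andP[x0 x1]; rewrite mobius_seriesE ?x1 ?ltW.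
Qed.

Lemma mobius_series_derive2 (z : R) : 0 < z < 1 ->
  derive1n 2 (@mobius_series R d) z = fsum (fps_scale z (D (D g))).
Proof.
move=> z01; have /andP[z0 z1] := z01.
have [_ h] : is_derive z 1 (fun x => fsum (fps_scale x g)) (fsum (fps_scale z (D g))) /\
    is_derive z 1 (fun x => fsum (fps_scale x (D g))) (fsum (fps_scale z (D (D g)))).
  by apply: mobius_fsum_derive; rewrite ger0_norm// ltW.
rewrite derive1nS derive1n1 derive1E; apply: derive_val; apply: near_eq_is_derive h.
by apply: filterS (near_itv z01) => x x01; rewrite mobius_series_derive1.
Qed.

Lemma mobius_series_radius (z : R) : 0 < z < 1 ->
  (z%:E < convergence_radius (@mobius_coef R d))%E.
Proof.
move=> /andP[z0 z1]; pose r := (z + 1) / 2.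
have r0 : 0 <= r by rewrite /r; lra.
have r1 : r < 1 by rewrite /r; lra.
apply: (@lt_le_trans _ _ r%:E); first by rewrite lte_fin /r; lra.
apply: ereal_sup_ubound; exists r; last by rewrite ger0_norm.
apply/cvg_ex; exists (fsum (fps_scale r g)); apply: (@pseries_cvg _ g).
by apply/rapid_summable/rapid_mobius; rewrite r0.
Qed.

Variables (s q : R).
Hypotheses (s01 : 0 < s < 1) (q1 : q < 1 / 2) (hs : fsum (fps_scale s (D g)) = 0).
Hypothesis hq : forall n, \sum_(i < n) `|psum (fps_scale s (D g)) i.+1| <= q.

Local Notation h := (fps_scale s (D g)).
Let s0 : 0 < s. Proof. by case/andP: s01. Qed.
Let s01' : 0 <= s < 1. Proof. by case/andP: s01 => ? ->; rewrite ltW. Qed.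
Let rh : rapid h. Proof. exact: rapid_mobius_deriv. Qed.
Let rGh : rapid (fps_geom R * h). Proof. exact: rapid_geom. Qed.

Let Gh0 : (fps_geom R * h) 0%N = 1. Proof. exact: psum_h0. Qed.

Let Gh_gt0 (y : R) : 0 <= y <= 1 -> 0 < fsum (fps_scale y (fps_geom R * h)).
Proof.
move=> y01; apply: (@fsum_scale_gt0 _ y q) => //.
- exact: rapid_summable.
- by rewrite Gh0.
- by have := q1; lra.
- by move=> n; rewrite Gh0 mulr1; apply: hq.
Qed.

(** The derivative at c is 1 - c / s times the value at c / s of h / (1 - X), which is positive on
    [0, 1] because its constant coefficient 1 dominates. Thus s is the first zero. *)
Lemma mobius_deriv_gt0 (c : R) : 0 <= c < s -> 0 < fsum (fps_scale c (D g)).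
Proof.
move=> /andP[c0 cs]; have -> : fps_scale c (D g) = fps_scale (c / s) h.
  apply/funext => n; rewrite /fps_scale -mulrA -exprMn.
  by rewrite [s * _]mulrC divfK// gt_eqF.
have y01 : 0 <= c / s <= 1 by rewrite divr_ge0 ?(ltW s0)//= ler_pdivrMr// mul1r ltW.
rewrite -(fps_geomK h) fsum_scale_1subX//; last exact: rapid_summable.
by rewrite mulr_gt0 ?Gh_gt0// subr_gt0 ltr_pdivrMr// mul1r.
Qed.

Lemma mobius_fsum_gt0 : 0 < fsum (fps_scale s g).
Proof.
pose M (x : R) := fsum (fps_scale x g); pose M' (x : R) := fsum (fps_scale x (D g)).
have dM x : 0 <= x <= s -> is_derive x 1 M (M' x).
  move=> /andP[x0 xs]; case: (@mobius_fsum_derive R d x) => //.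
  by rewrite ger0_norm//; apply: le_lt_trans xs _; case/andP: s01.
have [||c cI] := @MVT _ M M' 0 s s0.
- by move=> x; rewrite in_itv /= => /andP[x0 xs]; apply: dM; rewrite !ltW.
- by apply: derivable_within_continuous => x; rewrite in_itv /= => /dM [].
move: cI; rewrite in_itv /= => /andP[c0 cs]; rewrite subr0.
have -> : M 0 = 0.
  rewrite /M; apply: fsum_lim; rewrite (_ : psum _ = cst 0); first exact: cvg_cst.
  apply/funext => k; rewrite psumE big1// => -[[|i] hi] _; rewrite /fps_scale /=.
    by rewrite /mobius_fps /mobius_coef mobius_pow0 mul0r.
  by rewrite expr0n mulr0.
rewrite subr0 /M => ->; rewrite mulr_gt0//; apply: mobius_deriv_gt0.
by rewrite (ltW c0).
Qed.

Let hd : D h = fps_const s * fps_scale s (D (D g)).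
Proof.
apply/funext => n; rewrite fps_constM /fps_scale /fps_deriv exprS; ring.
Qed.

Let sDD : summable (fps_scale s (D (D g))).
Proof.
rewrite (_ : fps_scale _ _ = fps_const s^-1 * D h); last first.
  by rewrite hd mulrA -rmorphM mulVf ?gt_eqF// rmorph1 mul1r.
apply: summableM; first exact: summable_const.
exact/rapid_summable/rapid_deriv.
Qed.

Lemma mobius_fsum_deriv2_lt0 : fsum (fps_scale s (D (D g))) < 0.
Proof.
have := @Gh_gt0 1; rewrite fps_scale_1 fsum_geom// hd fsumM//; last exact: summable_const.
rewrite fsum_const ler01 lexx => /(_ isT).
by rewrite oppr_gt0 pmulr_rlt0.
Qed.

Lemma critical_smallest : smallest_critical_point d s.
Proof.
split.
  split=> //; first exact: mobius_series_radius.
  by rewrite mobius_series_derive1.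
move=> t [t0 _ ht]; rewrite leNgt; apply/negP => ts.
have t01 : 0 < t < 1 by rewrite t0 (lt_trans ts)//; case/andP: s01.
move: ht; rewrite mobius_series_derive1// => /eqP.
by rewrite gt_eqF// mobius_deriv_gt0// (ltW t0).
Qed.

Hypothesis q0 : 0 <= q.

Lemma num_decompositions_asymp :
  asymp_equiv
    (fun n => (num_decompositions R d n)%:R)
    (fun n => (Num.sqrt (- (2 * pi * derive1n 2 (@mobius_series R d) s)))^-1
              * n%:R `^ (- (3 / 2))
              * mobius_series d s `^ (1 / 2 - n%:R)).
Proof.
have r0 := mobius_fsum_gt0; have M2 := mobius_fsum_deriv2_lt0.
rewrite mobius_series_derive2// mobius_seriesE//.
set r := fsum (fps_scale s g) in r0 *; set M := fsum _ in M2 *.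
pose F := dec_series R d.
pose m := fps_const r^-1 * fps_scale s g.
pose a := fps_const s^-1 * fps_scale r F.
have rg : rapid (fps_scale s g) by apply: rapid_mobius.
(* Chosen so that s K is the midpoint of s and 1: the rescaled series m still converges beyond 1. *)
pose K := (s + 1) / 2 / s.
have K1 : 1 < K by rewrite /K ltr_pdivlMr// mul1r; case/andP: s01; lra.
have sK : s * K = (s + 1) / 2 by rewrite /K mulrC divfK// gt_eqF.
clearbody K.
have [C hC] : exists C, forall n, `|m n| * K ^+ n <= C.
  have r01 : 0 <= (s + 1) / 2 < 1 by case/andP: s01 => ? ?; apply/andP; split; lra.
  have [C hC] := rapid_mobius d r01 0.
  exists (r^-1 * C) => n; rewrite /m fps_constM normrM gtr0_norm ?invr_gt0//.
  rewrite -mulrA ler_wpM2l ?invr_ge0 ?(ltW r0)//.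
  apply: le_trans (hC n); rewrite expr0 mul1r /fps_scale -sK exprMn.
  have K0 : 0 <= K ^+ n by rewrite exprn_ge0// ltW// (lt_trans ltr01).
  by move: (K ^+ n) K0 => Kn K0; rewrite mulrA [leRHS]normrM (ger0_norm K0).
have Dm : D m = fps_const (s / r) * h.
  apply/funext => n; rewrite /m /fps_deriv !fps_constM /fps_scale exprS; ring.
have m1 : m 1%N = s / r.
  by rewrite /m fps_constM /fps_scale mobius_fps1 expr1 mul1r mulrC.
have dec0 : F 0%N = 0 by apply: dec_series0.
have ma : fps_comp m a = fpsX R.
  apply/funext => n; have := congr1 (fun f => f n) (mobius_comp_dec_series R d).
  rewrite /= -/F => hn.
  have -> : fps_comp m a n = r^-1 * r ^+ n * fps_comp g F n.
    rewrite /fps_comp mulr_sumr; apply: eq_bigr => k _.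
    rewrite /m /a exprMn -rmorphXn -fps_scaleXn !fps_constM /fps_scale.
    rewrite exprVn; have : s ^+ k != 0 by rewrite expf_neq0// gt_eqF.
    by move: (s ^+ k) => x x0; field; rewrite x0 gt_eqF.
  rewrite hn /fpsX; case: eqP => [->|_]; last by rewrite mulr0.
  by rewrite expr1 mulVf ?mulr1// gt_eqF.
have sh : summable h by apply: rapid_summable.
have DDm : D (D m) = fps_const (s ^+ 2 / r) * fps_scale s (D (D g)).
  apply/funext => n; rewrite Dm /fps_deriv !fps_constM /fps_scale /fps_deriv exprS; ring.
have nE n : (num_decompositions R d n)%:R = F n by rewrite -num_decompositionsE.
have fsm : fsum m = 1.
  rewrite fsumM; [|exact: summable_const|exact: rapid_summable].
  by rewrite fsum_const mulVf// gt_eqF.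
have fsDm : fsum (D m) = 0.
  by rewrite Dm fsumM; [rewrite hs mulr0|exact: summable_const|].
have m10 : 0 < m 1%N by rewrite m1 divr_gt0.
have fsDDm : fsum (D (D m)) = s ^+ 2 / r * M.
  by rewrite DDm fsumM; [rewrite fsum_const|exact: summable_const|].
have tl n : \sum_(i < n) `|\sum_(k < i.+2) k.+1%:R * m k.+1| <= q * m 1%N.
  rewrite m1 mulrC; have sr0 : 0 < s / r by rewrite divr_gt0.
  apply: le_trans (ler_wpM2l (ltW sr0) (hq n)); rewrite mulr_sumr; apply: ler_sum => i _.
  rewrite -(gtr0_norm sr0) -normrM psumE mulr_sumr.
  suff -> : \sum_(k < i.+2) k.+1%:R * m k.+1 = \sum_(k < i.+2) s / r * h k by [].
  by apply: eq_bigr => k _; have := congr1 (fun f => f (k : nat)) Dm; rewrite fps_constM => <-.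
have m0 : m 0%N = 0.
  by rewrite /m fps_constM /fps_scale /mobius_fps /mobius_coef mobius_pow0 mul0r mulr0.
have a0 : a 0%N = 0 by rewrite /a fps_constM /fps_scale dec0 mul0r mulr0.
have age0 n : 0 <= a n.
  rewrite /a fps_constM /fps_scale -nE.
  by rewrite mulr_ge0 ?invr_ge0 ?(ltW s0)// mulr_ge0// exprn_ge0// ltW.
have := inversion_asymptotics K1 hC m0 fsm fsDm m10 q0 q1 tl a0 age0 ma.
rewrite fsDDm => lim; rewrite /asymp_equiv.
set A := Num.sqrt (- (2 * pi * M)).
have A0 : 0 < A by rewrite sqrtr_gt0 oppr_gt0 pmulr_rlt0// mulr_gt0// pi_gt0.
(* As m''(1) = s^2 M_d''(s) / M_d(s), rescaling multiplies the constant by s / sqrt(r). The s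
   cancels the normalisation of a, and sqrt(r) accounts for the 1/2 in the exponent 1/2 - n. *)
pose c := s / Num.sqrt r * A.
have sr0 : 0 < Num.sqrt r by rewrite sqrtr_gt0.
have c0 : 0 < c by rewrite mulr_gt0// divr_gt0.
have cE : Num.sqrt (- (2 * pi * (s ^+ 2 / r * M))) = c.
  rewrite (_ : - _ = s ^+ 2 / r * (- (2 * pi * M))); last by ring.
  rewrite sqrtrM ?divr_ge0 ?sqr_ge0 ?(ltW r0)// sqrtrM ?sqr_ge0// sqrtr_sqr gtr0_norm//.
  by rewrite sqrtrV// ltW.
rewrite cE in lim.
have lim1 : (fun n => c * (a n * (n%:R * Num.sqrt n%:R))) @ \oo --> (1 : R).
  by rewrite -[X in _ --> X](@mulfV _ c) ?gt_eqF//; apply: cvgMl_tmp; exact: lim.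
apply: cvg_trans lim1; apply: near_eq_cvg.
(* At n = 0 the power n^(-3/2) takes a default value, so the comparison is made for positive n. *)
near=> n; have n0 : (0 < n)%N by near: n; exact: nbhs_infty_gt.
have nr0 : 0 < n%:R :> R by rewrite ltr0n.
have sn0 : 0 < Num.sqrt (n%:R : R) by rewrite sqrtr_gt0.
have -> : n%:R `^ (- (3 / 2)) = (n%:R * Num.sqrt n%:R)^-1 :> R.
  rewrite powRN (_ : 3 / 2 = 1 + 2^-1); last by field.
  by rewrite powRD ?powRr1 ?powR12_sqrt ?ler0n// (gt_eqF nr0) implybT.
have -> : r `^ (1 / 2 - n%:R) = Num.sqrt r / r ^+ n.
  rewrite powRB ?(gt_eqF r0) ?implybT// mul1r powR12_sqrt ?ltW//.
  by rewrite powR_mulrn// ltW.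
rewrite nE /c /a fps_constM /fps_scale.
have rn0 : r ^+ n != 0 by rewrite expf_neq0// gt_eqF.
move: (r ^+ n) rn0 => rn rn0; field.
by rewrite rn0 !gt_eqF.
Unshelve. all: by end_near.
Qed.
End MobiusSeriesFunction.

Unset Implicit Arguments.

Theorem theorem14 (R : realType) (d : nat) (hd : (1 <= d)%N) :
  (exists s : R, smallest_critical_point d s) /\
  (forall s : R, smallest_critical_point d s ->
    asymp_equiv
      (fun n => (num_decompositions R d n)%:R)
      (fun n => (Num.sqrt (- (2 * pi * derive1n 2 (@mobius_series R d) s)))^-1
                * n%:R `^ (- (3 / 2))
                * mobius_series d s `^ (1 / 2 - n%:R))).
Proof.
have [s [q [s01 q0 q1 [hs hq]]]] := @critical_point_exists R d hd.
have cs := critical_smallest s01 q1 hs hq.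
split; first by exists s.
move=> t [ct mt]; have -> : t = s by apply/le_anti; rewrite mt ?cs.2//; exact: cs.1.
exact: (num_decompositions_asymp s01 q1 hs hq q0).
Qed.
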